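(* Let $C\ge1$ be an odd integer and let $j_c=\lceil C/2\rceil$. For $0<\lambda<1$ put $A_\lambda=(1-\lambda)^{-1}$, $\lambda_-:=A_\lambda^{-1}\lambda^{j_c}$ and $\lambda_+:=A_\lambda\lambda^{j_c}$. Then the following two properties hold. (1) If $\left(\frac{\gamma}{b}\right)^{1/j_c}\le\lambda<1$ with $\gamma>e$, then, for any $b$ large enough depending on $\gamma$, the smallest fixed point of $x\mapsto A_\lambda^{2}J_2^{(\lambda_-)}(x)$ is strictly smaller than the largest fixed point of $x\mapsto A_\lambda^{-2}J_2^{(\lambda_+)}(x)$ (both maps on $[0,\infty)$). In particular, there is phase coexistence for the multi-state hard core model with capacity $C$ and activity $\lambda$ on $\mathbb{T}^b$. (2) If $0<\lambda\le\left(\frac{\gamma'}{b}\right)^{1/j_c}$ with $\gamma'<e$, then, for every $b$ large enough depending on $\gamma'$, there is a unique Gibbs measure for the multi-state hard core model with capacity $C$ and activity $\lambda$ on $\mathbb{T}^b$.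
   Context: For $\ell>0$ and integer $b\ge2$, $J_2^{(\ell)}(x)=\dfrac{\ell}{\bigl(1+\frac{\ell}{(1+x)^b}\bigr)^b}$, $x\ge0$. The capacity $C$ is fixed, so thresholds for $b$ may also depend on $C$. $\mathbb{T}^b$ is the infinite rooted $b$-ary tree: the infinite graph without cycles in which the root $r$ has exactly $b$ neighbors and every other vertex has exactly $b+1$ neighbors. For a graph $G=(V,E)$ and an integer $C\ge 1$, put $S_C=\{0,1,\dots,C\}$ and let $\Omega_G=\{\sigma\in S_C^V:\ \sigma_x+\sigma_y\le C \text{ for every } xy\in E\}$ be the set of allowable configurations. For a finite graph $G$ and activity $\lambda>0$, $\mu_{G,\lambda}$ is the probability measure on $\Omega_G$ with $\mu_{G,\lambda}(\sigma)\propto\prod_{v\in V}\lambda^{\sigma_v}$. For $U\subset V$, $\partial U=\{x\in V\setminus U: xz\in E\text{ for some }z\in U\}$, $\overline U=U\cup\partial U$, $G[\overline U]$ is the restriction (induced subgraph) of $G$ to $\overline U$, and $\sigma_U$ is the restriction of $\sigma$ to $U$. A Gibbs measure on $G$ with capacity $C$ and activity $\lambda$ is a probability measure $\mu$ on $S_C^V$ (with the product $\sigma$-field), concentrated on $\Omega_G$, such that for every finite $U\subset V$ and $\mu$-almost every $\tau$, $\mu(\sigma_U=\tau_U\mid\sigma_{V\setminus U}=\tau_{V\setminus U})=\mu_{G[\overline U],\lambda}(\sigma_U=\tau_U\mid\sigma_{\partial U}=\tau_{\partial U})$. Phase coexistence at $\lambda$ means that there is more than one Gibbs measure for the activity $\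lambda$.
   Formalization: In (1) the fixed-point comparison is proved for λ ≤ λ_max with any λ_max < 1, b large depending on γ, C and λ_max, since for fixed b it fails as λ→1; phase coexistence is proved for all λ < 1 with b large depending only on γ and C. In (2), γ' > 0. *)

(* Defs.v *)
From HB Require Import structures.
From mathcomp Require Import all_boot all_order all_algebra finmap.
From mathcomp Require Import all_classical all_reals all_analysis.
Set Implicit Arguments.
Unset Strict Implicit.
Unset Printing Implicit Defensive.
Import Order.TTheory GRing.Theory Num.Theory.
Import numFieldNormedType.Exports.
Local Open Scope classical_set_scope.
Local Open Scope ring_scope.

HB.instance Definition _ (n : nat) := isPointed.Build 'I_n.+1 ord0.

(* A graph is an adjacency relation [e : rel V]; states S_C are ['I_C.+1]. *)
Definition allowable (V : Type) (C : nat) (e : rel V) (s : V -> 'I_C.+1) : Prop :=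
  forall x y, e x y -> (s x + s y <= C)%N.

Section FiniteGraph.
Variables (R : realType) (V : finType) (C : nat) (e : rel V) (lambda : R).
Local Notation conf := {ffun V -> 'I_C.+1}.

Definition weight (s : conf) : R := \prod_(v : V) lambda ^+ s v.

Definition fin_mu (A : set conf) : R :=
  (\sum_(s : conf | `[< allowable e s /\ A s >]) weight s) /
  (\sum_(s : conf | `[< allowable e s >]) weight s).

Definition fin_cond_mu (A B : set conf) : R := fin_mu (A `&` B) / fin_mu B.
End FiniteGraph.

Section Boundary.
Variables (V : choiceType) (e : rel V).

(* [fset_set] is junk (empty) on infinite sets; for locally finite graphs the
   set below is finite, see [mem_boundary] and [tree_locally_finite]. *)
Definition boundary (U : {fset V}) : {fset V} :=
  fset_set [set x | x \notin U /\ exists2 z, z \in U & e x z].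

Definition closure_fset (U : {fset V}) : {fset V} := (U `|` boundary U)%fset.

Definition induced (W : {fset V}) : rel W := fun x y => e (val x) (val y).

Definition locally_finite : Prop :=
  forall z, finite_set [set x | e x z].

Lemma mem_boundary (U : {fset V}) (x : V) : locally_finite ->
  x \in boundary U <-> x \notin U /\ exists2 z, z \in U & e x z.
Proof.
move=> lf; rewrite in_fset_set ?inE //.
apply: (@sub_finite_set _ _ (\bigcup_(z in [set` U]) [set x | e x z])).
  by move=> y /= [_ [z zU eyz]]; exists z.
by apply: bigcup_finite => // z _; exact: lf.
Qed.
End Boundary.

Section InfiniteGraph.
Variables (R : realType) (V : countType) (C : nat) (e : rel V) (lambda : R).

Definition cylinders (W : set V) : set (set (V -> 'I_C.+1)) :=
  [set [set s : V -> 'I_C.+1 | s v = i] | v in W & i in [set: 'I_C.+1]].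

(* S_C^V with the product sigma-field *)
Definition config := g_sigma_algebraType (cylinders [set: V]).

(* [f] is a version of the conditional probability mu(A | F) *)
Definition is_cond_prob (mu : probability config R) (F : set (set config))
    (A : set config) (f : config -> R) : Prop :=
  [/\ forall B : set R, measurable B -> F (f @^-1` B),
      mu.-integrable [set: config] (EFin \o f) &
      forall D, F D -> (\int[mu]_(t in D) (f t)%:E = mu (A `&` D))%E].

(* the sigma-field generated by the restriction of configurations to V \ U *)
Definition outside (U : {fset V}) : set (set config) :=
  <<s cylinders [set v | v \notin U] >>.

Definition restr (U : {fset V}) (t : config) : {ffun U -> 'I_C.+1} :=
  [ffun x : U => t (val x)].

Definition local_spec (U : {fset V}) (t : config) : R :=
  let W := closure_fset e U in
  fin_cond_mu (@induced V e W) lambda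
    [set s : {ffun W -> 'I_C.+1} |
      forall x : W, val x \in U -> s x = t (val x)]
    [set s : {ffun W -> 'I_C.+1} |
      forall x : W, val x \in boundary e U -> s x = t (val x)].

(* [k eta] plays the role of mu(sigma_U = eta | sigma_(V \ U)); versions are
   unique up to null sets, so the condition does not depend on the choice of [k]. *)
Definition is_gibbs (mu : probability config R) : Prop :=
  {ae mu, forall t, allowable e t} /\
  forall U : {fset V},
    exists k : {ffun U -> 'I_C.+1} -> config -> R,
      (forall eta, is_cond_prob mu (outside U) [set s | restr U s = eta] (k eta)) /\
      {ae mu, forall t, k (restr U t) t = local_spec U t}.

(* Measures are compared on measurable sets only. *)
Definition phase_coexistence : Prop :=
  exists mu nu : probability config R,
    [/\ is_gibbs mu, is_gibbs nu & exists2 A, measurable A & mu A <> nu A].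

Definition unique_gibbs : Prop :=
  exists2 mu : probability config R, is_gibbs mu &
    forall nu : probability config R, is_gibbs nu ->
      forall A, measurable A -> nu A = mu A.
End InfiniteGraph.

(* The infinite rooted b-ary tree: vertices are words over {0, ..., b-1}, the
   root is the empty word and the children of [x] are the words [i :: x]. *)
Definition tree_edge (b : nat) : rel (seq 'I_b) :=
  fun x y => [exists i, y == i :: x] || [exists i, x == i :: y].

Lemma tree_locally_finite (b : nat) : locally_finite (@tree_edge b).
Proof.
move=> z; apply: (@sub_finite_set _ _
  ([set behead z] `|` (fun i => i :: z) @` [set: 'I_b])).
  move=> x /= /orP[] /existsP[i /eqP ->]; first by left.
  by right; exists i.
by rewrite finite_setU; split=> //; exact/finite_image/finite_finset.
Qed.

Section FixedPoints.
Variable R : realType.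

Definition J2 (b : nat) (l x : R) : R :=
  l / (1 + l / (1 + x) ^+ b) ^+ b.

(* fixed points of self-maps of [0, +oo) *)
Definition is_fixpoint (f : R -> R) (x : R) : Prop := 0 <= x /\ f x = x.

Definition is_least_fixpoint (f : R -> R) (x : R) : Prop :=
  is_fixpoint f x /\ forall y, is_fixpoint f y -> x <= y.

Definition is_greatest_fixpoint (f : R -> R) (x : R) : Prop :=
  is_fixpoint f x /\ forall y, is_fixpoint f y -> y <= x.

Definition A_ (lambda : R) : R := (1 - lambda)^-1.
Definition jc (C : nat) : nat := uphalf C.
Definition lambda_minus (C : nat) (lambda : R) : R :=
  (A_ lambda)^-1 * lambda ^+ jc C.
Definition lambda_plus (C : nat) (lambda : R) : R :=
  A_ lambda * lambda ^+ jc C.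

Definition fixpoints_separated (C b : nat) (lambda : R) : Prop :=
  exists x y : R,
    [/\ is_least_fixpoint
          (fun t => A_ lambda ^+ 2 * J2 b (lambda_minus C lambda) t) x,
        is_greatest_fixpoint
          (fun t => A_ lambda ^- 2 * J2 b (lambda_plus C lambda) t) y &
        x < y].
End FixedPoints.

(* Main.v *)
From HB Require Import structures.
Require Import Defs.
From mathcomp Require Import all_boot all_order all_algebra finmap.
From mathcomp Require Import all_classical all_reals all_analysis.
From mathcomp Require Import measurable_realfun.
From mathcomp Require Import zify ring lra.
Set Implicit Arguments.
Unset Strict Implicit.
Unset Printing Implicit Defensive.
Import Order.TTheory GRing.Theory Num.Theory.
Import numFieldNormedType.Exports.
Local Open Scope classical_set_scope.
Local Open Scope ring_scope.

(* Write [j = jc C], so that [C = 2 j - 1], and call a spin occupied when it is at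
   least [j].  If all vertices at distance [n] from the root are given spin 0, the
   distribution function [F_n] of the root satisfies [F_0 = 1] and
   [F_(n+1) (m) ~ sum_(k <= m) lambda^k F_n (C - k)^b].  The odds [x_n] that the
   root is occupied then satisfy
     [L x_n <= x_(n+1) <= U x_n],  [U x = A lambda^j / (1+x)^b],
     [L x = A^-1 lambda^j / (1+x)^b],
   for every [A >= sum_(r < j) lambda^r]; both [(1 - lambda)^-1] and [j] are such
   bounds, which is why coexistence is uniform in [lambda < 1].

   Coexistence: with [gamma > e] and [b] large, [x = 1/b] satisfies
   [U (L x) <= x < L x].  Hence [x_n <= x] for even [n] and [L x <= x_n] for odd [n],
   and weak limits of the finite-volume measures on balls of even and of odd radius
   are two different Gibbs measures.  By Tarski the same point separates the two
   fixed points.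

   Uniqueness: likelihood-ratio order is reversed by the recursion, so that every
   boundary condition at distance [n] is sandwiched between [F_n] and [F_(n+1)], and
   it is enough that the limits [p] and [q] of [F_(2n)] and [F_(2n+1)] agree.  With
   [d m = ln (p m / q m)] one step of the recursion gives
   [d m <= b sum_(k > m) lambda^k p (C-k)^b d (C-k)].  When [b lambda^j] is small two
   steps contract.  Otherwise [lambda] is tiny compared with [b lambda^j], so that
   only the step from [j-1] to [j-1] matters, and its factor is [b] times the odds of
   an occupied root, which is below 1 because [U (L x) < x] for [x >= c/b], [c < 1]. *)

(** * Iterated sums over the spins of finitely many vertices *)

(** A neighbour of a spin k may take any value up to C - k, so distribution functions, not
    densities, carry the recursion. The value e appears on rescaling x = t / b and s = b lambda^j:
    for small lambda both U and L approach t -> s e^(-t), whose fixed point t has multiplier -t, and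
    -1 is reached at t = 1, that is at s = e. Hence the witness t = 1: there U (L t) <= t reads ln s
    <= s / e, with equality only at s = e. For large s the approximation is poor, because lambda may
    be close to 1 and A far from 1; a crude polynomial bound takes over. For uniqueness the scalar
    bounds do not suffice: U and L differ, so they confine the odds without identifying them, and
    the whole distribution function has to be compared. Likelihood ratios are used since partial
    sums and products over children both respect that order. Gibbs measures arise as limits of
    finite-volume laws on the full power set, where an ultrafilter makes all events converge at
    once; only the cylinder probabilities are then extended to a countably additive measure. *)

Section Resummation.
Variables (R : realType) (V : choiceType) (C : nat).
Local Notation cfg := (V -> 'I_C.+1).
Implicit Types (X Y : seq V) (s t u : cfg) (f g : cfg -> R).

Definition upd t v k : cfg := fun x => if x == v then k else t x.

Lemma upd_same t v k : upd t v k v = k.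
Proof. by rewrite /upd eqxx. Qed.

Lemma upd_neq t v k x : x != v -> upd t v k x = t x.
Proof. by rewrite /upd => /negPf ->. Qed.

Lemma updC t v w k l : v != w -> upd (upd t v k) w l = upd (upd t w l) v k.
Proof.
move=> vw; apply/funext => x; rewrite /upd.
by case: eqVneq => // ->; rewrite eq_sym (negPf vw).
Qed.

(** Summation by successive updates of a total configuration, rather than over finite functions:
    volumes can be enlarged, split and reordered without a change of type, and the values of [t] off
    [X] act as the boundary condition. *)
Fixpoint rsum X f t : R :=
  if X is v :: X' then \sum_k rsum X' f (upd t v k) else f t.

Lemma rsum_cat X Y f t : rsum (X ++ Y) f t = rsum X (rsum Y f) t.
Proof. by elim: X t => //= v X IH t; apply: eq_bigr => k _. Qed.

Lemma eq_rsum X f g t :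
  (forall s, (forall x, x \notin X -> s x = t x) -> f s = g s) ->
  rsum X f t = rsum X g t.
Proof.
elim: X t => [|v X IH] t /= fg; first exact: fg.
apply: eq_bigr => k _; apply: IH => s st; apply: fg => x.
by rewrite inE negb_or => /andP[xv xX]; rewrite st// upd_neq.
Qed.

Lemma le_rsum X f g t :
  (forall s, (forall x, x \notin X -> s x = t x) -> f s <= g s) ->
  rsum X f t <= rsum X g t.
Proof.
elim: X t => [|v X IH] t /= fg; first exact: fg.
apply: ler_sum => k _; apply: IH => s st; apply: fg => x.
by rewrite inE negb_or => /andP[xv xX]; rewrite st// upd_neq.
Qed.

Lemma rsum0 X t : rsum X (fun=> 0) t = 0.
Proof. by elim: X t => //= v X IH t; rewrite big1. Qed.

Lemma rsum_ge0 X f t : (forall s, 0 <= f s) -> 0 <= rsum X f t.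
Proof. by move=> f0; rewrite -(rsum0 X t); apply: le_rsum. Qed.

Lemma rsumZ X c f t : rsum X (fun s => c * f s) t = c * rsum X f t.
Proof.
elim: X t => //= v X IH t; rewrite mulr_sumr.
by apply: eq_bigr => k _.
Qed.

Lemma rsumZr X c f t : rsum X (fun s => f s * c) t = rsum X f t * c.
Proof.
by rewrite mulrC -rsumZ; apply: eq_rsum => s _; rewrite mulrC.
Qed.

Lemma rsumD X f g t : rsum X (fun s => f s + g s) t = rsum X f t + rsum X g t.
Proof.
elim: X t => //= v X IH t; rewrite -big_split.
by apply: eq_bigr => k _.
Qed.

Lemma rsum_off X f t u : (forall x, x \notin X -> t x = u x) ->
  rsum X f t = rsum X f u.
Proof.
elim: X t u => [|v X IH] t u /= tu.
  by congr f; apply/funext => x; exact: tu.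
apply: eq_bigr => k _; apply: IH => x xX; rewrite /upd.
by case: eqVneq => // xv; apply: tu; rewrite inE negb_or xv.
Qed.


Lemma rsumC v w f t : v != w ->
  \sum_k \sum_l f (upd (upd t v k) w l) = \sum_l \sum_k f (upd (upd t w l) v k).
Proof.
move=> vw; rewrite exchange_big; apply: eq_bigr => l _; apply: eq_bigr => k _.
by rewrite updC.
Qed.

Lemma rsum_consC v X f t : v \notin X ->
  \sum_k rsum X f (upd t v k) = rsum X (fun s => \sum_k f (upd s v k)) t.
Proof.
elim: X t => [//|w X IH] t /=; rewrite inE negb_or => /andP[vw vX].
rewrite rsumC//; apply: eq_bigr => l _; exact: IH.
Qed.

Lemma rsum_catC X Y f t : uniq (X ++ Y) ->
  rsum (X ++ Y) f t = rsum (Y ++ X) f t.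
Proof.
rewrite !rsum_cat; elim: X t => [|v X IH] t //=.
rewrite mem_cat negb_or => /andP[/andP[vX vY] u].
rewrite (eq_bigr (fun k => rsum Y (rsum X f) (upd t v k))); last first.
  by move=> k _; rewrite IH.
exact: rsum_consC.
Qed.

Lemma perm_rsum X Y f t : uniq X -> perm_eq X Y -> rsum X f t = rsum Y f t.
Proof.
move=> uX XY.
suff: uniq Y /\ rsum X f t = rsum Y f t by case.
have P0 : uniq X /\ rsum X f t = rsum X f t by [].
move: P0; apply: (catCA_perm_ind (P := fun Z => uniq Z /\ rsum X f t = rsum Z f t) _ XY).
  move=> s1 s2 s3 [u ->]; split.
    by rewrite (perm_uniq (s2 := s1 ++ s2 ++ s3)) // perm_catCA.
  rewrite !catA (rsum_cat (s1 ++ s2)) (rsum_cat (s2 ++ s1)) rsum_catC //.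
  by move: u; rewrite catA cat_uniq => /andP[].
Qed.

Definition splice X t u : cfg := fun x => if x \in X then u x else t x.

Definition agree X s t : bool := all (fun x => s x == t x) X.

Lemma agreeP X s t : reflect (forall x, x \in X -> s x = t x) (agree X s t).
Proof.
apply: (iffP allP) => H x xX; first by apply/eqP/H.
by apply/eqP/H.
Qed.

Lemma rsum_pick X f t u : uniq X ->
  rsum X (fun s => (agree X s u)%:R * f s) t = f (splice X t u).
Proof.
elim: X t => [|v X IH] t /=.
  by rewrite mul1r => _; congr f.
move=> /andP[vX uX]; rewrite (bigD1 (u v)) //= big1 ?addr0 => [|k kv].
  rewrite (@eq_rsum _ _ (fun s => (agree X s u)%:R * f s)) => [|s st].
    rewrite IH//; congr f; apply/funext => x; rewrite /splice /upd inE.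
    by case: (x \in X); rewrite ?orbT ?orbF //; case: eqVneq => // ->.
  by rewrite /= st// upd_same eqxx.
rewrite -(rsum0 X (upd t v k)); apply: eq_rsum => s st.
by rewrite /= st// upd_same (negPf kv) mul0r.
Qed.

Lemma rsum_prod X (phi : V -> 'I_C.+1 -> R) t : uniq X ->
  rsum X (fun s => \prod_(v <- X) phi v (s v)) t = \prod_(v <- X) \sum_k phi v k.
Proof.
elim: X t => [|v X IH] t /=; first by rewrite !big_nil.
move=> /andP[vX uX]; rewrite big_cons mulr_suml; apply: eq_bigr => k _.
rewrite -(IH (upd t v k))// -rsumZ; apply: eq_rsum => s st.
by rewrite big_cons st// upd_same.
Qed.

(** Bridge from the sums over finite functions in [fin_mu] to iterated sums. Freezing the spins
    outside of [X] is what lets the induction release one vertex at a time. *)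
Lemma rsum_ffun_sub (W : {fset V}) (X : seq V) (g : {ffun W -> 'I_C.+1} -> R) t :
  uniq X -> {subset X <= W} ->
  \sum_(s : {ffun W -> 'I_C.+1} | [forall x, (val x \notin X) ==> (s x == t (val x))]) g s =
  rsum X (fun u => g [ffun x => u (val x)]) t.
Proof.
elim: X t => [|v X IH] t /=.
  move=> _ _; rewrite (big_pred1 [ffun x : W => t (val x)]) // => s /=.
  apply/forallP/eqP => [H|->].
    by apply/ffunP => x; rewrite ffunE; apply/eqP/H.
  by move=> x; rewrite ffunE.
move=> /andP[vX uX] XW; have vW : v \in W by apply: XW; rewrite inE eqxx.
pose vw : W := [` vW]%fset.
rewrite (partition_big (fun s : {ffun W -> 'I_C.+1} => s vw) xpredT) //=.
apply: eq_bigr => k _; rewrite -IH //; last first.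
  by move=> x xX; apply: XW; rewrite inE xX orbT.
apply: eq_bigl => s; apply/andP/forallP => [[/forallP H /eqP sk] x|H].
  apply/implyP => xX; have [xv|xv] := eqVneq (val x) v.
    by rewrite xv upd_same -sk; apply/eqP; congr (s _); apply/val_inj.
  by rewrite upd_neq//; apply: (implyP (H x)); rewrite inE negb_or xv.
split.
  apply/forallP => x; apply/implyP; rewrite inE negb_or => /andP[xv xX].
  by have := implyP (H x) xX; rewrite upd_neq.
by have := implyP (H vw) vX; rewrite upd_same.
Qed.

End Resummation.

(** * Cylinders and finitely additive probabilities *)

Section Cylinders.
Variables (R : realType) (V : choiceType) (C : nat).
Local Notation cfg := (V -> 'I_C.+1).
Implicit Types (X : seq V) (s t u : cfg) (A B : set cfg).

Definition spin v k : set cfg := [set s | s v = k].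

Definition cyl X t : set cfg := [set s | forall x, x \in X -> s x = t x].

Lemma cyl_cons v X t : cyl (v :: X) t = spin v (t v) `&` cyl X t.
Proof.
apply/seteqP; split => s /=.
  by move=> H; split => [|x xX]; apply: H; rewrite inE ?eqxx ?xX ?orbT.
by case=> sv H x; rewrite inE => /orP[/eqP->//|/H].
Qed.

Lemma eq_cyl X t u : (forall x, x \in X -> t x = u x) -> cyl X t = cyl X u.
Proof.
by move=> tu; apply/seteqP; split => s /= H x xX; rewrite H// tu.
Qed.

Lemma cyl0 t : cyl [::] t = setT.
Proof. by apply/seteqP; split. Qed.

(* [Q] is the class of events on which [m] is known to be additive: all events for
   a finitely additive probability, the measurable ones for a measure. *)
Lemma rsum_cyl (m : set cfg -> R) (Q : set (set cfg)) X A t :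
  (forall A v k, Q A -> Q (A `&` spin v k)) ->
  (forall A v, Q A -> m A = \sum_k m (A `&` spin v k)) ->
  Q A -> uniq X -> rsum X (fun u => m (A `&` cyl X u)) t = m A.
Proof.
move=> Qspin part; elim: X A t => [|v X IH] A t QA /=.
  by rewrite cyl0 setIT.
move=> /andP[vX uX]; rewrite [RHS](part _ v) //; apply: eq_bigr => k _.
rewrite -(IH _ (upd t v k)) //; last exact: Qspin.
by apply: eq_rsum => s st; rewrite cyl_cons st// upd_same setIA.
Qed.

(** Defined on every set of configurations, so that limits of finite-volume laws raise no question
    of measurability. *)
Definition finadd (m : set cfg -> R) : Prop :=
  [/\ forall A, 0 <= m A, m setT = 1 &
      forall A B, A `&` B = set0 -> m (A `|` B) = m A + m B].

Section Finadd.
Variables (m : set cfg -> R) (fm : finadd m).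

Lemma finadd_set0 : m set0 = 0.
Proof.
case: fm => _ _ mU; have := mU set0 set0; rewrite setI0 setU0 => /(_ erefl).
by move=> /eqP; rewrite -subr_eq0 opprD addrA subrr sub0r oppr_eq0 => /eqP.
Qed.

Lemma finadd_spin A v : m A = \sum_k m (A `&` spin v k).
Proof.
case: fm => _ _ mU.
have H (r : seq 'I_C.+1) : uniq r ->
    m (A `&` [set s | s v \in r]) = \sum_(k <- r) m (A `&` spin v k).
  elim: r => [_|k r IH /= /andP[kr ur]].
    rewrite big_nil -finadd_set0; congr m; apply/seteqP; split => // s [].
    by rewrite /= in_nil.
  rewrite big_cons -IH// -mU.
    congr m; apply/seteqP; split => s /=.
      by case=> As; rewrite inE => /orP[/eqP|] ?; [left|right].
    by case=> -[As H]; split => //; rewrite inE ?H ?eqxx ?orbT.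
  apply/seteqP; split => // s [[_ /= sk] [_ /=]]; rewrite sk => skr.
  by rewrite skr in kr.
rewrite -(H (index_enum _)) ?index_enum_uniq//; congr m; apply/seteqP; split => // s.
  by move=> As; split => //=; rewrite mem_index_enum.
Qed.

Lemma finadd_le A B : A `<=` B -> m A <= m B.
Proof.
case: fm => m0 _ mU AB.
have -> : B = A `|` (B `\` A) by rewrite setDUK.
rewrite mU ?lerDl//; apply/seteqP; split => // x [? []]//.
Qed.

Lemma finadd_le1 A : m A <= 1.
Proof. by case: fm => _ <- _; exact: finadd_le. Qed.

Lemma rsum_finadd X A t : uniq X -> rsum X (fun u => m (A `&` cyl X u)) t = m A.
Proof.
apply: (@rsum_cyl _ setT) => //; move=> B v _; exact: finadd_spin.
Qed.

End Finadd.

End Cylinders.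

(** * Extension of a finitely additive probability *)

Section Probability.
Variables (R : realType) (V : countType) (C : nat).
Local Notation cfg := (V -> 'I_C.+1).
Variable mu : probability (config V C) R.

Lemma measurable_spin (v : V) k : measurable (spin v k : set (config V C)).
Proof. by apply: sub_sigma_algebra; exists v => //; exists k. Qed.

Lemma measurable_cyl (X : seq V) (t : cfg) : measurable (cyl X t : set (config V C)).
Proof.
elim: X => [|v X IH]; first by rewrite cyl0; exact: measurableT.
by rewrite cyl_cons; apply: measurableI => //; exact: measurable_spin.
Qed.

Lemma prob_spin (A : set (config V C)) (v : V) : measurable A ->
  fine (mu A) = \sum_k fine (mu (A `&` spin v k)).
Proof.
move=> mA; have mAk k : measurable (A `&` spin v k : set (config V C)).
  by apply: measurableI => //; exact: measurable_spin.
rewrite sum_fine; last by move=> k _; rewrite fin_num_measure.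
congr fine; rewrite -measure_semi_additive_ord //.
- congr (mu _); rewrite -big_distrr /=; apply/seteqP; split => s; last by case.
  by move=> As; split => //; rewrite -bigcup_seq; exists (s v) => //=; exact: mem_index_enum.
- by move=> i j _ _ [s [[_ /= <-] [_ /= <-]]].
- by apply: bigsetU_measurable => k _.
Qed.

Lemma rsum_prob X (A : set (config V C)) t : uniq X -> measurable A ->
  rsum X (fun u => fine (mu (A `&` cyl X u))) t = fine (mu A).
Proof.
move=> uX mA.
apply: (@rsum_cyl _ _ _ (fine \o mu) (@measurable _ (config V C))) => //.
  by move=> B v k mB; apply: measurableI => //; exact: measurable_spin.
by move=> B v mB; exact: prob_spin.
Qed.

End Probability.

Section Extension.
Variables (R : realType) (V : countType) (C : nat).
Local Notation cfg := (V -> 'I_C.+1).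
Variables (m : set cfg -> R) (fm : finadd m).

(** The vertices of code below [n]. A countable type need not use every code, hence the branches
    that add nothing. *)
Fixpoint prefix_seq n : seq V :=
  if n is n'.+1 then
    if pickle_inv n' is Some v then v :: prefix_seq n' else prefix_seq n'
  else [::].

Lemma mem_prefix_seq n (v : V) : (v \in prefix_seq n) = (choice.pickle v < n)%N.
Proof.
elim: n => //= n IH; case E: (pickle_inv n) => [w|].
  have wn : choice.pickle w = n by have := @pickle_invK V n; rewrite E.
  rewrite inE IH ltnS [RHS]leq_eqVlt; congr (_ || _).
  by apply/eqP/eqP => [->//|vn]; apply: (pcan_inj (@choice.pickleK V)); rewrite vn wn.
rewrite IH ltnS [RHS]leq_eqVlt; case: eqP => // vn.
by have := @pickleK_inv _ v; rewrite vn E.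
Qed.

Lemma prefix_seq_uniq n : uniq (prefix_seq n).
Proof.
elim: n => //= n IH; case E: (pickle_inv n) => [w|] //=; rewrite IH andbT.
have wn : choice.pickle w = n by have := @pickle_invK V n; rewrite E.
by rewrite mem_prefix_seq wn ltnn.
Qed.

(** Inside an interval of length [m A], the offset at which the points with spin [n] at [v]
    begin. *)
Definition start A (v : V) (n : nat) : R :=
  \sum_(i < C.+1 | (i < n)%N) m (A `&` spin v i).

Lemma startS A v (k : 'I_C.+1) : start A v k.+1 = start A v k + m (A `&` spin v k).
Proof.
rewrite /start (bigD1 k) //= addrC; congr (_ + _); apply: eq_bigl => i.
by rewrite ltnS [RHS]ltn_neqAle andbC.
Qed.

Lemma start_max A v : start A v C.+1 = m A.
Proof.
rewrite (finadd_spin fm A v); apply: eq_bigl => i; by rewrite ltn_ord.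
Qed.

Lemma le_start A v n n' : (n <= n')%N -> start A v n <= start A v n'.
Proof.
move=> nn'; rewrite /start [leRHS](bigID (fun i : 'I_C.+1 => (i < n)%N)) /=.
rewrite [X in _ <= X + _](eq_bigl (fun i : 'I_C.+1 => (i < n)%N)) => [|i].
  by rewrite lerDl sumr_ge0// => i _; case: fm.
by rewrite andbC; case: (ltnP i n) => //= /leq_trans; apply.
Qed.

(** The default is reached only when [u] lies outside of [0, m A[. *)
Definition digit A (v : V) (u : R) : 'I_C.+1 :=
  odflt ord0 [pick k : 'I_C.+1 | start A v k <= u < start A v k.+1].

Lemma digitP A v u k : 0 <= u -> u < m A ->
  (digit A v u = k) <-> (start A v k <= u < start A v k.+1).
Proof.
move=> u0 uA.
have uniqk (k1 k2 : 'I_C.+1) : start A v k1 <= u < start A v k1.+1 ->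
    start A v k2 <= u < start A v k2.+1 -> (k1 <= k2)%N.
  move=> /andP[a1 b1] /andP[a2 b2]; rewrite leqNgt; apply/negP => /(le_start A v).
  by rewrite leNgt (le_lt_trans a1 b2).
have [k0 Hk0] : exists k0 : 'I_C.+1, start A v k0 <= u < start A v k0.+1.
  pose P n := (n <= C)%N && (start A v n <= u).
  have P0 : exists n, P n by exists 0%N; rewrite /P /= /start big_pred0.
  have Pb n : P n -> (n <= C)%N by case/andP.
  case: (ex_maxnP P0 Pb) => n /andP[nC nu] nmax.
  exists (inord n); rewrite inordK ?ltnS// nu /= ltNge; apply/negP => Snu.
  have [nC'|] := ltnP n C; first by have := nmax n.+1; rewrite /P nC' Snu ltnn => /(_ isT).
  move=> Cn; have nC' : n = C by apply/eqP; rewrite eqn_leq nC.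
  by move: Snu; rewrite nC' start_max leNgt uA.
rewrite /digit; case: pickP => [k1 Hk1 /=|/(_ k0)]; last by rewrite Hk0.
split=> [<-//|Hk]; apply/val_inj/eqP; rewrite eqn_leq.
by rewrite !uniqk.
Qed.

(* The spins are read off a point [u] of [0, 1[ one vertex at a time: the interval of
   the points that produce a given prefix is cut in the proportions that [m] assigns
   to the next spin, so its length is the mass of the corresponding cylinder. *)
Fixpoint decode n u : set cfg * R :=
  if n is n'.+1 then
    let p := decode n' u in
    if pickle_inv n' is Some v then
      let k := digit p.1 v p.2 in (p.1 `&` spin v k, p.2 - start p.1 v k)
    else p
  else (setT, u).

Definition decoded u : cfg :=
  fun v => let p := decode (choice.pickle v) u in digit p.1 v p.2.

(** The induction has to follow the state of the decoder too: on the interval of a cylinder the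
    remainder is the offset from the left end [a]. A prefix event thus becomes a half-open interval,
    measurable and of known length. *)
Lemma decodedP n t : exists2 a, 0 <= a & a + m (cyl (prefix_seq n) t) <= 1 /\
  forall u, 0 <= u < 1 ->
    [/\ cyl (prefix_seq n) t (decoded u) <-> a <= u < a + m (cyl (prefix_seq n) t) &
    cyl (prefix_seq n) t (decoded u) -> decode n u = (cyl (prefix_seq n) t, u - a)].
Proof.
case: (fm) => m0 mT _.
elim: n => [|n [a a0 [a1 IH]]].
  exists 0 => //; rewrite add0r /= cyl0 mT; split => // u u01.
  by split => //; rewrite subr0.
rewrite /=; case E: (pickle_inv n) => [v|]; last by exists a.
have vn : choice.pickle v = n by have := @pickle_invK V n; rewrite E.
set A := cyl (prefix_seq n) t in a1 IH *.
have mA : m (cyl (v :: prefix_seq n) t) = start A v (t v).+1 - start A v (t v).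
  by rewrite cyl_cons setIC startS addrC addKr.
have sA : start A v (t v).+1 <= m A by rewrite -(start_max A v); exact: le_start.
have s0 : 0 <= start A v (t v) by apply: sumr_ge0.
exists (a + start A v (t v)); first exact: addr_ge0.
rewrite mA -addrA (addrC (start _ _ _)) subrK; split.
  by rewrite (le_trans _ a1)// lerD2l.
move=> u u01; have [H1 H2] := IH _ u01; rewrite cyl_cons.
have key : A (decoded u) -> (decoded u v = t v) <->
    (start A v (t v) <= u - a < start A v (t v).+1).
  move=> Au; move/H1: (Au) => /andP[au ua].
  rewrite {1}/decoded vn H2 //=; apply: digitP; first by rewrite subr_ge0.
  by rewrite ltrBlDl.
split.
- split.
    by case=> /= uv Au; move/(key Au): uv; rewrite lerBrDl ltrBlDl.
  move=> /andP[b1 b2].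
  have Au : A (decoded u).
    apply/H1; rewrite (le_trans _ b1) ?lerDl//=.
    by rewrite (lt_le_trans b2)// lerD2l.
  split => //; apply/(key Au).
  by rewrite lerBrDl b1 ltrBlDl.
- case=> /= uv Au; rewrite H2//=.
  have -> : digit A v (u - a) = t v by move: uv; rewrite /spin /= /decoded vn H2.
  by rewrite setIC opprD addrA.
Qed.

Definition code_config u : config V C :=
  if 0 <= u < 1 then decoded u else fun=> ord0.

Lemma measurable_code_config :
  measurable_fun [set: measurableTypeR R] (code_config : measurableTypeR R -> config V C).
Proof.
refine (@measurability _ _ (measurableTypeR R) (config V C) _ code_config (cylinders [set: V]) _ _) => //.
move=> _ [_ [v _ [i _ <-]] <-].
rewrite setTI.
(* The spins at codes up to that of [v] form a finite type, so the preimage is a finite union of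
   intervals, together with all or nothing of the complement of [0, 1[. *)
pose tg (g : {ffun 'I_(choice.pickle v).+1 -> 'I_C.+1}) : cfg :=
  fun x => g (inord (choice.pickle x)).
pose n := (choice.pickle v).+1.
have -> : code_config @^-1` [set s | s v = i] =
   (`[0, 1[ `&` \bigcup_(g in [set g | tg g v = i])
      [set u | cyl (prefix_seq n) (tg g) (decoded u)])
   `|` (~` `[0, 1[ `&` [set u | ord0 = i]).
  apply/seteqP; split => u /=; rewrite /code_config in_itv /=.
    case: ifPn => u01 ui; last by right; split => //; apply/negP.
    left; split => //.
    exists [ffun k : 'I_n => if pickle_inv k is Some w then decoded u w else ord0].
      by rewrite /= /tg ffunE inordK// pickleK_inv.
    move=> /= x xn; have {}xn : (choice.pickle x < n)%N by rewrite -mem_prefix_seq.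
    by rewrite /tg ffunE inordK// pickleK_inv.
  case=> [[-> [g /= gi H]]|[/negP/negPf-> //]].
  have vin : v \in prefix_seq n by rewrite mem_prefix_seq.
  by rewrite -gi; exact: H vin.
apply: measurableU.
  rewrite setI_bigcupr; apply: fin_bigcup_measurable; first exact: finite_finset.
  move=> g _; have [a a0 [a1 H]] := decodedP n (tg g).
  have -> : `[0, 1[ `&` [set u | cyl (prefix_seq n) (tg g) (decoded u)] =
      [set` `[a, a + m (cyl (prefix_seq n) (tg g))[].
    apply/seteqP; split => u /=; rewrite !in_itv/=.
      by case=> u01; have [<-] := H _ u01.
    move=> /andP[b1 b2].
    have u01 : 0 <= u < 1 by rewrite (le_trans a0)//= (lt_le_trans b2).
    by split => //; have [-> _] := H _ u01; rewrite b1.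
  exact: measurable_itv.
apply: (@measurableI _ (measurableTypeR R)); first by apply: measurableC; exact: measurable_itv.
have [->|i0] := eqVneq ord0 i.
  have -> : [set u : R | i = i] = setT by apply/seteqP; split.
  exact: measurableT.
have -> : [set u : R | ord0 = i] = set0.
  by apply/seteqP; split => // u /= /eqP; rewrite (negPf i0).
exact: measurable0.
Qed.


Lemma uniform_itv a b : 0 <= a -> a <= b -> b <= 1 ->
  uniform_prob (@ltr01 R) `[a, b[ = (b - a)%:E.
Proof.
move=> a0 ab b1; rewrite /uniform_prob (eq_integral (fun=> 1%:E)); last first.
  move=> x; rewrite inE /= in_itv /= => /andP[ax xb].
  by rewrite /uniform_pdf (le_trans a0)//= (ltW (lt_le_trans xb b1)) subr0 invr1.
rewrite integral_cst//= mul1e lebesgue_measure_itv /= lte_fin.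
have [ab'|ba] := ltP a b; first by rewrite EFinB.
by rewrite (@le_anti _ _ b a) ?subrr// ba ab.
Qed.

Let law : probability (config V C) R :=
  distribution (uniform_prob (@ltr01 R))
    (HB.pack code_config (isMeasurableFun.Build _ _ _ _ _ measurable_code_config) :
      {mfun measurableTypeR R >-> config V C}).

Lemma law_prefix n t : law (cyl (prefix_seq n) t) = (m (cyl (prefix_seq n) t))%:E.
Proof.
have [a a0 [a1 H]] := decodedP n t; case: (fm) => m0 _ _.
rewrite /law /distribution /pushforward /=.
set A := _ @^-1` _.
pose U : probability (measurableTypeR R) R := uniform_prob (@ltr01 R).
rewrite -[LHS]/(U A).
have mA : measurable (A : set (measurableTypeR R)).
  rewrite -[A]setTI; apply: measurable_code_config => //.
  exact: measurable_cyl.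
have m01 : measurable (`[0, 1[ : set (measurableTypeR R)) by exact: measurable_itv.
have U01 : U (~` `[0, 1[) = 0%E.
  have e : uniform_prob (@ltr01 R) `[0, 1[ = 1%E by rewrite uniform_itv// subr0.
  by rewrite /U (probability_setC (uniform_prob (@ltr01 R)) m01) -[X in (X - _)%E]e subee// e.
rewrite (measureDI _ mA m01) -[RHS]add0e; congr (_ + _)%E.
  apply/eqP; rewrite -measure_le0 -U01; apply: le_measure; rewrite ?inE.
  - exact: measurableD.
  - exact: measurableC.
  - by move=> x [].
have -> : A `&` `[0, 1[ = `[a, a + m (cyl (prefix_seq n) t)[%classic.
  apply/seteqP; split => u /=; rewrite !in_itv/= /A /= /code_config.
    by case=> + u01; rewrite u01; have [<-] := H _ u01.
  move=> /andP[b1 b2].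
  have u01 : 0 <= u < 1 by rewrite (le_trans a0)//= (lt_le_trans b2).
  by rewrite u01; split => //; have [-> _] := H _ u01; rewrite b1.
by rewrite /U; apply: etrans (uniform_itv _ _ _) _; rewrite ?lerDl// addrC addKr.
Qed.

(** The decoding gives the mass of prefix cylinders; any other cylinder is a finite disjoint union
    of these, over which both [law] and [m] are additive. *)
Theorem finadd_extension : exists mu : probability (config V C) R,
  forall X t, uniq X -> mu (cyl X t) = (m (cyl X t))%:E.
Proof.
exists law => X t uX.
pose n := (\max_(x <- X) choice.pickle x).+1.
have XY : {subset X <= prefix_seq n}.
  by move=> x xX; have := @leq_bigmax_seq _ X xpredT (fun x => choice.pickle x) x xX isT; rewrite mem_prefix_seq ltnS.
rewrite -[LHS]fineK ?fin_num_measure//; last exact: measurable_cyl.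
congr EFin.
rewrite -(rsum_prob law t (prefix_seq_uniq n) (measurable_cyl X t)).
rewrite -(rsum_finadd fm _ t (prefix_seq_uniq n)); apply: eq_rsum => s _.
have [Hs|Hs] := pselect (forall x, x \in X -> s x = t x).
  have -> : cyl X t `&` cyl (prefix_seq n) s = cyl (prefix_seq n) s.
    apply/setIidr => u /= H x xX; rewrite H ?Hs//; exact: XY.
  by rewrite law_prefix.
have -> : cyl X t `&` cyl (prefix_seq n) s = set0.
  apply/seteqP; split => // u [/= H1 H2]; apply: Hs => x xX.
  by rewrite -H2 ?H1//; exact: XY.
by rewrite measure0 (finadd_set0 fm).
Qed.

End Extension.

(** * The specification *)

Lemma le_rsum_term (R : realType) (V : choiceType) (C : nat) (X : seq V)
    (f : (V -> 'I_C.+1) -> R) t : (forall s, 0 <= f s) -> f t <= rsum X f t.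
Proof.
move=> f0; elim: X t => //= v X IH t.
have tt : upd t v (t v) = t by apply/funext => x; rewrite /upd; case: eqVneq => [->|].
rewrite (bigD1 (t v)) //= tt (le_trans (IH t))// lerDl.
by apply: sumr_ge0 => k _; exact: rsum_ge0.
Qed.

Section Specification.
Variables (R : realType) (V : countType) (C : nat) (e : rel V) (lambda : R).
Hypotheses (lambda0 : 0 < lambda) (lfe : locally_finite e).
Local Notation cfg := (V -> 'I_C.+1).
Implicit Types (U : {fset V}) (s t : cfg).

Definition okon (W : {fset V}) t : bool :=
  `[< forall x y, x \in W -> y \in W -> e x y -> (t x + t y <= C)%N >].

(* The unnormalized specification; the weights of the boundary spins cancel. *)
Definition phi U t : R :=
  (okon (closure_fset e U) t)%:R * \prod_(v <- U) lambda ^+ t v.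

Lemma phi_ge0 U t : 0 <= phi U t.
Proof.
by rewrite mulr_ge0// prodr_ge0// => v _; rewrite exprn_ge0// ltW.
Qed.

Lemma phi_eq0 U t : (phi U t == 0) = ~~ okon (closure_fset e U) t.
Proof.
rewrite /phi mulf_eq0; case: (okon _ _); last by rewrite eqxx.
rewrite oner_eq0 /= prodf_seq_eq0; apply/negbTE/hasPn => v _ /=.
by rewrite expf_neq0// gt_eqF.
Qed.

Lemma eq_phi U s t : (forall x, x \in closure_fset e U -> s x = t x) ->
  phi U s = phi U t.
Proof.
move=> st; rewrite /phi; congr (_%:R * _).
  by rewrite /okon; congr nat_of_bool; apply/asboolP/asboolP => H x y xW yW; [rewrite -!st//|rewrite !st//]; exact: H.
rewrite !big_seq; apply: eq_bigr => v vU; rewrite st//.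
by rewrite in_fsetU vU.
Qed.

Lemma boundary_notin U x : x \in boundary e U -> x \notin U.
Proof. by move/(mem_boundary U x lfe) => []. Qed.

(** The normalization [Z] and the boundary weight [c] are common to numerator and denominator. If
    the boundary spins of [t] already violate the constraint, both sides are 0 by the convention for
    division. *)
Lemma local_specE U t : local_spec e lambda U t = phi U t / rsum U (phi U) t.
Proof.
rewrite /local_spec /fin_cond_mu; set W := closure_fset e U; set E := @Defs.induced _ _ _.
set A := [set s : {ffun W -> _} | _]; set B := [set s : {ffun W -> _} | _].
rewrite /fin_mu; set Z := \sum_(s : {ffun W -> 'I_C.+1} | `[< allowable E s >]) _.
have w0 (s : {ffun W -> 'I_C.+1}) : 0 < Defs.weight lambda s.
  by apply: prodr_gt0 => v _; exact: exprn_gt0.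
have Z0 : Z != 0.
  rewrite gt_eqF// /Z (bigD1 [ffun=> ord0])/=; last first.
    by apply/asboolP => x y _; rewrite !ffunE.
  rewrite ltr_pwDl//; apply: sumr_ge0 => s _; exact: ltW.
have red x y z : z != 0 -> (x / z) / (y / z) = x / y :> R.
  by move=> z0; rewrite invf_div mulrA divfK.
rewrite red//.
pose c := \prod_(v <- boundary e U) lambda ^+ t v.
have c0 : c != 0.
  by rewrite gt_eqF//; apply: prodr_gt0 => v _; exact: exprn_gt0.
have permW : perm_eq W (U ++ boundary e U).
  apply: uniq_perm => [||x]; [exact: fset_uniq| |by rewrite mem_cat in_fsetU].
  rewrite cat_uniq !fset_uniq andbT /=; apply/hasPn => x /=; exact: boundary_notin.
have wphi s : (forall x, x \notin U -> s x = t x) ->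
    (okon W s)%:R * Defs.weight lambda [ffun x : W => s (val x)] = phi U s * c.
  move=> st; rewrite /phi -mulrA; congr (_ * _).
  rewrite /Defs.weight (eq_bigr (fun v : W => lambda ^+ s (val v))); last first.
    by move=> v _; rewrite ffunE.
  rewrite -(big_seq_fsetE _ _ xpredT (fun v => lambda ^+ s v))/= (perm_big _ permW)/=.
  rewrite big_cat /=; congr (_ * _); rewrite /c [LHS]big_seq [RHS]big_seq.
  by apply: eq_bigr => v /boundary_notin/st ->.
have okE s : `[< allowable E [ffun x : W => s (val x)] >] = okon W s.
  rewrite /okon; apply/asboolP/asboolP => H x y; last first.
    by rewrite !ffunE => /H; apply; exact: valP.
  by move=> xW yW exy; have := H [` xW]%fset [` yW]%fset exy; rewrite !ffunE.
have -> : \sum_(s : {ffun W -> 'I_C.+1} | `[< allowable E s /\ B s >]) Defs.weight lambda s = rsum U (phi U) t * c.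
  pose g (s : {ffun W -> 'I_C.+1}) := `[< allowable E s >]%:R * Defs.weight lambda s.
  transitivity (rsum U (fun u => g [ffun x : W => u (val x)]) t); last first.
    by rewrite -rsumZr; apply: eq_rsum => s st; rewrite -wphi// /g okE.
  rewrite -(rsum_ffun_sub g) ?fset_uniq//; last by move=> x xU; rewrite in_fsetU xU.
  rewrite [LHS]big_mkcond [RHS]big_mkcond /=; apply: eq_bigr => s _; rewrite /g.
  have <- : `[< B s >] = [forall x : W, (val x \notin U) ==> (s x == t (val x))].
    apply/asboolP/forallP => [H x|H x xb].
      apply/implyP => xU; apply/eqP/H.
      by have := valP x; rewrite in_fsetU (negPf xU).
    by apply/eqP/(implyP (H x))/boundary_notin.
  by rewrite asbool_and andbC; case: asboolP => //=; case: asboolP => //=; rewrite ?mul1r ?mul0r.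
have -> : \sum_(s : {ffun W -> 'I_C.+1} | `[< allowable E s /\ (A `&` B) s >]) Defs.weight lambda s = phi U t * c.
  rewrite -wphi// -okE [LHS]big_mkcond /=.
  rewrite (bigD1 [ffun x : W => t (val x)])//= big1 ?addr0 => [|s st].
    case: asboolP => [[H _]|H].
      by case: asboolP => //; rewrite mul1r.
    case: asboolP => [H'|]; last by rewrite mul0r.
    by exfalso; apply: H; split => //; split => x _; rewrite ffunE.
  case: asboolP => // -[_ [H1 H2]]; exfalso; move/eqP: st; apply; apply/ffunP => x.
  rewrite ffunE; have := valP x; rewrite in_fsetU => /orP[]; [exact: H1|exact: H2].
by rewrite invfM mulrACA divff// mulr1.
Qed.

Lemma local_spec_ge0 U t : 0 <= local_spec e lambda U t.
Proof.
by rewrite local_specE divr_ge0 ?phi_ge0//; apply: rsum_ge0; exact: phi_ge0.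
Qed.

Lemma local_spec_le1 U t : local_spec e lambda U t <= 1.
Proof.
rewrite local_specE; have := le_rsum_term U t (phi_ge0 U).
have : 0 <= rsum U (phi U) t by apply: rsum_ge0; exact: phi_ge0.
rewrite le_eqVlt => /orP[/eqP <-|r0 pr]; first by rewrite invr0 mulr0.
by rewrite ler_pdivrMr// mul1r.
Qed.

Lemma rsum_phi_off U (X : seq V) s t :
  (forall x, x \in closure_fset e U -> s x = t x) ->
  rsum X (phi U) s = rsum X (phi U) t.
Proof.
elim: X s t => [|v X IH] s t /= st; first exact: eq_phi.
apply: eq_bigr => k _; apply: IH => x xW; rewrite /upd.
by case: eqVneq => // _; exact: st.
Qed.

Lemma rsum_phi_boundary U s t : (forall x, x \in boundary e U -> s x = t x) ->
  rsum U (phi U) s = rsum U (phi U) t.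
Proof.
move=> st; rewrite (@rsum_off _ _ _ _ _ s (splice U s t)) => [|x xU].
  apply: rsum_phi_off => x; rewrite in_fsetU /splice.
  by case: (x \in U) => //= /st.
by rewrite /splice (negPf xU).
Qed.

Lemma eq_local_spec U s t : (forall x, x \in closure_fset e U -> s x = t x) ->
  local_spec e lambda U s = local_spec e lambda U t.
Proof. by move=> st; rewrite !local_specE (eq_phi st) (rsum_phi_off _ st). Qed.

End Specification.

(** * Gibbs measures and cylinder probabilities *)

Section Local.
Variables (R : realType) (V : countType) (C : nat).
Local Notation cfg := (V -> 'I_C.+1).

(** Splitting according to the spin at the head of [X], and freezing that spin, leaves an event that
    depends on one vertex fewer. *)
Lemma cylinders_local (W : set V) (X : seq V) (P : set (config V C)) :
  (forall x, x \in X -> W x) ->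
  (forall s t : cfg, (forall x, x \in X -> s x = t x) -> P s -> P t) ->
  <<s cylinders W >> P.
Proof.
pose T := g_sigma_algebraType (@cylinders V C W).
elim: X P => [|v X IH] P XW XP.
  have [[s Ps]|nP] := pselect (exists s, P s).
    have -> : P = setT by apply/seteqP; split => // t _; apply: XP Ps.
    exact: (@measurableT _ T).
  have -> : P = set0 by apply/seteqP; split => // s Ps; apply: nP; exists s.
  exact: (@measurable0 _ T).
have -> : P = \bigcup_(k in [set: 'I_C.+1]) (spin v k `&` [set s | P (upd s v k)]).
  have updv s : upd s v (s v) = s.
    by apply/funext => x; rewrite /upd; case: eqVneq => [->|].
  apply/seteqP; split => s; first by move=> Ps; exists (s v) => //; split => //=; rewrite updv.
  by case=> k _ [/= <-]; rewrite updv.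
apply: (@fin_bigcup_measurable _ T); first exact: finite_finset.
move=> k _; apply: (@measurableI _ T).
  by apply: sub_sigma_algebra; exists v; [apply: XW; rewrite inE eqxx|exists k].
apply: IH => [x xX|s t st /=]; first by apply: XW; rewrite inE xX orbT.
apply: XP => x; rewrite inE /upd; case: eqVneq => //= _; exact: st.
Qed.

Lemma measurable_local (X : seq V) (f : config V C -> R) :
  (forall s t : cfg, (forall x, x \in X -> s x = t x) -> f s = f t) ->
  measurable_fun [set: config V C] f.
Proof.
move=> Xf _ B _; rewrite setTI; apply: (@cylinders_local _ X) => // s t /Xf.
by move=> /= ->.
Qed.

Lemma integral_local (mu : probability (config V C) R) (X : seq V)
    (D : set (config V C)) (f : config V C -> R) (t : cfg) :
  measurable D -> uniq X -> (forall s, 0 <= f s) ->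
  (forall s t : cfg, (forall x, x \in X -> s x = t x) -> f s = f t) ->
  (\int[mu]_(s in D) (f s)%:E)%E =
  (rsum X (fun s => f s * fine (mu (D `&` cyl X s))) t)%:E.
Proof.
elim: X D f t => [|v X IH] D f t mD /= uX f0 Xf.
  rewrite (eq_integral (fun=> (f t)%:E)) => [|s _]; last by rewrite (Xf s t).
  by rewrite integral_cst// cyl0 setIT EFinM fineK// fin_num_measure.
case/andP: uX => vX uX.
have mDk k : measurable (D `&` spin v k : set (config V C)).
  by apply: measurableI => //; exact: measurable_spin.
have DE : D = \big[setU/set0]_(k < C.+1) (D `&` spin v k).
  rewrite -big_distrr /=; apply/seteqP; split => s; last by case.
  by move=> As; split => //; rewrite -bigcup_seq; exists (s v) => //=; exact: mem_index_enum.
have mf : measurable_fun [set: config V C] (EFin \o f).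
  by apply/measurable_EFinP; exact: measurable_local Xf.
rewrite {1}DE ge0_integral_bigsetU//; last 3 first.
- by move=> i j _ _ [s [[_ /= <-] [_ /= <-]]].
- exact: measurable_funTS mf.
- by move=> s _; rewrite lee_fin.
rewrite -sumEFin; apply: eq_bigr => k _.
rewrite (eq_integral (fun s : config V C => (f (upd (s : cfg) v k))%:E)); last first.
  move=> s; rewrite inE => -[_ /= sk]; congr (f _)%:E; apply/funext => x.
  by rewrite /upd; case: eqVneq => [->|].
rewrite (IH _ _ (upd t v k))//; last first.
  move=> s s' ss'; apply: Xf => x; rewrite inE /upd.
  by case: eqVneq => //= _; exact: ss'.
congr EFin; apply: eq_rsum => s st; have sv : s v = k by rewrite st// upd_same.
rewrite cyl_cons sv setIA; congr (f _ * _); apply/funext => x.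
by rewrite /upd; case: eqVneq => [->|].
exact: index_enum_uniq.
Qed.

Lemma outside_measurable (U : {fset V}) (D : set (config V C)) :
  outside U D -> measurable D.
Proof.
apply: smallest_sub; first exact: smallest_sigma_algebra.
by move=> _ [v _ [i _ <-]]; apply: sub_sigma_algebra; exists v => //; exists i.
Qed.

End Local.

Section GibbsOfCylinders.
Variables (R : realType) (V : countType) (C : nat) (e : rel V) (lambda : R).
Hypotheses (lambda0 : 0 < lambda) (lfe : locally_finite e).
Local Notation cfg := (V -> 'I_C.+1).
Implicit Types (U : {fset V}) (s t : cfg).
Variable mu : probability (config V C) R.

Hypothesis mu_edge : forall x y, e x y ->
  mu [set s : config V C | ~~ (s x + s y <= C)%N] = 0%E.
(** The Gibbs property tested on cylinders and without division: both sides are continuous in the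
    cylinder probabilities, so it passes to limits of finite-volume laws. *)
Hypothesis mu_cyl : forall U (X : seq V) t, uniq X -> {subset boundary e U <= X} ->
  (forall x, x \in X -> x \notin U) ->
  fine (mu (cyl U t `&` cyl X t)) * rsum U (phi e lambda U) t =
  phi e lambda U t * fine (mu (cyl X t)).

Lemma measurable_edge x y : measurable [set s : config V C | ~~ (s x + s y <= C)%N].
Proof.
apply: (@cylinders_local _ _ _ [:: x; y]) => // s t st /=.
by rewrite !st ?inE ?eqxx ?orbT.
Qed.

(** If [phi] vanishes, a forbidden edge lies in the closure of [U] and [mu_edge] makes the cylinder
    null; otherwise the partition function is positive and can be divided out. *)
Lemma mu_local_spec U (X : seq V) t : uniq X -> {subset boundary e U <= X} ->
  (forall x, x \in X -> x \notin U) ->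
  fine (mu (cyl U t `&` cyl X t)) = local_spec e lambda U t * fine (mu (cyl X t)).
Proof.
move=> uX bX XU; have := mu_cyl t uX bX XU; rewrite local_specE//.
have := le_rsum_term U t (phi_ge0 (C := C) e lambda0 U).
have [p0|p0] := eqVneq (phi e lambda U t) 0.
  move=> _ _; rewrite p0 !mul0r.
  move/eqP: p0; rewrite phi_eq0// => /asboolPn.
  move/existsNP => [x] /existsNP[y] /not_implyP[xW] /not_implyP[yW] /not_implyP[exy bad].
  suff -> : mu (cyl U t `&` cyl X t) = 0%E by [].
  apply/eqP; rewrite -measure_le0 -(mu_edge exy).
  apply: le_measure; rewrite ?inE; [|exact: measurable_edge|].
    by apply: measurableI; exact: measurable_cyl.
  have W z s : z \in closure_fset e U -> (cyl U t `&` cyl X t) s -> s z = t z.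
    by rewrite in_fsetU => /orP[zU [H _]|/bX zX [_ H]]; exact: H.
  by move=> s Hs /=; rewrite (W x)// (W y)//; apply/negP.
move=> pr eq1; have r0 : rsum U (phi e lambda U) t != 0.
  by rewrite gt_eqF// (lt_le_trans _ pr)// lt0r p0 phi_ge0.
by rewrite mulrAC -eq1 mulfK.
Qed.

(** Both sides are finite measures in [D]. They agree on the cylinders off [U], which together with
    the empty set form a class stable under intersection, hence on the sigma-field that these
    generate. *)
Lemma mu_outside U t D : outside U D ->
  fine (mu (D `&` (cyl U t `&` cyl (boundary e U) t))) =
  local_spec e lambda U t * fine (mu (D `&` cyl (boundary e U) t)).
Proof.
pose b := boundary e U.
have mcyl X s : measurable (cyl X s : set (config V C)) by exact: measurable_cyl.
have mB : measurable (cyl U t `&` cyl b t : set (config V C)) by exact: measurableI.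
have mC : measurable (cyl b t : set (config V C)) by [].
have l0 : 0 <= local_spec e lambda U t by exact: local_spec_ge0.
pose m1 : {measure set (config V C) -> \bar R} := mrestr mu mB.
pose m2 : {measure set (config V C) -> \bar R} := mscale (NngNum l0) (mrestr mu mC).
pose G : set (set (config V C)) := [set A | A = set0 \/
  exists2 X : seq V, (forall x, x \in X -> x \notin U) & exists u, A = cyl X u].
have Gm : G `<=` measurable.
  by move=> A [->|[X _ [u ->]]]; [exact: measurable0|exact: mcyl].
have GI : setI_closed G.
  move=> A B [->|[X XU [u ->]]]; first by left; rewrite set0I.
  case=> [->|[Y YU [w ->]]]; first by left; rewrite setI0.
  have [[s [H1 H2]]|ns] := pselect (exists s, (cyl X u `&` cyl Y w) s); last first.
    by left; apply/seteqP; split => // s Hs; apply: ns; exists s.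
  right; exists (X ++ Y).
    by move=> x; rewrite mem_cat => /orP[/XU|/YU].
  exists s; rewrite (eq_cyl (t := u) (u := s)); last by move=> x /H1.
  rewrite (eq_cyl (t := w) (u := s)); last by move=> x /H2.
  apply/seteqP; split => s' /=.
    by case=> H3 H4 x; rewrite mem_cat => /orP[/H3|/H4].
  by move=> H; split => x xX; apply: H; rewrite mem_cat xX ?orbT.
have GT : G setT by right; exists [::] => //; exists t; rewrite cyl0.
have m12 A : G A -> m1 A = m2 A.
  move=> [->|[X XU [u ->]]]; first by rewrite !measure0.
  rewrite /m1 /m2 /= /mscale /= /mrestr /=.
  have [[s [H1 H2]]|ns] := pselect (exists s, (cyl X u `&` cyl b t) s); last first.
    have E0 : cyl X u `&` cyl b t = set0.
      by apply/seteqP; split => // s Hs; apply: ns; exists s.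
    by rewrite setIC -setIA (setIC (cyl b t)) E0 setI0 !measure0 mule0.
  (* One configuration that represents all three cylinders: [t] on [U] and [s] elsewhere. *)
  pose s0 := splice U s t.
  have s0U x : x \in U -> s0 x = t x by rewrite /s0 /splice => ->.
  have s0N x : x \notin U -> s0 x = s x by rewrite /s0 /splice => /negPf ->.
  have bU x : x \in b -> x \notin U by exact: boundary_notin.
  pose Y := undup (b ++ X).
  have cE : cyl X u `&` cyl b t = cyl Y s0.
    apply/seteqP; split => s' /=.
      case=> H3 H4 x; rewrite mem_undup mem_cat => /orP[xb|xX].
        by rewrite s0N ?bU// H4// H2.
      by rewrite s0N ?XU// H3// H1.
    move=> H; split => x xX.
      by rewrite H ?mem_undup ?mem_cat ?xX ?orbT// s0N ?XU// H1.
    by rewrite H ?mem_undup ?mem_cat ?xX// s0N ?bU// H2.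
  rewrite setIC -setIA (setIC (cyl b t)) cE (eq_cyl (t := t) (u := s0)) => [|x xU]; last by rewrite s0U.
  have -> : local_spec e lambda U t = local_spec e lambda U s0.
    apply: eq_local_spec => // x; rewrite in_fsetU => /orP[xU|xb]; first by rewrite s0U.
    by rewrite s0N ?bU// H2.
  rewrite -[LHS]fineK ?fin_num_measure//; last exact: measurableI.
  rewrite mu_local_spec ?undup_uniq//.
  - by rewrite EFinM fineK// fin_num_measure.
  - by move=> x xb; rewrite mem_undup mem_cat xb.
  - by move=> x; rewrite mem_undup mem_cat => /orP[/bU|/XU].
move=> oD.
have sG : <<s G >> D.
  apply: (smallest_sub _ _ oD); first exact: smallest_sigma_algebra.
  move=> _ [v vU [i _ <-]]; apply: sub_sigma_algebra; right; exists [:: v].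
    by move=> x; rewrite inE => /eqP ->.
  exists (fun=> i); apply/seteqP; split => s /=; last by apply; rewrite inE.
  by move=> sv x; rewrite inE => /eqP ->.
have gc : \bigcup_(k in [set: nat]) (fun=> [set: config V C]) k = setT.
  by apply/seteqP; split => // x _; exists 0%N.
have m1oo (k : nat) : (m1 ((fun=> setT) k) < +oo)%E.
  rewrite (le_lt_trans (y := 1%E)) ?ltry// /m1 /= /mrestr setTI.
  exact: probability_le1.
have := @g_sigma_algebra_measure_unique _ R _ G Gm (fun=> setT) (fun=> GT) gc m1 m2 GI m12 m1oo D sG.
rewrite /m1 /m2 /= /mscale /= /mrestr /= => ->.
rewrite fineM// fin_num_measure//; apply: measurableI => //.
exact: outside_measurable oD.
Qed.

Definition glue U t (eta : {ffun U -> 'I_C.+1}) : cfg :=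
  fun x => if insub x is Some y then eta y else t x.

Theorem gibbs_of_cylinders : is_gibbs e lambda mu.
Proof.
split.
  pose N := \bigcup_(i in [set: nat])
     (if choice.unpickle i is Some (x, y) then
        if e x y then [set s : config V C | ~~ (s x + s y <= C)%N] else set0 else set0).
  have negN : mu.-negligible N.
    apply: negligible_bigcup => i; case: (choice.unpickle i) => [[x y]|]; last exact: negligible_set0.
    case: ifP => exy; last exact: negligible_set0.
    exists [set s : config V C | ~~ (s x + s y <= C)%N]; split => //.
      exact: measurable_edge.
    exact: mu_edge.
  apply: negligibleS negN => s /= /existsNP[x] /existsNP[y] /not_implyP[exy bad].
  by exists (choice.pickle (x, y)) => //; rewrite choice.pickleK exy /=; apply/negP.
(* With [eta] written over [U], the specification reads only boundary spins of [t], so this version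
   is measurable with respect to the outside of [U]. *)
move=> U; exists (fun eta t => local_spec e lambda U (glue t eta)); split; last first.
  apply: aeW => t; apply: eq_local_spec => // x _; rewrite /glue.
  by case: insubP => //= y _ <-; rewrite ffunE.
move=> eta.
have dep s t : (forall x, x \in boundary e U -> s x = t x) ->
    local_spec e lambda U (glue s eta) = local_spec e lambda U (glue t eta).
  move=> st; apply: eq_local_spec => // x xW; rewrite /glue.
  case: insubP => //= xU; apply: st; move: xW.
  by rewrite in_fsetU (negPf xU).
split.
- move=> B _; apply: cylinders_local (fun x => @boundary_notin _ _ lfe U x) _ => s t /dep /=.
  by move=> ->.
- have mf : measurable_fun [set: config V C]
      (fun t => local_spec e lambda U (glue t eta)).
    exact: measurable_local dep.
  apply: measurable_bounded_integrable => //.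
    by rewrite (le_lt_trans (probability_le1 mu measurableT))// ltry.
  exists 1; split => // r r1 t _ /=; rewrite ger0_norm ?local_spec_ge0//.
  by rewrite (le_trans (local_spec_le1 _ _ _ _))// ltW.
- move=> D oD; have mD := outside_measurable oD.
  pose t0 : cfg := fun=> ord0.
  rewrite (integral_local (X := boundary e U) _ t0)// ?fset_uniq// => [|s]; last exact: local_spec_ge0.
  have AE t : [set s | restr U s = eta] = cyl U (glue t eta).
    apply/seteqP; split => s /=.
      by move=> <- x xU; rewrite /glue insubT /= ffunE.
    move=> H; apply/ffunP => x; rewrite ffunE H ?(valP x)// /glue.
    by rewrite valK.
  have mA : measurable ([set s | restr U s = eta] `&` D : set (config V C)).
    by rewrite (AE t0); apply: measurableI => //; exact: measurable_cyl.
  rewrite -[RHS]fineK ?fin_num_measure//; congr EFin.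
  rewrite -(rsum_prob mu t0 (fset_uniq (boundary e U)) mA); apply: eq_rsum => s _.
  have bs : cyl (boundary e U) s = cyl (boundary e U) (glue s eta).
    apply: eq_cyl => x /(boundary_notin lfe) xU; rewrite /glue insubF//.
    exact: negbTE.
  by rewrite (AE s) bs -mu_outside// (setIC _ D) setIA.
Qed.

End GibbsOfCylinders.

(** * Finite volumes and their limits *)

Section CylindersOfGibbs.
Variables (R : realType) (V : countType) (C : nat) (e : rel V) (lambda : R).
Hypotheses (lambda0 : 0 < lambda) (lfe : locally_finite e).
Local Notation cfg := (V -> 'I_C.+1).
Implicit Types (U : {fset V}) (s t : cfg).
Variable nu : probability (config V C) R.
Hypothesis gnu : is_gibbs e lambda nu.

(* The Gibbs property determines the kernel [k eta] at [s] only when [s] restricts to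
   [eta] on [U], hence an inequality; equality follows because both sides have the
   same sum over the spins in [U]. *)
Lemma gibbs_cyl_le U t :
  fine (nu (cyl U t `&` cyl (boundary e U) t)) <=
  local_spec e lambda U t * fine (nu (cyl (boundary e U) t)).
Proof.
case: gnu => _ /(_ U) [k [Hk /= kae]].
set A := cyl U t; set D := cyl (boundary e U) t; set c := local_spec _ _ _ _.
have AE : A = [set s : config V C | restr U s = restr U t].
  apply/seteqP; split => s /=.
    by move=> H; apply/ffunP => x; rewrite !ffunE; exact: H (valP x).
  by move=> /ffunP H x xU; have := H [` xU]%fset; rewrite !ffunE.
have [km ki kI] := Hk (restr U t).
pose T := g_sigma_algebraType (@cylinders V C [set v | v \notin U]).
have oD : outside U D.
  apply: (@cylinders_local _ _ _ (boundary e U)) => [x|s s' ss' H x xb /=].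
    exact: boundary_notin.
  by rewrite -ss'// H.
(* The boundary cylinder is split according to whether the version takes the value expected on it;
   the bad part [N] meets [A] in a null set. *)
pose M := D `&` (k (restr U t) @^-1` [set c]).
pose N := D `&` (k (restr U t) @^-1` ~` [set c]).
have oM : outside U M.
  exact (@measurableI _ T _ _ oD (km _ (measurable_set1 c))).
have oN : outside U N.
  exact (@measurableI _ T _ _ oD (km _ (measurableC (measurable_set1 c)))).
have mA : measurable (A : set (config V C)) by exact: measurable_cyl.
have mM := outside_measurable oM; have mN := outside_measurable oN.
have AN0 : nu (A `&` N) = 0%E.
  apply: measure_negligible; first exact: measurableI.
  apply: negligibleS kae => s /= [As [Ds /= ks]] H; apply: ks; rewrite /c.
  have <- : restr U s = restr U t by move: As; rewrite AE.
  rewrite H; apply: eq_local_spec => // x; rewrite in_fsetU => /orP[/As|/Ds] //.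
have -> : A `&` D = (A `&` M) `|` (A `&` N).
  rewrite -setIUr; congr (_ `&` _); rewrite -setIUr -preimage_setU setUCr.
  by rewrite preimage_setT setIT.
have AMe : nu (A `&` M) = (c%:E * nu M)%E.
  rewrite AE -kI// -integral_cst//; apply: eq_integral => s.
  by rewrite inE => -[_ /= ->].
have -> : nu ((A `&` M) `|` (A `&` N)) = (c%:E * nu M)%E.
  rewrite measureU0//; exact: measurableI.
rewrite fineM ?fin_num_measure// ler_wpM2l ?local_spec_ge0//.
have mD := outside_measurable oD.
apply: fine_le; rewrite ?fin_num_measure//.
by apply: le_measure; rewrite ?inE//; exact: subIsetl.
Qed.

Lemma gibbs_cyl U t : rsum U (phi e lambda U) t != 0 ->
  fine (nu (cyl U t `&` cyl (boundary e U) t)) * rsum U (phi e lambda U) t =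
  phi e lambda U t * fine (nu (cyl (boundary e U) t)).
Proof.
move=> r0; pose D := cyl (boundary e U) t.
pose q s := local_spec e lambda U s * fine (nu (cyl (boundary e U) s)) -
  fine (nu (cyl U s `&` cyl (boundary e U) s)).
have q0 s : 0 <= q s by rewrite subr_ge0; exact: gibbs_cyl_le.
have Q0 : rsum U q t = 0.
  rewrite (@eq_rsum _ _ _ _ _ (fun s => phi e lambda U s *
      (fine (nu D) / rsum U (phi e lambda U) t) + (-1) * fine (nu (D `&` cyl U s)))).
    rewrite rsumD rsumZr rsumZ rsum_prob ?fset_uniq//; last exact: measurable_cyl.
    by rewrite mulrC divfK// mulN1r subrr.
  move=> s st; rewrite /q mulN1r setIC.
  have Ds : cyl (boundary e U) s = D.
    by apply: eq_cyl => x /(boundary_notin lfe)/st.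
  by rewrite Ds local_specE// (rsum_off _ st) mulrAC mulrA.
have qt : q t = 0.
  by apply/eqP; rewrite eq_le q0 andbT -Q0; exact: le_rsum_term.
move/eqP: qt; rewrite /q subr_eq0 => /eqP <-.
by rewrite local_specE// mulrAC divfK.
Qed.

End CylindersOfGibbs.

(** * Finite-volume laws and the domain Markov property *)

Section FiniteVolume.
Variables (R : realType) (V : countType) (C : nat) (e : rel V) (lambda : R).
Hypotheses (lambda0 : 0 < lambda) (lfe : locally_finite e) (esym : symmetric e).
Local Notation cfg := (V -> 'I_C.+1).
Implicit Types (U : {fset V}) (B : seq V) (s t : cfg).

Definition zero_cfg : cfg := fun=> ord0.

Definition box_weight B s : R :=
  `[< allowable e s >]%:R * \prod_(v <- B) lambda ^+ s v.

(* Spins outside of [B] are 0: this is the free boundary condition. *)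
Definition box_law B (A : set cfg) : R :=
  rsum B (fun s => box_weight B s * `[< A s >]%:R) zero_cfg /
  rsum B (box_weight B) zero_cfg.

Lemma box_weight_ge0 B s : 0 <= box_weight B s.
Proof. by rewrite mulr_ge0// prodr_ge0// => v _; rewrite exprn_ge0// ltW. Qed.

Lemma box_partition_gt0 B : 0 < rsum B (box_weight B) zero_cfg.
Proof.
apply: lt_le_trans (le_rsum_term B zero_cfg (box_weight_ge0 B)).
rewrite mulr_gt0 ?prodr_gt0//.
by case: asboolP => // H; exfalso; apply: H => x y _.
Qed.

Lemma finadd_box_law B : finadd (box_law B).
Proof.
split.
- move=> A; rewrite divr_ge0 ?(ltW (box_partition_gt0 B))//.
  by apply: rsum_ge0 => s; rewrite mulr_ge0// box_weight_ge0.
- rewrite /box_law (@eq_rsum _ _ _ _ _ (box_weight B)).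
    by rewrite divff// gt_eqF// box_partition_gt0.
  by move=> s _; case: asboolP => [_|H]; [rewrite mulr1|exfalso; exact: H].
- move=> A A' AA'; rewrite /box_law -mulrDl -rsumD; congr (_ / _).
  apply: eq_rsum => s _; rewrite -mulrDr; congr (_ * _).
  have nAA' : ~ (A s /\ A' s).
    by move=> H; have : (A `&` A') s by []; rewrite AA'.
  case: (asboolP (A s)) => As; case: (asboolP (A' s)) => A's.
  + by exfalso; apply: nAA'.
  + by rewrite addr0; case: asboolP => // H; exfalso; apply: H; left.
  + by rewrite add0r; case: asboolP => // H; exfalso; apply: H; right.
  + by rewrite addr0; case: asboolP => // -[].
Qed.

Lemma box_law_edge B x y : e x y -> box_law B [set s | ~~ (s x + s y <= C)%N] = 0.
Proof.
move=> exy; rewrite /box_law (@eq_rsum _ _ _ _ _ (fun=> 0)) ?rsum0 ?mul0r//.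
move=> s _; rewrite /box_weight; case: (asboolP (allowable e s)) => [H|_]; last by rewrite !mul0r.
by case: asboolP => [/=|_]; rewrite ?mulr0// H.
Qed.

(** Domain Markov property: every edge either avoids [U] or lies in its closure, so the weight
    factors into [rest], constant while the spins off [U] are frozen, and [phi]. *)
Lemma box_law_cyl B U (X : seq V) t : uniq B -> {subset U <= B} ->
  {subset boundary e U <= X} -> (forall x, x \in X -> x \notin U) ->
  box_law B (cyl U t `&` cyl X t) * rsum U (phi e lambda U) t =
  phi e lambda U t * box_law B (cyl X t).
Proof.
move=> uB UB bX XU; rewrite /box_law mulrAC mulrA; congr (_ / _).
pose Y := seq.filter [predC U] B.
have pB : perm_eq B (Y ++ U).
  apply: uniq_perm => // [|x].
    rewrite cat_uniq filter_uniq// fset_uniq andbT /=.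
    by apply/hasPn => x xU; rewrite mem_filter /= xU.
  rewrite mem_cat mem_filter /=; case xU: (x \in U) => /=.
    by rewrite UB.
  by rewrite orbF.
rewrite !(perm_rsum _ _ uB pB) !rsum_cat -rsumZr -rsumZ; apply: eq_rsum => s _.
have XN s' : (forall x, x \notin U -> s' x = s x) -> cyl X t s' <-> cyl X t s.
  by move=> ss'; split => H x xX; have := H x xX; rewrite ss' ?XU.
have [sX|nsX] := pselect (cyl X t s); last first.
  have z (A : set cfg) : A `<=` cyl X t ->
      rsum U (fun s' => box_weight B s' * `[< A s' >]%:R) s = 0.
    move=> AX; rewrite -(rsum0 R U s); apply: eq_rsum => s' /XN H.
    by case: asboolP => [/AX/H//|_]; rewrite mulr0.
  by rewrite !z ?mul0r ?mulr0// => s' [].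
pose okout s := `[< forall x y, x \notin U -> y \notin U -> e x y -> (s x + s y <= C)%N >].
pose rest s := (okout s)%:R * \prod_(v <- Y) lambda ^+ s v : R.
have restE s' : (forall x, x \notin U -> s' x = s x) -> rest s' = rest s.
  move=> ss'; rewrite /rest; congr (_ * _).
    rewrite /okout; congr (nat_of_bool _)%:R; apply/asboolP/asboolP => H x y xU yU.
      by rewrite -!ss'//; exact: H.
    by rewrite !ss'//; exact: H.
  rewrite !big_seq; apply: eq_bigr => v; rewrite mem_filter /= => /andP[vU _].
  by rewrite ss'.
have bwE s' : box_weight B s' = rest s' * phi e lambda U s'.
  rewrite /box_weight (perm_big _ pB) /= big_cat /= /rest /phi mulrACA; congr (_ * _).
  have -> : `[< allowable e s' >] = okout s' && okon e (closure_fset e U) s'.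
    apply/asboolP/andP => [H|[/asboolP H1 /asboolP H2] x y exy].
      by split; apply/asboolP => x y _ _; exact: H.
    have inW z w : z \in U -> e z w -> w \in closure_fset e U.
      move=> zU ezw; rewrite in_fsetU; case wU: (w \in U) => //=.
      by apply/(mem_boundary U w lfe); rewrite wU; split => //; exists z => //; rewrite esym.
    have UW z : z \in U -> z \in closure_fset e U by rewrite in_fsetU => ->.
    have [xU|xU] := boolP (x \in U); first by apply: H2 => //; [exact: UW|exact: inW exy].
    have [yU|yU] := boolP (y \in U); last exact: H1.
    by apply: H2 => //; [rewrite esym in exy; exact: inW exy|exact: UW].
  by case: (okout _); case: (okon _ _ _); rewrite /= ?mulr1 ?mulr0.
have -> : rsum U (fun s' => box_weight B s' * `[< cyl X t s' >]%:R) s =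
    rest s * rsum U (phi e lambda U) t.
  have -> : rsum U (phi e lambda U) t = rsum U (phi e lambda U) s.
    by symmetry; apply: rsum_phi_boundary => x xb; exact/sX/bX.
  rewrite -rsumZ; apply: eq_rsum => s' ss'; rewrite bwE restE//.
  by case: asboolP => [_|H]; [rewrite mulr1|exfalso; apply: H; apply/XN].
have -> : rsum U (fun s' => box_weight B s' * `[< (cyl U t `&` cyl X t) s' >]%:R) s =
    rest s * phi e lambda U t.
  rewrite (@eq_rsum _ _ _ _ _ (fun s' => (agree U s' t)%:R * box_weight B s')).
    rewrite rsum_pick ?fset_uniq// bwE restE => [|x xU].
      congr (_ * _); apply: eq_phi => // x; rewrite in_fsetU /splice.
      by case: (x \in U) => //= xb; exact/sX/bX.
    by rewrite /splice (negPf xU).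
  move=> s' /XN H; rewrite mulrC; congr ((nat_of_bool _)%:R * _).
  apply/asboolP/agreeP => [[]|H'] //; split => //; exact/H.
by ring.
Qed.

End FiniteVolume.

(** * Limits along an ultrafilter *)

Section Limit.
Variables (R : realType) (V : countType) (C : nat).
Local Notation cfg := (V -> 'I_C.+1).

Lemma ultra_cvg01 (G : set_system nat) (u : nat -> R) : UltraFilter G ->
  (forall n, 0 <= u n <= 1) -> exists l, u @ G --> (l : R).
Proof.
move=> GU u01; have := @segment_compact R 0 1.
have FF : ProperFilter (u @ G) by exact: fmap_proper_filter.
move=> /(_ _ FF) []; first by apply: (@filterE _ G) => n /=; rewrite in_itv /= u01.
move=> l [_ cl]; exists l => N Nl.
have [//|GN] := in_ultra_setVsetC (u @^-1` N) GU.
by have [x []] := cl (~` N) N GN Nl.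
Qed.

(** An ultrafilter finer than [F] makes all events converge simultaneously, by compactness of
    [0, 1]. It is returned with the inclusion of [F], so that bounds holding eventually along [F]
    pass to the limit. *)
Lemma finadd_limit (F : set_system nat) (mn : nat -> set cfg -> R) :
  ProperFilter F -> (forall n, finadd (mn n)) ->
  exists2 G : set_system nat, ProperFilter G /\ F `<=` G &
  exists2 m : set cfg -> R, finadd m & forall A, (fun n => mn n A) @ G --> (m A : R).
Proof.
move=> FF fmn; have [G [GU FG]] := ultraFilterLemma FF.
exists G; first by split => //; exact: ultra_proper.
have GP : ProperFilter G by exact: ultra_proper.
have cv A : exists l, (fun n => mn n A) @ G --> (l : R).
  apply: ultra_cvg01 => n; case: (fmn n) => -> _ _ /=.
  exact: finadd_le1.
exists (fun A => projT1 (cid (cv A))) => [|A]; last by case: cid.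
split.
- move=> A; case: cid => l /= lA.
  by apply: (cvgr_to_ge lA); apply: nearW => n; case: (fmn n).
- case: cid => l /= lA; apply: (cvg_unique _ lA) => //.
  rewrite (_ : (fun n => mn n setT) = cst 1); first exact: cvg_cst.
  by apply/funext => n; case: (fmn n).
- move=> A B AB; case: cid => l /= lAB; case: cid => l1 /= lA; case: cid => l2 /= lB.
  apply: (cvg_unique _ lAB) => //.
  rewrite (_ : (fun n => mn n (A `|` B)) = (fun n => mn n A + mn n B)); first exact: cvgD.
  by apply/funext => n; case: (fmn n) => _ _; exact.
Qed.

End Limit.

(** * The recursion for the law of the root *)

Section Recursion.
Variables (R : realType) (C b : nat) (lambda : R).
Hypothesis lambda0 : 0 < lambda.
Implicit Types g h : 'I_C.+1 -> R.

Definition psum g (m : nat) : R := \sum_(k < C.+1 | (k <= m)%N) lambda ^+ k * g k.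

(* [h / g] is nondecreasing, cross-multiplied because [g] and [h] may vanish. *)
Definition hlr g h : Prop :=
  forall k m : 'I_C.+1, (k <= m)%N -> g m * h k <= g k * h m.

Lemma psum_ge0 g m : (forall k, 0 <= g k) -> 0 <= psum g m.
Proof. by move=> g0; apply: sumr_ge0 => k _; rewrite mulr_ge0// exprn_ge0// ltW. Qed.

Lemma le_psum g m n : (forall k, 0 <= g k) -> (m <= n)%N -> psum g m <= psum g n.
Proof.
move=> g0 mn; rewrite /psum [leRHS](bigID (fun k : 'I_C.+1 => (k <= m)%N)) /=.
rewrite [X in _ <= X + _](eq_bigl (fun k : 'I_C.+1 => (k <= m)%N)) => [|k].
  by rewrite lerDl sumr_ge0// => k _; rewrite mulr_ge0// exprn_ge0// ltW.
by rewrite andbC; case: (leqP k m) => //= /leq_trans; apply.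
Qed.

Lemma psum_gt0 g m : (forall k, 0 <= g k) -> 0 < g ord0 -> 0 < psum g m.
Proof.
move=> g0 g00; rewrite /psum (bigD1 ord0)//= expr0 mul1r ltr_pwDl//.
by apply: sumr_ge0 => k _; rewrite mulr_ge0// exprn_ge0// ltW.
Qed.

Lemma psumE g h m : (forall k : 'I_C.+1, (k <= m)%N -> g k = h k) ->
  psum g m = psum h m.
Proof. by move=> gh; apply: eq_bigr => k km; rewrite gh. Qed.

Lemma psumZ g c m : psum (fun k => g k * c) m = psum g m * c.
Proof. by rewrite /psum mulr_suml; apply: eq_bigr => k _; rewrite mulrA. Qed.

(** After the product of the two sums up to [m] is cancelled, a double sum remains whose terms
    compare one by one. *)
Lemma hlr_psum g h m n : (forall k, 0 <= g k) -> (forall k, 0 <= h k) ->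
  hlr g h -> (m <= n)%N -> psum g n * psum h m <= psum g m * psum h n.
Proof.
move=> g0 h0 gh mn.
have split_sum f : psum f n = psum f m +
    \sum_(k < C.+1 | (m < k <= n)%N) lambda ^+ k * f k.
  rewrite /psum (bigID (fun k : 'I_C.+1 => (k <= m)%N)) /=; congr (_ + _).
    by apply: eq_bigl => k; case: (leqP k m) => [km|]; rewrite ?andbF ?andbT// (leq_trans km).
  by apply: eq_bigl => k; rewrite -ltnNge andbC.
rewrite (split_sum g) (split_sum h) mulrDl mulrDr lerD2l.
rewrite /psum !mulr_suml; under eq_bigr do rewrite mulr_sumr.
under [leRHS]eq_bigr do rewrite mulr_sumr.
rewrite exchange_big /=; apply: ler_sum => k km; apply: ler_sum => l /andP[ml ln].
have -> : lambda ^+ l * g l * (lambda ^+ k * h k) =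
  lambda ^+ l * lambda ^+ k * (g l * h k) by ring.
have -> : lambda ^+ k * g k * (lambda ^+ l * h l) =
  lambda ^+ l * lambda ^+ k * (g k * h l) by ring.
apply: ler_wpM2l; first by rewrite mulr_ge0// exprn_ge0// ltW.
by apply: gh; rewrite (leq_trans km)// ltnW.
Qed.

(** The order is reversed because partial sums are evaluated at [C - k]. The fields may differ from
    child to child, as they do under an inhomogeneous boundary condition. *)
Lemma hlr_prod (I : finType) (g h : I -> 'I_C.+1 -> R) :
  (forall i k, 0 <= g i k) -> (forall i k, 0 <= h i k) ->
  (forall i, hlr (g i) (h i)) ->
  hlr (fun k => \prod_i psum (h i) (C - k)) (fun k => \prod_i psum (g i) (C - k)).
Proof.
move=> g0 h0 gh k m km; rewrite -!big_split /=; apply: ler_prod => i _.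
rewrite mulr_ge0 ?psum_ge0//= mulrC [leRHS]mulrC; apply: hlr_psum => //.
by rewrite leq_sub2l.
Qed.

(* The field at a vertex whose descendants at distance [n] all have spin 0. *)
Fixpoint hfield n : 'I_C.+1 -> R :=
  if n is n'.+1 then fun k => psum (hfield n') (C - k) ^+ b
  else fun k => (k == ord0)%:R.

Definition rcdf n m : R := psum (hfield n) m / psum (hfield n) C.

Lemma hfield_ge0 n k : 0 <= hfield n k.
Proof.
elim: n k => [|n IH] k /=; first exact: ler0n.
by rewrite exprn_ge0// psum_ge0.
Qed.

Lemma hfield_gt0 n : 0 < hfield n ord0.
Proof.
elim: n => [|n IH] /=; first exact: ltr01.
by rewrite exprn_gt0// psum_gt0// => k; exact: hfield_ge0.
Qed.

Lemma psum_hfield_gt0 n m : 0 < psum (hfield n) m.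
Proof. by apply: psum_gt0 => [k|]; [exact: hfield_ge0|exact: hfield_gt0]. Qed.

Lemma psum_hfield0 m : psum (hfield 0) m = 1.
Proof.
rewrite /psum (bigD1 ord0)//= mulr1 expr0 big1 ?addr0// => k /andP[_ /negPf ->].
by rewrite mulr0.
Qed.

Lemma hfield1 k : hfield 1 k = 1.
Proof. by rewrite /= -/(hfield 0) psum_hfield0 expr1n. Qed.

Lemma rcdf0 m : rcdf 0 m = 1.
Proof. by rewrite /rcdf !psum_hfield0 divff// oner_neq0. Qed.

Lemma rcdf_max n : rcdf n C = 1.
Proof. by rewrite /rcdf divff// gt_eqF// psum_hfield_gt0. Qed.

Lemma rcdf_gt0 n m : 0 < rcdf n m.
Proof. by rewrite divr_gt0// psum_hfield_gt0. Qed.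

Lemma rcdfS n m : rcdf n.+1 m =
  psum (fun k => rcdf n (C - k) ^+ b) m / psum (fun k => rcdf n (C - k) ^+ b) C.
Proof.
have H p : psum (fun k => rcdf n (C - k) ^+ b) p =
    psum (hfield n.+1) p * (psum (hfield n) C)^-1 ^+ b.
  by rewrite -psumZ; apply: psumE => k _; rewrite /rcdf exprMn.
by rewrite !H invfM mulrACA divff ?mulr1// expf_neq0// invr_neq0// gt_eqF// psum_hfield_gt0.
Qed.

(** The point mass at spin 0 is extremal for the order, and the constant [hfield 1] is the opposite
    extreme among nonincreasing fields; the field of any boundary condition lies between them. *)
Lemma hlr_hfield0 g : (forall k, 0 <= g k) -> hlr (hfield 0) g.
Proof.
move=> g0 k m km /=; have [m0|m0] := eqVneq m ord0.
  have -> : k = ord0 by apply/val_inj/eqP; rewrite /= -leqn0 (leq_trans km)// m0.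
  by rewrite m0 eqxx.
by rewrite mul0r mulr_ge0// ler0n.
Qed.

Lemma hlr_hfield1 g : (forall k l : 'I_C.+1, (k <= l)%N -> g l <= g k) -> hlr g (hfield 1).
Proof. by move=> g0 k m km; rewrite !hfield1 !mulr1 g0. Qed.

Lemma hlr_expr g h : (forall k, 0 <= g k) -> (forall k, 0 <= h k) -> hlr g h ->
  hlr (fun k => psum h (C - k) ^+ b) (fun k => psum g (C - k) ^+ b).
Proof.
move=> g0 h0 gh k m km.
have := @hlr_prod 'I_b (fun=> g) (fun=> h) (fun=> g0) (fun=> h0) (fun=> gh) k m km.
by rewrite !prodr_const !card_ord.
Qed.

Lemma hlr_hfieldS n : if odd n then hlr (hfield n.+1) (hfield n) else hlr (hfield n) (hfield n.+1).
Proof.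
elim: n => [|n IH]; first by apply: hlr_hfield0; exact: hfield_ge0.
rewrite oddS; case: (odd n) IH => IH;
  exact: (hlr_expr (hfield_ge0 _) (hfield_ge0 _) IH).
Qed.

Lemma hlr_hfieldSS n : if odd n then hlr (hfield n.+2) (hfield n) else hlr (hfield n) (hfield n.+2).
Proof.
elim: n => [|n IH]; first by apply: hlr_hfield0; exact: hfield_ge0.
rewrite oddS; case: (odd n) IH => IH;
  exact: (hlr_expr (hfield_ge0 _) (hfield_ge0 _) IH).
Qed.

Lemma rcdf_out n m : (C <= m)%N -> rcdf n m = 1.
Proof.
move=> Cm; rewrite -(rcdf_max n) /rcdf; congr (_ / _); apply: eq_bigl => k.
have kC : (k <= C)%N by rewrite -ltnS.
by rewrite kC (leq_trans kC Cm).
Qed.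

Lemma rcdf_ratio n n' m m' : hlr (hfield n) (hfield n') -> (m <= m')%N ->
  rcdf n m' * rcdf n' m <= rcdf n m * rcdf n' m'.
Proof.
move=> nn' mm'; rewrite /rcdf !mulf_div ler_pM2r ?invr_gt0 ?mulr_gt0 ?psum_hfield_gt0//.
by apply: hlr_psum => // k; exact: hfield_ge0.
Qed.

Lemma rcdf_hlr n n' m : hlr (hfield n) (hfield n') -> rcdf n' m <= rcdf n m.
Proof.
move=> nn'; have [mC|Cm] := leqP m C; last by rewrite !rcdf_out// ltnW.
by have := rcdf_ratio nn' mC; rewrite !rcdf_max mul1r mulr1.
Qed.

End Recursion.

(** * The tree *)

Section Tree.
Variables (R : realType) (C b : nat) (lambda : R).
Hypothesis lambda0 : 0 < lambda.
Local Notation V := (seq 'I_b).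
Local Notation cfg := (V -> 'I_C.+1).
Implicit Types (s t : cfg) (h : V -> 'I_C.+1 -> R).

Fixpoint level n : seq V :=
  if n is n'.+1 then [seq i :: w | w <- level n', i <- enum 'I_b] else [:: [::]].

Fixpoint tball n : seq V := if n is n'.+1 then tball n' ++ level n else level 0.

Lemma ballS n : tball n.+1 = tball n ++ level n.+1.
Proof. by []. Qed.

Lemma mem_level n (v : V) : (v \in level n) = (size v == n).
Proof.
elim: n v => [|n IH] v /=; first by rewrite inE size_eq0.
apply/allpairsP/idP => [[[w i] /= [wn _ ->]]|]; first by rewrite eqSS -IH.
by case: v => // i w; rewrite eqSS -IH => wn; exists (w, i); rewrite mem_enum.
Qed.

Lemma level_uniq n : uniq (level n).
Proof.
elim: n => //= n IH; apply: allpairs_uniq => //; first exact: enum_uniq.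
by move=> [w i] [w' i'] _ _ /= [-> ->].
Qed.

Lemma mem_ball n (v : V) : (v \in tball n) = (size v <= n)%N.
Proof.
elim: n v => [|n IH] v; first by rewrite /= inE leqn0 size_eq0.
by rewrite ballS mem_cat IH mem_level [RHS]leq_eqVlt ltnS orbC.
Qed.

Lemma ball_uniq n : uniq (tball n).
Proof.
elim: n => // n IH; rewrite ballS cat_uniq IH level_uniq andbT.
apply/hasPn => v; rewrite mem_level mem_ball => /eqP ->.
by rewrite -ltnNge.
Qed.

Lemma tree_edge_sym : symmetric (@tree_edge b).
Proof. by move=> x y; rewrite /tree_edge orbC. Qed.

Lemma tree_edge_cons (i : 'I_b) (v : V) : tree_edge v (i :: v).
Proof. by apply/orP; left; apply/existsP; exists i. Qed.

Lemma tree_edgeP (x y : V) : tree_edge x y ->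
  (exists i, y = i :: x) \/ (exists i, x = i :: y).
Proof. by move=> /orP[] /existsP[i /eqP ->]; [left|right]; exists i. Qed.

Lemma allowable_tree t : allowable (@tree_edge b) t <->
  forall i v, (t (i :: v) + t v <= C)%N.
Proof.
split => [H i v|H x y /tree_edgeP[] [i ->]].
- by apply: H; rewrite tree_edge_sym; exact: tree_edge_cons.
- by rewrite addnC; exact: H.
- exact: H.
Qed.

(** The constraint between [v] and its parent. At the root [behead] returns the root itself, which
    is why [core] and [ok_ball] test only the other vertices. *)
Definition up_ok t (v : V) : bool := (t v + t (behead v) <= C)%N.

Fixpoint core n t : R :=
  if n is n'.+1 then core n' t * \prod_(v <- level n) (lambda ^+ t v * (up_ok t v)%:R)
  else lambda ^+ t [::].

(* The external field [h] on the sphere of radius [n] carries the weight of the part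
   of the tree outside of the ball. *)
Definition tree_weight n h t : R := core n t * \prod_(v <- level n) h v (t v).

Definition Phi h : V -> 'I_C.+1 -> R :=
  fun w k => \prod_(i < b) psum lambda (h (i :: w)) (C - k).

Lemma coreS n t : core n.+1 t =
  core n t * \prod_(v <- level n.+1) (lambda ^+ t v * (up_ok t v)%:R).
Proof. by []. Qed.

Lemma eq_core n s t : (forall v, (size v <= n)%N -> s v = t v) -> core n s = core n t.
Proof.
elim: n => [|n IH] st; first by rewrite /= st.
rewrite !coreS IH => [|v vn]; last by rewrite st// ltnW.
congr (_ * _); rewrite !big_seq; apply: eq_bigr => v.
rewrite mem_level => /eqP vn; rewrite /up_ok !st ?vn// size_behead vn.
exact: leqnSn.
Qed.

Lemma big_level_succ n (F : V -> R) :
  \prod_(v <- level n.+1) F v = \prod_(w <- level n) \prod_(i < b) F (i :: w).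
Proof.
rewrite /= big_allpairs_dep; apply: eq_bigr => w _.
by rewrite big_enum.
Qed.

(** Given the ball of radius [n], the spins of the next sphere interact only with their parents, so
    their sum of products is a product of sums. *)
Lemma tree_weight_peel n h t :
  rsum (level n.+1) (tree_weight n.+1 h) t = tree_weight n (Phi h) t.
Proof.
pose F (v : V) (k : 'I_C.+1) := lambda ^+ k * ((k + t (behead v) <= C)%N)%:R * h v k.
rewrite (@eq_rsum _ _ _ _ _ (fun s => core n t * \prod_(v <- level n.+1) F v (s v))).
  rewrite rsumZ rsum_prod ?level_uniq// big_level_succ; congr (_ * _).
  apply: eq_bigr => w _; apply: eq_bigr => i _; rewrite /psum [RHS]big_mkcond /=.
  apply: eq_bigr => k _; rewrite /F /=.
  have -> : (k <= C - t w)%N = (k + t w <= C)%N.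
    by rewrite leq_subRL 1?addnC// -ltnS ltn_ord.
  by case: leqP; rewrite ?mulr1// mulr0 mul0r.
move=> s st; rewrite /tree_weight coreS (@eq_core n s t) => [|v vn].
  rewrite -mulrA -big_split; congr (_ * _); rewrite !big_seq; apply: eq_bigr => v.
  rewrite mem_level => /eqP vn; rewrite /F /up_ok (st (behead v))//.
  by rewrite mem_level size_behead vn neq_ltn /= ltnSn.
by apply: st; rewrite mem_level neq_ltn ltnS vn.
Qed.

Lemma rsum_ball n h (g : 'I_C.+1 -> R) t :
  rsum (tball n) (fun s => tree_weight n h s * g (s [::])) t =
  \sum_(k < C.+1) lambda ^+ k * iter n Phi h [::] k * g k.
Proof.
elim: n h => [|n IH] h.
  by rewrite /=; apply: eq_bigr => k _; rewrite /tree_weight /= big_seq1 !upd_same.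
rewrite ballS rsum_cat iterSr -(IH (Phi h)); apply: eq_rsum => s _.
rewrite -tree_weight_peel -rsumZr; apply: eq_rsum => s' ss'.
by rewrite (ss' [::])// mem_level.
Qed.

Definition ok_ball n t : bool :=
  `[< forall v : V, (0 < size v <= n)%N -> up_ok t v >].

Lemma ok_ballS n t : ok_ball n.+1 t = ok_ball n t && all (up_ok t) (level n.+1).
Proof.
apply/asboolP/andP => [H|[/asboolP H1 /allP H2] v].
  split; first by apply/asboolP => v /andP[v0 vn]; apply: H; rewrite v0 (leq_trans vn).
  by apply/allP => v; rewrite mem_level => /eqP vn; apply: H; rewrite vn /=.
rewrite [(_ <= n.+1)%N]leq_eqVlt ltnS => /andP[v0 /orP[vn|vn]].
  by apply: H2; rewrite mem_level.
by apply: H1; rewrite v0.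
Qed.

Lemma coreE n t : core n t = (ok_ball n t)%:R * \prod_(v <- tball n) lambda ^+ t v.
Proof.
elim: n => [|n IH].
  rewrite /= big_seq1; suff -> : ok_ball 0 t by rewrite mul1r.
  by apply/asboolP => v; rewrite leqn0; case: (size v).
rewrite coreS IH ok_ballS ballS big_cat big_split.
have -> : \prod_(v <- level n.+1) (up_ok t v)%:R = (all (up_ok t) (level n.+1))%:R :> R.
  elim: (level n.+1) => [|v L IHL]; first by rewrite big_nil.
  by rewrite big_cons IHL /=; case: (up_ok t v); rewrite ?mul1r ?mul0r.
rewrite -mulnb natrM.
set P := \prod_(v <- tball n) _; set Q := \prod_(v <- level n.+1) _.
have -> (a c : R) : a * P * (Q * c) = a * c * (P * Q) by ring.
by [].
Qed.

Lemma core_ge0 n t : 0 <= core n t.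
Proof. by rewrite coreE mulr_ge0// prodr_ge0// => v _; rewrite exprn_ge0// ltW. Qed.

Lemma box_weight_ball n t : (forall v, (n < size v)%N -> t v = ord0) ->
  box_weight (@tree_edge b) lambda (tball n) t = core n t.
Proof.
move=> t0; rewrite coreE /box_weight; congr ((nat_of_bool _)%:R * _).
apply/asboolP/asboolP => [/allowable_tree H [//|i v] _|H]; first exact: H.
apply/allowable_tree => i v; have [vn|vn] := ltnP (size v) n.
  exact: (H (i :: v)).
by rewrite (t0 (i :: v)) /= ?ltnS// add0n -ltnS.
Qed.

Definition fball n : {fset V} := [fset x in tball n]%fset.

Lemma mem_fball n (v : V) : (v \in fball n) = (size v <= n)%N.
Proof. by rewrite inE mem_ball. Qed.

Lemma mem_boundary_ball n (v : V) :
  (v \in boundary (@tree_edge b) (fball n)) = (size v == n.+1).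
Proof.
apply/idP/eqP => [/(mem_boundary _ _ (@tree_locally_finite b))|vn].
  rewrite mem_fball -ltnNge => -[vn [z]]; rewrite mem_fball => zn /tree_edgeP[] [i E].
    by move: zn vn; rewrite E /= => zn vn; have := ltn_trans vn zn; rewrite ltnn.
  by move: vn; rewrite E /= ltnS => nz; apply/eqP; rewrite eqSS eqn_leq zn.
apply/(mem_boundary _ _ (@tree_locally_finite b)); rewrite mem_fball vn ltnn.
split => //; case: v vn => // i w [wn]; exists w; first by rewrite mem_fball wn.
by rewrite tree_edge_sym; exact: tree_edge_cons.
Qed.

(* The external field created by the spins of [t] on the next sphere. *)
Definition bc t : V -> 'I_C.+1 -> R := fun w k =>
  \prod_(i < b) ((k + t (i :: w) <= C)%N)%:R.

Lemma perm_fball n : perm_eq (fball n) (tball n).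
Proof.
by apply: uniq_perm; [exact: fset_uniq|exact: ball_uniq|move=> v; rewrite mem_fball mem_ball].
Qed.

Lemma phi_ball n t : phi (@tree_edge b) lambda (fball n) t = tree_weight n (bc t) t.
Proof.
rewrite /phi (perm_big _ (perm_fball n)) /= /tree_weight coreE -mulrA mulrCA.
rewrite [in LHS]mulrC; congr (_ * _).
have -> : okon (@tree_edge b) (closure_fset (@tree_edge b) (fball n)) t = ok_ball n.+1 t.
  have inW v : (v \in closure_fset (@tree_edge b) (fball n)) = (size v <= n.+1)%N.
    by rewrite in_fsetU mem_fball mem_boundary_ball [RHS]leq_eqVlt ltnS orbC.
  apply/asboolP/asboolP => H.
    move=> [//|i v] /= vn; apply: H; rewrite ?inW//=; first exact: ltnW.
    by rewrite tree_edge_sym; exact: tree_edge_cons.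
  move=> x y; rewrite !inW => xn yn /tree_edgeP[] [i E]; subst.
    by rewrite addnC; exact: (H (i :: x)).
  exact: (H (i :: y)).
rewrite ok_ballS -mulnb natrM; congr (_ * _).
have -> : (all (up_ok t) (level n.+1))%:R = \prod_(v <- level n.+1) (up_ok t v)%:R :> R.
  elim: (level n.+1) => [|v L IHL]; first by rewrite big_nil.
  by rewrite big_cons -IHL /=; case: (up_ok t v); rewrite ?mul1r ?mul0r.
rewrite big_level_succ; apply: eq_bigr => w _; apply: eq_bigr => i _.
by rewrite /up_ok /= addnC.
Qed.

End Tree.

(** * Gibbs measures on the tree *)

Section LocalEvents.
Variables (R : realType) (V : countType) (C : nat).
Local Notation cfg := (V -> 'I_C.+1).

Lemma finadd_extension_local (m : set cfg -> R) (mu : probability (config V C) R)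
    (X : seq V) (A : set (config V C)) : finadd m ->
  (forall X t, uniq X -> mu (cyl X t) = (m (cyl X t))%:E) ->
  (forall s t : cfg, (forall x, x \in X -> s x = t x) -> A s -> A t) ->
  mu A = (m A)%:E.
Proof.
move=> fm mum XA; pose Y := undup X; have uY : uniq Y by exact: undup_uniq.
have mA : measurable A.
  exact: (cylinders_local (W := setT) (X := X)).
rewrite -[LHS]fineK ?fin_num_measure//; congr EFin.
pose t : cfg := fun=> ord0.
rewrite -(rsum_prob mu t uY mA) -(rsum_finadd fm A t uY); apply: eq_rsum => s _.
have HY u : cyl Y s u -> forall x, x \in X -> s x = u x.
  by move=> H x xX; rewrite H// mem_undup.
have [As|nAs] := pselect (A s).
  have -> : A `&` cyl Y s = cyl Y s by apply/setIidr => u /HY/XA; exact.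
  by rewrite mum.
have -> : A `&` cyl Y s = set0.
  apply/seteqP; split => // u [Au /HY H]; apply: nAs; apply: XA Au => x xX.
  by rewrite H.
by rewrite measure0 (finadd_set0 fm).
Qed.

Lemma eq_prob_cyl (mu nu : probability (config V C) R) :
  (forall X t, uniq X -> mu (cyl X t) = nu (cyl X t)) ->
  forall A, measurable A -> mu A = nu A.
Proof.
move=> H; pose G : set (set (config V C)) := [set A | A = set0 \/
  exists X : seq V, exists u, A = cyl X u].
have cE X s : cyl X s = cyl (undup X) s.
  by apply/seteqP; split => s' H' x xX; apply: H'; move: xX; rewrite mem_undup.
have GI : setI_closed G.
  move=> A B [->|[X [u ->]]]; first by left; rewrite set0I.
  case=> [->|[Y [w ->]]]; first by left; rewrite setI0.
  have [[s [H1 H2]]|ns] := pselect (exists s, (cyl X u `&` cyl Y w) s); last first.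
    by left; apply/seteqP; split => // s Hs; apply: ns; exists s.
  right; exists (X ++ Y), s.
  rewrite (eq_cyl (t := u) (u := s)); last by move=> x /H1.
  rewrite (eq_cyl (t := w) (u := s)); last by move=> x /H2.
  apply/seteqP; split => s' /=.
    by case=> H3 H4 x; rewrite mem_cat => /orP[/H3|/H4].
  by move=> H'; split => x xX; apply: H'; rewrite mem_cat xX ?orbT.
have GT : G setT by right; exists [::], (fun=> ord0); rewrite cyl0.
have gc : \bigcup_(k in [set: nat]) (fun=> [set: config V C]) k = setT.
  by apply/seteqP; split => // x _; exists 0%N.
have mG : @measurable _ (config V C) = <<s G >>.
  apply/seteqP; split; apply: smallest_sub; try exact: smallest_sigma_algebra.
    move=> _ [v _ [i _ <-]]; apply: sub_sigma_algebra; right; exists [:: v], (fun=> i).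
    apply/seteqP; split => s /=; last by apply; rewrite inE.
    by move=> sv x; rewrite inE => /eqP ->.
  move=> A [->|[X [u ->]]]; first exact: (@measurable0 _ (config V C)).
  exact: measurable_cyl.
apply: (@measure_unique _ R _ G (fun=> setT) mG GI (fun=> GT) gc).
  by move=> A [->|[X [u ->]]]; [rewrite !measure0|rewrite cE; apply: H; exact: undup_uniq].
by move=> k; rewrite (le_lt_trans (probability_le1 mu measurableT))// ltry.
Qed.

End LocalEvents.

Section TreeGibbs.
Variables (R : realType) (C b : nat) (lambda : R).
Hypothesis lambda0 : 0 < lambda.
Local Notation V := (seq 'I_b).
Local Notation cfg := (V -> 'I_C.+1).
Implicit Types (s t : cfg) (h : V -> 'I_C.+1 -> R).

Definition root_le (m : nat) : set cfg := [set s | (s [::] <= m)%N].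

Lemma PhiE (h : V -> 'I_C.+1 -> R) (g : 'I_C.+1 -> R) : (forall v k, h v k = g k) ->
  forall v k, Phi lambda h v k = psum lambda g (C - k) ^+ b.
Proof.
move=> hg v k; rewrite /Phi (eq_bigr (fun=> psum lambda g (C - k))) ?prodr_const ?card_ord//.
by move=> i _; apply: psumE => l _; rewrite hg.
Qed.

Lemma iter_Phi_hfield n (h : V -> 'I_C.+1 -> R) d :
  (forall v k, h v k = hfield b lambda d k) ->
  forall v k, iter n (Phi lambda) h v k = hfield b lambda (n + d) k.
Proof. by move=> hd; elim: n => [//|n IH] v k; rewrite iterS (PhiE IH). Qed.

(** The index is [n.+1] because the spins 0 begin on the sphere of radius [n.+1]; on the sphere of
    radius [n] they leave the constant field [hfield 1]. *)
Lemma box_law_root n m :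
  box_law (@tree_edge b) lambda (tball b n) (root_le m) = rcdf C b lambda n.+1 m.
Proof.
have H (g : 'I_C.+1 -> R) :
    rsum (tball b n) (fun s => box_weight (@tree_edge b) lambda (tball b n) s * g (s [::]))
      (@zero_cfg V C) = \sum_(k < C.+1) lambda ^+ k * hfield b lambda n.+1 k * g k.
  rewrite (@eq_rsum _ _ _ _ _ (fun s => tree_weight lambda n (fun=> fun=> 1) s * g (s [::]))).
    rewrite rsum_ball; apply: eq_bigr => k _; rewrite (iter_Phi_hfield n (d := 1)) ?addn1//.
    by move=> v l; rewrite hfield1.
  move=> s s0; rewrite box_weight_ball; last first.
    by move=> v vn; rewrite s0// mem_ball -ltnNge.
  by rewrite /tree_weight big1 ?mulr1.
rewrite /rcdf -/(hfield b lambda n.+1).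
rewrite /box_law; congr (_ / _).
  rewrite (@eq_rsum _ _ _ _ _ (fun s => box_weight (@tree_edge b) lambda (tball b n) s * ((s [::] <= m)%N)%:R)).
    rewrite (H (fun k => ((k <= m)%N)%:R)) /psum [RHS]big_mkcond /=.
    by apply: eq_bigr => k _; case: ifP; rewrite ?mulr1 ?mulr0.
  by move=> s _; congr (_ * (nat_of_bool _)%:R); apply/asboolP/idP.
rewrite (@eq_rsum _ _ _ _ _ (fun s => box_weight (@tree_edge b) lambda (tball b n) s * 1)).
  rewrite (H (fun=> 1)) /psum [RHS]big_mkcond /=; apply: eq_bigr => k _.
  by rewrite mulr1 -ltnS ltn_ord.
by move=> s _; rewrite mulr1.
Qed.

(** The filter is left free so that it can run along even or along odd radii. Stating one-sided
    bounds avoids any assumption that the recursion converges. *)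
Lemma tree_gibbs_limit (F : set_system nat) : ProperFilter F ->
  (forall N, \forall n \near F, (N <= n)%N) ->
  exists2 mu : probability (config V C) R, is_gibbs (@tree_edge b) lambda mu &
  forall m a, ((\forall n \near F, rcdf C b lambda n.+1 m <= a) -> fine (mu (root_le m)) <= a) /\
    ((\forall n \near F, a <= rcdf C b lambda n.+1 m) -> a <= fine (mu (root_le m))).
Proof.
move=> FF Finf; have lft := @tree_locally_finite b.
have [G [GP FG] [m fm mG]] := finadd_limit FF
  (fun n => finadd_box_law C (@tree_edge b) lambda0 (tball b n)).
have [mu mum] := finadd_extension fm.
have muE (X : seq V) (A : set (config V C)) :
    (forall s t : cfg, (forall x, x \in X -> s x = t x) -> A s -> A t) -> mu A = (m A)%:E.
  exact: finadd_extension_local.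
exists mu.
  apply: gibbs_of_cylinders => //.
    move=> x y exy; rewrite (muE [:: x; y]).
      congr EFin; apply: (cvg_unique _ (mG _)) => //.
      rewrite (_ : (fun n => _) = cst 0); first exact: cvg_cst.
      by apply/funext => n; rewrite box_law_edge.
    by move=> s t st /=; rewrite !st ?inE ?eqxx ?orbT.
  move=> U X t uX bX XU.
  rewrite (muE (U ++ X)); last first.
    move=> s u su [H1 H2]; split => x xX; rewrite -su ?mem_cat ?xX ?orbT//.
      exact: H1.
    exact: H2.
  rewrite (muE X) => [/=|s u su H x xX]; last by rewrite -su// H.
  set Ph := rsum _ _ _; set ph := phi _ _ _ _.
  set A := cyl U t `&` cyl X t; set B := cyl X t.
  have cA : (fun n => box_law (@tree_edge b) lambda (tball b n) A * Ph) @ G --> m A * Ph.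
    by apply: cvgMl; exact: mG.
  have cB : (fun n => ph * box_law (@tree_edge b) lambda (tball b n) B) @ G --> ph * m B.
    by apply: cvgMr; exact: mG.
  apply: (cvg_unique _ cA) => //; apply: cvg_trans cB; apply: near_eq_cvg.
  apply: FG; apply: filterS (Finf (\max_(x <- U) size x)%N) => n Hn.
  rewrite box_law_cyl//; [exact: tree_edge_sym|exact: ball_uniq|].
  move=> x xU; rewrite mem_ball (leq_trans _ Hn)//.
  by have := @leq_bigmax_seq _ (enum_fset U) xpredT (fun x => size x) x xU isT.
move=> k a; have rootE : mu (root_le k) = (m (root_le k))%:E.
  by apply: (muE [:: [::]]) => s t st; rewrite /root_le /= st// inE.
rewrite rootE /=; split => Fk.
  apply: (cvgr_to_le (mG (root_le k))); apply: FG; apply: filterS Fk => n.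
  by rewrite box_law_root.
apply: (cvgr_to_ge (mG (root_le k))); apply: FG; apply: filterS Fk => n.
by rewrite box_law_root.
Qed.

Lemma exists_tree_gibbs :
  exists mu : probability (config V C) R, is_gibbs (@tree_edge b) lambda mu.
Proof.
have [|mu gmu _] := @tree_gibbs_limit \oo _; last by exists mu.
by move=> N; exact: nbhs_infty_ge.
Qed.

Lemma tree_phase_coexistence m x y : x < y ->
  (forall n, ~~ odd n -> y <= rcdf C b lambda n m) ->
  (forall n, odd n -> rcdf C b lambda n m <= x) ->
  phase_coexistence C (@tree_edge b) lambda.
Proof.
move=> xy Hy Hx.
have big_filter (f : nat -> nat) : (forall n, (n <= f n)%N) ->
    forall N, \forall n \near (f @ \oo), (N <= n)%N.
  move=> fn N; apply: filterS (nbhs_infty_ge N) => n /= Nn.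
  exact: leq_trans (fn n).
(* Radius and index of the recursion differ by one, so even radii yield the bound at odd indices and
   odd radii the one at even indices. *)
have [|mu gmu Hmu] := @tree_gibbs_limit (double @ \oo) _.
  by apply: big_filter => n; rewrite -addnn leq_addr.
have [|nu gnu Hnu] := @tree_gibbs_limit ((fun n => n.*2.+1) @ \oo) _.
  by apply: big_filter => n; rewrite -addnn -addnS leq_addr.
exists mu, nu; split => //; exists (root_le m).
  apply: (cylinders_local (W := setT) (X := [:: [::]])) => // s t st.
  by rewrite /root_le /= st// inE.
have Lmu : fine (mu (root_le m)) <= x.
  by have [+ _] := Hmu m x; apply; apply: (@filterE _ \oo) => n; apply: Hx => /=; rewrite odd_double.
have Lnu : y <= fine (nu (root_le m)).
  by have [_ +] := Hnu m y; apply; apply: (@filterE _ \oo) => n; apply: Hy => /=; rewrite odd_double.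
by move=> E; move: (lt_le_trans (le_lt_trans Lmu xy) Lnu); rewrite E ltxx.
Qed.

End TreeGibbs.

(** * Uniqueness from convergence of the root recursion *)

Section TreeUnique.
Variables (R : realType) (C b : nat) (lambda : R).
Hypothesis lambda0 : 0 < lambda.
Local Notation V := (seq 'I_b).
Local Notation cfg := (V -> 'I_C.+1).
Implicit Types (s t u : cfg) (h : V -> 'I_C.+1 -> R).
Local Notation zero := (@zero_cfg V C).
Local Notation Phi := (Phi lambda).

Lemma bc_ge0 t v k : 0 <= bc R t v k.
Proof. by apply: prodr_ge0 => i _; exact: ler0n. Qed.

Lemma iter_Phi_ge0 d h : (forall v k, 0 <= h v k) ->
  forall v k, 0 <= iter d Phi h v k.
Proof.
move=> h0; elim: d => [//|d IH] v k /=.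
by apply: prodr_ge0 => i _; exact: psum_ge0.
Qed.

Lemma hlr_iter_Phi d t v :
  if odd d then hlr (hfield b lambda d.+1) (iter d Phi (bc R t) v) /\
    hlr (iter d Phi (bc R t) v) (hfield b lambda d)
  else hlr (hfield b lambda d) (iter d Phi (bc R t) v) /\
    hlr (iter d Phi (bc R t) v) (hfield b lambda d.+1).
Proof.
have h0 d' v' k : 0 <= iter d' Phi (bc R t) v' k by apply: iter_Phi_ge0; exact: bc_ge0.
elim: d v => [|d IH] v.
  split; first by apply: hlr_hfield0; exact: bc_ge0.
  apply: hlr_hfield1 => k l kl; apply: ler_prod => i _; rewrite ler0n /= ler_nat.
  by case: (leqP (l + _)) => //= lC; rewrite (leq_trans _ lC)// leq_add2r.
have H0 n (k : 'I_C.+1) : 0 <= hfield b lambda n k by exact: hfield_ge0.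
have P1 n : (forall v, hlr (hfield b lambda n) (iter d Phi (bc R t) v)) ->
    hlr (iter d.+1 Phi (bc R t) v) (hfield b lambda n.+1).
  move=> H k m km; have := @hlr_prod _ _ _ lambda0 'I_b (fun=> hfield b lambda n)
    (fun i => iter d Phi (bc R t) (i :: v)) (fun=> H0 n) (fun i => h0 d (i :: v))
    (fun i => H (i :: v)) k m km.
  by rewrite !prodr_const !card_ord.
have P2 n : (forall v, hlr (iter d Phi (bc R t) v) (hfield b lambda n)) ->
    hlr (hfield b lambda n.+1) (iter d.+1 Phi (bc R t) v).
  move=> H k m km; have := @hlr_prod _ _ _ lambda0 'I_b
    (fun i => iter d Phi (bc R t) (i :: v)) (fun=> hfield b lambda n)
    (fun i => h0 d (i :: v)) (fun=> H0 n) (fun i => H (i :: v)) k m km.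
  by rewrite !prodr_const !card_ord.
rewrite oddS; case: (odd d) IH => IH; split.
- by apply: P2 => v'; case: (IH v').
- by apply: P1 => v'; case: (IH v').
- by apply: P2 => v'; case: (IH v').
- by apply: P1 => v'; case: (IH v').
Qed.

Lemma psum_iter_bounds e t v m : (m <= C)%N ->
  rcdf C b lambda e.*2.+1 m * psum lambda (iter e.*2 Phi (bc R t) v) C
   <= psum lambda (iter e.*2 Phi (bc R t) v) m <=
  rcdf C b lambda e.*2 m * psum lambda (iter e.*2 Phi (bc R t) v) C.
Proof.
move=> mC; have := hlr_iter_Phi e.*2 t v; rewrite odd_double => -[H1 H2].
have h0 k : 0 <= iter e.*2 Phi (bc R t) v k by apply: iter_Phi_ge0; exact: bc_ge0.
have H0 n (k : 'I_C.+1) : 0 <= hfield b lambda n k by exact: hfield_ge0.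
have Hp n : 0 < psum lambda (hfield (C := C) b lambda n) C by exact: psum_hfield_gt0.
rewrite /rcdf; apply/andP; split; rewrite mulrAC.
  by rewrite ler_pdivrMr// [leLHS]mulrC; apply: hlr_psum.
by rewrite ler_pdivlMr// [leLHS]mulrC; apply: hlr_psum.
Qed.

Lemma core_zero n : core lambda n zero = 1 :> R.
Proof.
rewrite coreE big1 ?mulr1 => [|v _]; last by rewrite expr0.
suff -> : ok_ball n zero by [].
by apply/asboolP => v _.
Qed.

Section Marginals.
Variable nu : probability (config V C) R.
Hypothesis gnu : is_gibbs (@tree_edge b) lambda nu.

(** The factor of proportionality between the law inside the ball and [tree_weight]; it depends only
    on the spins off the ball. *)
Definition kappa N t : R := fine (nu (cyl (level b N.+1) t)) /
  rsum (fball b N) (phi (@tree_edge b) lambda (fball b N)) t.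

Lemma tree_partition_neq0 N t :
  rsum (fball b N) (phi (@tree_edge b) lambda (fball b N)) t != 0.
Proof.
(* Spin 0 throughout the ball is compatible with any spins on the next sphere, so one term of the
   sum is positive. *)
pose t0 := splice (fball b N) t zero.
rewrite (@rsum_off _ _ _ _ _ t t0) => [|v vN]; last by rewrite /t0 /splice (negPf vN).
rewrite gt_eqF//; apply: (lt_le_trans _ (le_rsum_term _ t0 _)); last exact: phi_ge0.
rewrite phi_ball /tree_weight (@eq_core _ _ _ _ _ t0 zero) => [|v vN]; last first.
  by rewrite /t0 /splice mem_fball vN.
rewrite core_zero mul1r big_seq; apply: prodr_gt0 => v; rewrite mem_level => /eqP vN.
apply: prodr_gt0 => i _; have -> : t0 v = ord0 by rewrite /t0 /splice mem_fball vN leqnn.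
by rewrite add0n -ltnS ltn_ord.
Qed.

Lemma kappa_off N s t : (forall v, v \notin fball b N -> s v = t v) ->
  kappa N s = kappa N t.
Proof.
move=> st; rewrite /kappa (rsum_off _ st) (@eq_cyl _ _ _ s t)// => v.
by rewrite mem_level => /eqP vN; apply: st; rewrite mem_fball vN ltnn.
Qed.

(** Erases everything but the sphere, so that the boundary field stays literally the same function
    while spins inside are summed. *)
Definition on_level N t : cfg := splice (level b N) zero t.

Lemma tree_weight_bc N t :
  tree_weight lambda N (bc R t) t = tree_weight lambda N (bc R (on_level N.+1 t)) t.
Proof.
rewrite /tree_weight; congr (_ * _); rewrite !big_seq; apply: eq_bigr => v.
rewrite mem_level => /eqP vN; apply: eq_bigr => i _; congr ((nat_of_bool (_ + nat_of_ord _ <= _)%N)%:R).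
by rewrite /on_level /splice mem_level /= vN eqxx.
Qed.

Lemma gibbs_ball N t :
  fine (nu (cyl (tball b N) t `&` cyl (level b N.+1) t)) =
  kappa N t * tree_weight lambda N (bc R (on_level N.+1 t)) t.
Proof.
have cE X Y s : X =i Y -> cyl X s = cyl Y s :> set cfg.
  by move=> XY; apply/seteqP; split => s' H x; [rewrite -XY|rewrite XY]; exact: H.
have cb s : cyl (boundary (@tree_edge b) (fball b N)) s = cyl (level b N.+1) s :> set cfg.
  by apply: cE => v; rewrite mem_boundary_ball mem_level.
have := gibbs_cyl lambda0 (@tree_locally_finite b) gnu (tree_partition_neq0 N t).
rewrite cb (cE _ _ _ (perm_mem (perm_fball b N))).
move=> H; rewrite -tree_weight_bc -phi_ball /kappa mulrAC -[LHS]mulr1.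
rewrite -(divff (tree_partition_neq0 N t)) mulrA H mulrC mulrAC mulrA.
by rewrite mulrC mulrA mulrAC.
Qed.

(** Each induction step sums out the sphere of radius [n.+1] and turns it into one more application
    of [Phi]. *)
Lemma gibbs_marginal n d t :
  fine (nu (cyl (tball b n) t `&` cyl (level b (n + d).+1) t)) =
  kappa (n + d) t * tree_weight lambda n (iter d Phi (bc R (on_level (n + d).+1 t))) t.
Proof.
elim: d n t => [|d IH] n t; first by rewrite addn0 gibbs_ball.
rewrite addnS -addSn iterS -tree_weight_peel -rsumZ.
set L := level b (n.+1 + d).+1.
have mA : measurable (cyl (tball b n) t `&` cyl L t : set (config V C)).
  by apply: measurableI; exact: measurable_cyl.
rewrite -(rsum_prob nu t (level_uniq b n.+1) mA); apply: eq_rsum => s st.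
have nL v : v \in L -> v \notin level b n.+1.
  by rewrite !mem_level => /eqP ->; rewrite eqSS neq_ltn ltnS leq_addr orbT.
have -> : cyl (tball b n) t `&` cyl L t `&` cyl (level b n.+1) s =
    cyl (tball b n.+1) s `&` cyl L s.
  rewrite (eq_cyl (X := L) (t := t) (u := s)); last by move=> v /nL/st ->.
  rewrite setIAC; congr (_ `&` _).
  rewrite (eq_cyl (t := t) (u := s)) => [|v]; last first.
    by rewrite mem_ball => vn; rewrite st// mem_level neq_ltn ltnS vn.
  apply/seteqP; split => u /=.
    by case=> H1 H2 v; rewrite mem_cat => /orP[/H1|/H2].
  by move=> H; split => v vX; apply: H; rewrite mem_cat vX ?orbT.
rewrite IH (@kappa_off _ s t) => [|v]; last first.
  rewrite mem_fball -ltnNge => vn; apply: st.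
  by rewrite mem_level neq_ltn (leq_ltn_trans _ vn) ?orbT// leq_addr.
congr (_ * tree_weight _ _ (iter _ _ (bc _ _)) _); apply/funext => v.
rewrite /on_level /splice -/L; case: ifP => // vL; apply: st; exact: nL.
Qed.

Definition gibbs_form n (r : nat -> R) t : R :=
  core lambda n t * \prod_(v <- level b n) r (C - t v)%N ^+ b.

(** Comparison with [zero], whose core is 1 and whose fields are products of full sums, removes the
    unknown normalizations; [psum_iter_bounds] then acts at every child of the sphere. *)
Lemma tree_weight_bounds n e s t :
  let h := iter e.*2.+1 Phi (bc R s) in
  gibbs_form n (rcdf C b lambda e.*2.+1) t * tree_weight lambda n h zero <=
  tree_weight lambda n h t <=
  gibbs_form n (rcdf C b lambda e.*2) t * tree_weight lambda n h zero.
Proof.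
rewrite /= /tree_weight core_zero mul1r /gibbs_form -!mulrA.
have c0 : 0 <= core lambda n t :> R by exact: core_ge0.
have r0 k m : 0 <= rcdf C b lambda k m by rewrite ltW// rcdf_gt0.
have p0 m v : 0 <= psum lambda (iter e.*2 Phi (bc R s) v) m.
  by apply: psum_ge0 => // k; apply: iter_Phi_ge0; exact: bc_ge0.
rewrite -!big_split /=; apply/andP; split; apply: ler_wpM2l => //; apply: ler_prod => v _.
  rewrite mulr_ge0 ?exprn_ge0//=; last by apply: prodr_ge0.
  rewrite -[X in _ ^+ X](card_ord b) -prodr_const -big_split /=.
  apply: ler_prod => i _; rewrite mulr_ge0//= subn0.
  by have /andP[] := @psum_iter_bounds e s (i :: v) (C - t v) (leq_subr _ _).
rewrite prodr_ge0//= -[X in _ ^+ X](card_ord b) -prodr_const -big_split /=.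
apply: ler_prod => i _; rewrite p0 //= subn0.
by have /andP[] := @psum_iter_bounds e s (i :: v) (C - t v) (leq_subr _ _).
Qed.

(* Given the spins on the sphere of radius [n + 2 e + 2], the law on the ball of radius
   [n] is that of a field between two homogeneous ones. *)
Lemma gibbs_cyl_bounds n e t :
  gibbs_form n (rcdf C b lambda e.*2.+1) t * fine (nu (cyl (tball b n) zero)) <=
  fine (nu (cyl (tball b n) t)) <=
  gibbs_form n (rcdf C b lambda e.*2) t * fine (nu (cyl (tball b n) zero)).
Proof.
pose N := (n + e.*2.+1)%N; pose L := level b N.+1.
have uL : uniq L by exact: level_uniq.
have mc u : measurable (cyl (tball b n) u : set (config V C)) by exact: measurable_cyl.
rewrite -(rsum_prob nu t uL (mc t)) -(rsum_prob nu t uL (mc zero)) -!rsumZ.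
have key s : (forall x, x \notin L -> s x = t x) ->
    exists2 c, 0 <= c & exists u,
     fine (nu (cyl (tball b n) t `&` cyl L s)) =
       c * tree_weight lambda n (iter e.*2.+1 Phi (bc R u)) t /\
     fine (nu (cyl (tball b n) zero `&` cyl L s)) =
       c * tree_weight lambda n (iter e.*2.+1 Phi (bc R u)) zero.
  move=> st; exists (kappa N s).
    by rewrite divr_ge0 ?fine_ge0//; apply: rsum_ge0; exact: phi_ge0.
  pose s0 := splice (tball b n) s zero.
  have nN v : v \in tball b n -> v \in fball b N.
    by rewrite mem_ball mem_fball => vn; rewrite (leq_trans vn)// leq_addr.
  have nL v : v \in tball b n -> v \notin L.
    rewrite mem_ball mem_level => vn; rewrite neq_ltn ltnS (leq_trans vn)//.
    exact: leq_addr.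
  have s0L v : v \in L -> s0 v = s v.
    by move=> vL; rewrite /s0 /splice; case: ifP => // /nL; rewrite vL.
  exists (on_level N.+1 s); split.
    rewrite (eq_cyl (t := t) (u := s)) => [|v /nL/st ->//].
    rewrite gibbs_marginal; congr (_ * _); congr (_ * _).
      by apply: eq_core => v vn; apply: st; apply: nL; rewrite mem_ball.
    rewrite !big_seq; apply: eq_bigr => v; rewrite mem_level => /eqP vn.
    by rewrite st// nL// mem_ball vn.
  rewrite (eq_cyl (X := L) (t := s) (u := s0)) => [|v /s0L ->//].
  rewrite (eq_cyl (t := zero) (u := s0)) => [|v vn]; last by rewrite /s0 /splice vn.
  rewrite gibbs_marginal (@kappa_off N s0 s) => [|v vN]; last first.
    by rewrite /s0 /splice; case: ifP => // /nN; rewrite (negPf vN).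
  have -> : on_level N.+1 s0 = on_level N.+1 s.
    by apply/funext => v; rewrite /on_level /splice; case: ifP => // /s0L.
  congr (_ * _); congr (_ * _).
    by apply: eq_core => v vn; rewrite /s0 /splice mem_ball vn.
  rewrite !big_seq; apply: eq_bigr => v; rewrite mem_level => /eqP vn.
  by rewrite /s0 /splice mem_ball vn leqnn.
apply/andP; split; apply: le_rsum => s /key[c c0 [u [-> ->]]];
  have /andP[H1 H2] := tree_weight_bounds n e u t;
  by rewrite [_ * (c * _)]mulrCA; apply: ler_wpM2l.
Qed.

Variable Fl : nat -> R.
Hypothesis cvg_even : forall m, (fun e => rcdf C b lambda e.*2 m) @ \oo --> (Fl m : R).
Hypothesis cvg_odd : forall m, (fun e => rcdf C b lambda e.*2.+1 m) @ \oo --> (Fl m : R).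

Lemma cvg_gibbs_form n (r : nat -> nat -> R) t :
  (forall m, (fun e => r e m) @ \oo --> (Fl m : R)) ->
  (fun e => gibbs_form n (r e) t) @ \oo --> (gibbs_form n Fl t : R).
Proof.
move=> rF; apply: cvgMr; elim: (level b n) => [|v L IH].
  rewrite big_nil (_ : (fun e => _) = cst 1); first exact: cvg_cst.
  by apply/funext => e; rewrite big_nil.
rewrite big_cons (_ : (fun e => _) = (fun e => r e (C - t v)%N ^+ b *
    \prod_(v <- L) r e (C - t v)%N ^+ b)); last first.
  by apply/funext => e; rewrite big_cons.
apply: cvgM => //; elim: b => [|k IHk].
  by rewrite (_ : (fun e => _) = cst 1); [exact: cvg_cst|apply/funext => e; rewrite expr0].
rewrite exprS (_ : (fun e => _) = (fun e => r e (C - t v)%N * r e (C - t v)%N ^+ k)).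
  exact: cvgM.
by apply/funext => e; rewrite exprS.
Qed.

(** Both bounds of [gibbs_cyl_bounds] have the same limit. The weight relative to [zero] is
    therefore common to all Gibbs measures, and the total mass fixes the remaining constant. *)
Lemma gibbs_cylE n t : fine (nu (cyl (tball b n) t)) =
  gibbs_form n Fl t * fine (nu (cyl (tball b n) zero)).
Proof.
set p0 := fine (nu (cyl (tball b n) zero)).
have cv (r : nat -> nat -> R) : (forall m, (fun e => r e m) @ \oo --> (Fl m : R)) ->
    (fun e => gibbs_form n (r e) t * p0) @ \oo --> (gibbs_form n Fl t * p0 : R).
  by move=> H; apply: cvgMl; exact: cvg_gibbs_form.
apply/eqP; rewrite eq_le; apply/andP; split.
  apply: (cvgr_to_ge (cv _ cvg_even)).
  by apply: nearW => e; have /andP[] := gibbs_cyl_bounds n e t.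
apply: (cvgr_to_le (cv _ cvg_odd)).
by apply: nearW => e; have /andP[] := gibbs_cyl_bounds n e t.
Qed.

Lemma gibbs_cyl_normalized n :
  fine (nu (cyl (tball b n) zero)) = (rsum (tball b n) (gibbs_form n Fl) zero)^-1.
Proof.
have E u : fine (nu ([set: config V C] `&` cyl (tball b n) u)) =
    gibbs_form n Fl u * fine (nu (cyl (tball b n) zero)).
  by rewrite setTI gibbs_cylE.
have := rsum_prob nu zero (ball_uniq b n) (@measurableT _ (config V C)).
rewrite (eq_rsum (fun u _ => E u)) rsumZr probability_setT => H.
by apply: (mulfI (x := rsum (tball b n) (gibbs_form n Fl) zero));
  rewrite ?H ?mulfV//; apply/eqP => r0; move: H; rewrite r0 mul0r => /eqP;
  rewrite eq_sym oner_eq0.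
Qed.

End Marginals.

Theorem tree_unique_gibbs (Fl : nat -> R) :
  (forall m, (fun e => rcdf C b lambda e.*2 m) @ \oo --> (Fl m : R)) ->
  (forall m, (fun e => rcdf C b lambda e.*2.+1 m) @ \oo --> (Fl m : R)) ->
  unique_gibbs C (@tree_edge b) lambda.
Proof.
move=> ce co; have [mu gmu] := exists_tree_gibbs C b lambda0.
exists mu => // nu gnu; apply: eq_prob_cyl => X t uX.
have mX : measurable (cyl X t : set (config V C)) by exact: measurable_cyl.
rewrite -[LHS]fineK ?fin_num_measure// -[RHS]fineK ?fin_num_measure//; congr EFin.
pose n := (\max_(x <- X) size x)%N.
have XB x : x \in X -> x \in tball b n.
  by move=> xX; rewrite mem_ball; exact: (@leq_bigmax_seq _ X xpredT (fun x => size x) x xX isT).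
rewrite -(rsum_prob nu zero (ball_uniq b n) mX) -(rsum_prob mu zero (ball_uniq b n) mX).
apply: eq_rsum => s _.
have [Hs|Hs] := pselect (forall x, x \in X -> s x = t x).
  have -> : cyl X t `&` cyl (tball b n) s = cyl (tball b n) s.
    by apply/setIidr => u /= H x xX; rewrite H ?Hs//; exact: XB.
  by rewrite (gibbs_cylE gnu ce co) (gibbs_cylE gmu ce co) !(gibbs_cyl_normalized _ ce co).
have -> : cyl X t `&` cyl (tball b n) s = set0.
  apply/seteqP; split => // u [/= H1 H2]; apply: Hs => x xX.
  by rewrite -H2 ?H1//; exact: XB.
by rewrite !measure0.
Qed.

End TreeUnique.

(** * Elementary inequalities *)

Section Numeric.
Variable R : realType.
Implicit Types (x y z s t c g l A K : R) (b n j : nat).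

Lemma ln_le_subr1 x : 0 < x -> ln x <= x - 1.
Proof.
move=> x0; have := @le_ln1Dx R (x - 1); rewrite addrCA subrr addr0; apply.
by rewrite ltrBrDl subrr.
Qed.

Lemma expr1D_le_expR n x : -1 <= x -> (1 + x) ^+ n <= expR (n%:R * x).
Proof.
move=> x1; rewrite expRM_natl; apply: lerXn2r; rewrite ?nnegrE ?expR_ge0//.
  by rewrite -lerBlDl sub0r.
exact: expR_ge1Dx.
Qed.

(** From ln (1 + x) >= x / (1 + x) >= x - x^2, the first being [ln_le_subr1] at the inverse of 1 +
    x. *)
Lemma expR_le_expr1D n x : 0 <= x <= 1 -> expR (n%:R * (x - x ^+ 2)) <= (1 + x) ^+ n.
Proof.
move=> /andP[x0 x1]; have x1p : 0 < 1 + x by rewrite ltr_wpDr.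
rewrite expRM_natl; apply: lerXn2r; rewrite ?nnegrE ?expR_ge0 ?(ltW x1p)//.
rewrite -[leRHS]lnK ?posrE// ler_expR.
have : ln (1 + x)^-1 <= (1 + x)^-1 - 1 by apply: ln_le_subr1; rewrite invr_gt0.
rewrite lnV ?posrE// lerNl; apply: le_trans.
have -> : - ((1 + x)^-1 - 1) = x / (1 + x) by field; lra.
by rewrite ler_pdivlMr//; nra.
Qed.

Lemma bernoulli n x : -1 <= x -> 1 + n%:R * x <= (1 + x) ^+ n.
Proof.
move=> x1; elim: n => [|n IH]; first by rewrite mul0r addr0 expr0.
rewrite exprS; apply: (@le_trans _ _ ((1 + x) * (1 + n%:R * x))).
  have n0 : 0 <= n%:R :> R by exact: ler0n.
  rewrite -natr1; nra.
by apply: ler_wpM2l => //; lra.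
Qed.

(** Bernoulli with exponent [n./2], then squared. The 3 absorbs the rounding and is attained at n =
    3. *)
Lemma sqr_le_expr1D n z : (2 <= n)%N -> 0 <= z -> (n%:R * z / 3) ^+ 2 <= (1 + z) ^+ n.
Proof.
move=> n2 z0.
have m3 : (n <= 3 * n./2)%N.
  by lia.
have nz : n%:R * z / 3 <= n./2%:R * z.
  rewrite ler_pdivrMr// mulrAC; apply: ler_wpM2r => //.
  by rewrite -natrM ler_nat mulnC.
apply: (@le_trans _ _ ((1 + z) ^+ (n./2 * 2))); last first.
  apply: ler_weXn2l; first by lra.
  by rewrite muln2 -[leqRHS]odd_double_half leq_addl.
rewrite exprM; apply: lerXn2r; rewrite ?nnegrE ?exprn_ge0//; try lra.
  by rewrite divr_ge0// mulr_ge0.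
by apply: (le_trans nz); apply: le_trans (bernoulli n./2 _); lra.
Qed.

(** The source of thresholds uniform in lambda: as b grows, a bounded b lambda^j forces lambda to be
    small. *)
Lemma small_root j (e s : R) : (0 < j)%N -> 0 < e ->
  exists b0 : nat, forall b (lambda : R), (b0 <= b)%N -> 0 < lambda ->
    b%:R * lambda ^+ j <= s -> lambda <= e.
Proof.
move=> j0 e0; exists (Num.truncn (s / e ^+ j)).+1 => b lambda bb l0 bl.
rewrite leNgt; apply/negP => el.
have ej : 0 < e ^+ j by rewrite exprn_gt0.
have : s / e ^+ j < b%:R.
  by apply: (lt_le_trans (truncnS_gt _)); rewrite ler_nat.
rewrite ltr_pdivrMr// ltNge => /negP; apply; apply: (le_trans _ bl).
by apply: ler_wpM2l => //; apply: lerXn2r; rewrite ?nnegrE ?(ltW e0) ?(ltW l0) ?(ltW el).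
Qed.

Lemma large_nat x : exists b0 : nat, forall b, (b0 <= b)%N -> x <= b%:R.
Proof.
exists (Num.truncn x).+1 => b bb.
by apply/ltW/(lt_le_trans (truncnS_gt _)); rewrite ler_nat.
Qed.

(* Upper and lower bounds for the odds of an occupied vertex when the odds at its
   [b] children are [x]; here [l = lambda ^+ jc C]. *)
Definition U_ A l b x := A * l / (1 + x) ^+ b.
Definition L_ A l b x := l / A / (1 + x) ^+ b.

End Numeric.

(** * The witness for coexistence *)

Section Witness.
Variable R : realType.
Implicit Types (x y z s t c g l A K : R) (b n j : nat).
Local Notation E := (expR 1 : R).

Lemma expR1_ge2 : 2 <= E.
Proof. by apply: le_trans (expR_ge1Dx _). Qed.

Lemma expr1V_le_E b : (0 < b)%N -> (1 + b%:R^-1) ^+ b <= E.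
Proof.
move=> b0; apply: le_trans (expr1D_le_expR _ _) _.
  by rewrite (@le_trans _ _ 0)// ?lerN10// invr_ge0.
by rewrite mulfV// pnatr_eq0 -lt0n.
Qed.

(** As (1 + 1/b)^b <= e, the value of [L_] at 1/b is at least l / (A e). The two numerical
    hypotheses are the two conclusions with that bound in place of [L_]. *)
Lemma witness_of_bounds b l A : (0 < b)%N -> 0 < l -> 0 < A ->
  E * A < b%:R * l -> A * (b%:R * l) <= (1 + l / A / E) ^+ b ->
  b%:R^-1 < L_ A l b b%:R^-1 /\ U_ A l b (L_ A l b b%:R^-1) <= b%:R^-1.
Proof.
move=> b0 l0 A0 H1 H2; have E0 := expR_gt0 (1 : R).
have br : 0 < b%:R :> R by rewrite ltr0n.
have q0 : 0 < (1 + b%:R^-1 : R) ^+ b by rewrite exprn_gt0// addr_gt0// invr_gt0.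
have zz : l / A / E <= L_ A l b b%:R^-1.
  rewrite /L_; apply: ler_wpM2l; first by rewrite divr_ge0// ltW.
  by rewrite lef_pV2 ?posrE// expr1V_le_E.
have z0 : 0 < l / A / E by rewrite !divr_gt0.
split.
  apply: lt_le_trans zz; rewrite !ltr_pdivlMr// -mulrA mulrC ltr_pdivrMr//.
  by rewrite [l * _]mulrC.
have p0 : 0 < (1 + L_ A l b b%:R^-1) ^+ b.
  by rewrite exprn_gt0// addr_gt0// (lt_le_trans z0).
rewrite /U_ ler_pdivrMr// ler_pdivlMl// mulrCA; apply: (le_trans H2).
apply: lerXn2r; rewrite ?nnegrE ?lerD2l//; first by rewrite addr_ge0// ltW.
by rewrite addr_ge0// (le_trans (ltW z0)).
Qed.

(* With [u = gamma / e] this is the room left by [gamma != e] in [ln s <= s / e]. *)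
Lemma gap_gt0 (u : R) : 0 < u -> u != 1 -> 0 < u - 1 - ln u.
Proof.
move=> u0 u1; rewrite subr_gt0 lt_neqAle ln_le_subr1// andbT.
apply/negP => /eqP E1; have u12 : u != 1 by [].
(* Strictness by halving: ln u = 2 ln (sqrt u) <= 2 (sqrt u - 1), which falls short of u - 1 by
   (sqrt u - 1)^2. *)
have h0 : 0 < Num.sqrt u by rewrite sqrtr_gt0.
have hu : Num.sqrt u ^+ 2 = u by rewrite sqr_sqrtr// ltW.
have := ln_le_subr1 h0.
have -> : ln (Num.sqrt u) = ln u / 2.
  by rewrite -[in RHS]hu lnXn// mulr2n; lra.
rewrite E1 => H.
have : (Num.sqrt u - 1) ^+ 2 <= 0.
  have -> : (Num.sqrt u - 1) ^+ 2 = Num.sqrt u ^+ 2 - 2 * Num.sqrt u + 1 by ring.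
  by rewrite hu; lra.
rewrite le_eqVlt ltNge sqr_ge0 orbF sqrf_eq0 subr_eq0 => /eqP h1.
by move: u12; rewrite -hu h1 expr1n eqxx.
Qed.

Lemma gap_mono (g u : R) : 1 <= g -> g <= u -> g - 1 - ln g <= u - 1 - ln u.
Proof.
move=> g1 gu; have g0 : 0 < g by lra.
have u0 : 0 < u by lra.
have : ln (u / g) <= u / g - 1 by apply: ln_le_subr1; rewrite divr_gt0.
rewrite ln_div ?posrE// => H.
suff : u / g - 1 <= u - g by lra.
by rewrite lerBlDr ler_pdivrMr//; nra.
Qed.

(** In logarithms the claim is ln s <= s / e with s = b l, up to three errors: ln A <= 2 lambda, at
    most s0 lambda for replacing 1 / A by 1, and s0^2 / b for the quadratic term. The gap [eta]
    covers their sum. *)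
Lemma small_regime (eta s0 lambda l A : R) b : (0 < b)%N -> 0 < eta -> 0 <= lambda -> lambda <= 1 / 2 ->
  1 <= A -> A * (1 - lambda) <= 1 -> 0 < l <= 1 -> b%:R * l <= s0 ->
  eta <= b%:R * l / E - ln (b%:R * l) ->
  (2 + s0) * lambda + s0 ^+ 2 / b%:R <= eta ->
  A * (b%:R * l) <= (1 + l / A / E) ^+ b.
Proof.
move=> b0 eta0 lam0 lam1 A1 Al /andP[l0 l1] ss0 Hs Heta.
have E2 := expR1_ge2; have E0 : 0 < E by lra.
have A0 : 0 < A by lra.
have br : 0 < b%:R :> R by rewrite ltr0n.
set s := b%:R * l in ss0 Hs *; have s_gt0 : 0 < s by rewrite mulr_gt0.
have z0 : 0 < l / A / E by rewrite !divr_gt0.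
have z1 : l / A / E <= 1.
  rewrite !ler_pdivrMr// mul1r; nra.
apply: le_trans (expR_le_expr1D b _); last by rewrite (ltW z0).
rewrite -[leLHS]lnK ?posrE ?mulr_gt0// ler_expR lnM ?posrE//.
have lnA : ln A <= 2 * lambda.
  by apply: (le_trans (ln_le_subr1 A0)); nra.
have Ai : 1 - lambda <= A^-1 by rewrite -[A^-1]mul1r ler_pdivlMr// mulrC.
have Ai1 : A^-1 <= 1 by rewrite invf_le1.
pose w := s / E; have w0 : 0 < w by rewrite divr_gt0.
have ws : w <= s by rewrite ler_pdivrMr//; nra.
have bz : b%:R * (l / A / E) = w * A^-1 by rewrite /w /s; field; rewrite !gt_eqF.
have bz2 : b%:R * (l / A / E) ^+ 2 = (w * A^-1) ^+ 2 / b%:R.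
  by rewrite -bz; field; rewrite !gt_eqF.
rewrite mulrBr bz bz2.
have wA : w - s0 * lambda <= w * A^-1 by nra.
have wA2 : (w * A^-1) ^+ 2 / b%:R <= s0 ^+ 2 / b%:R.
  rewrite ler_pM2r ?invr_gt0//; apply: lerXn2r; rewrite ?nnegrE.
  - by rewrite mulr_ge0 ?invr_ge0 ?ltW.
  - lra.
  - have : w * A^-1 <= w * 1 by rewrite ler_pM2l.
    lra.
rewrite -/w in Hs; lra.
Qed.

(** While b lambda^j stays below [s0], lambda is small and A close to 1, so the sharp exponential
    estimate applies. Above [s0] only A <= K is available, and quadratic growth is enough. *)
Lemma witness_exists j (gamma K : R) : (0 < j)%N -> E < gamma -> 1 <= K ->
  exists b0 : nat, forall b (lambda A : R), (b0 <= b)%N -> (2 <= b)%N ->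
    0 < lambda < 1 -> gamma <= b%:R * lambda ^+ j ->
    1 <= A <= K -> A * (1 - lambda) <= 1 ->
    let l := lambda ^+ j in
    b%:R^-1 < L_ A l b b%:R^-1 /\ U_ A l b (L_ A l b b%:R^-1) <= b%:R^-1.
Proof.
move=> j0 gE K1; have E2 := expR1_ge2; have E0 : 0 < E by lra.
pose g := gamma / E; have g1 : 1 < g by rewrite ltr_pdivlMr// mul1r.
pose eta := g - 1 - ln g.
have eta0 : 0 < eta by apply: gap_gt0; [lra|rewrite gt_eqF].
(* From this value of s = b l on, the square of b l / (3 A e) given by [sqr_le_expr1D] is at least A
   s. *)
pose s0 := 9 * K ^+ 3 * E ^+ 2.
have K2 : 1 <= K ^+ 2 by rewrite expr_ge1//; lra.
have K3 : K <= K ^+ 3 by rewrite exprS; nra.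
have s0E : E * K < s0.
  have K0 : 0 < K ^+ 3 by lra.
  rewrite /s0; have : E * K <= E ^+ 2 * K ^+ 3.
    by rewrite expr2 -mulrA; apply: ler_wpM2l; [lra|nra].
  have : 0 < E ^+ 2 * K ^+ 3 by rewrite mulr_gt0// exprn_gt0.
  lra.
have s0_gt0 : 0 < s0 by apply: lt_trans s0E; apply: mulr_gt0; lra.
(* In turn: for ln A <= 2 lambda, for A < g, and to spend at most half of [eta] on (2 + s0) lambda;
   the threshold [b2] provides for the other half. *)
pose e := Num.min (1 / 2) (Num.min ((1 - g^-1) / 2) (eta / 2 / (2 + s0))).
have gi : g^-1 < 1 by rewrite invf_lt1//; lra.
have e0 : 0 < e.
  rewrite !lt_min; apply/and3P; split; [lra|lra|].
  by rewrite !divr_gt0//; lra.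
have [b1 Hb1] := small_root s0 j0 e0.
have [b2 Hb2] := large_nat (2 * s0 ^+ 2 / eta).
exists (maxn b1 b2) => b lambda A; rewrite geq_max => /andP[bb1 bb2] b_ge2.
move=> /andP[lam0 lam1] gs /andP[A1 AK] Al /=; set l := lambda ^+ j in gs *.
have b0 : (0 < b)%N by exact: leq_trans b_ge2.
have br : 0 < b%:R :> R by rewrite ltr0n.
have l0 : 0 < l by rewrite exprn_gt0.
have l1 : l <= 1 by rewrite exprn_ile1// ltW.
have A0 : 0 < A by lra.
apply: witness_of_bounds => //.
  have [big|small] := leP s0 (b%:R * l).
    by apply: lt_le_trans big; apply: le_lt_trans s0E; nra.
  have le := Hb1 _ _ bb1 lam0 (ltW small).
  have le2 : lambda <= (1 - g^-1) / 2.
    by apply: (le_trans le); rewrite /e !ge_min lexx !orbT.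
  have gg : gamma = g * E by rewrite /g divfK// gt_eqF.
  apply: lt_le_trans gs; rewrite gg mulrC ltr_pM2r//.
  have : A * g^-1 < 1.
    have : 0 < 1 - g^-1 by lra.
    nra.
  by rewrite -ltr_pdivlMr ?invr_gt0 ?invrK ?mul1r//; lra.
have [big|small] := leP s0 (b%:R * l).
  set s := b%:R * l in gs big *.
  have z0 : 0 <= l / A / E by rewrite !divr_ge0 ?ltW.
  apply: le_trans (sqr_le_expr1D b_ge2 z0).
  have -> : b%:R * (l / A / E) / 3 = s / (3 * A * E) by rewrite /s; field; rewrite !gt_eqF.
  have d0 : 0 < 3 * A * E by rewrite !mulr_gt0.
  rewrite exprMn exprVn ler_pdivlMr ?exprn_gt0//.
  have A3 : A ^+ 3 <= K ^+ 3 by apply: lerXn2r; rewrite ?nnegrE//; lra.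
  have big2 : 9 * A ^+ 3 * E ^+ 2 <= s.
    apply: le_trans big; rewrite /s0 ler_pM2r ?exprn_gt0//; lra.
  have -> : A * s * (3 * A * E) ^+ 2 = s * (9 * A ^+ 3 * E ^+ 2) by ring.
  rewrite expr2 ler_pM2l// /s mulr_gt0//.
have le := Hb1 _ _ bb1 lam0 (ltW small).
have le1 : lambda <= 1 / 2 by apply: (le_trans le); rewrite /e ge_min lexx.
have le3 : lambda <= eta / 2 / (2 + s0).
  by apply: (le_trans le); rewrite /e !ge_min lexx !orbT.
apply: (@small_regime eta s0 lambda) => //; rewrite ?(ltW lam0) ?(ltW small) ?l0//.
  set s := b%:R * l in gs small *.
  have s_gt0 : 0 < s by rewrite mulr_gt0.
  have gu : g <= s / E by rewrite ler_pM2r ?invr_gt0.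
  have := gap_mono (ltW g1) gu; rewrite -/eta ln_div ?posrE// expRK; lra.
have h1 : (2 + s0) * lambda <= eta / 2.
  by rewrite mulrC -ler_pdivlMr//; lra.
have h2 : s0 ^+ 2 / b%:R <= eta / 2.
  have := Hb2 _ bb2; rewrite ler_pdivrMr// => h.
  by rewrite ler_pdivrMr//; lra.
lra.
Qed.

End Witness.

(** * No large odds below the critical value; fixed points *)

Section NoLargeOdds.
Variable R : realType.
Implicit Types (x y z s t c l A gamma lambda : R) (b n j : nat).
Local Notation E := (expR 1 : R).

(** The derivative 1/x - gamma e^(-x) is nonnegative because x e <= e^x. *)
Lemma ln_expR_mono gamma c t : 0 <= gamma <= E -> 0 < c -> c <= t ->
  ln c + gamma * expR (- c) <= ln t + gamma * expR (- t).
Proof.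
move=> /andP[g0 gE] c0 ct.
pose f x := ln x + gamma * expR (- x).
pose df x := x^-1 + gamma * (- expR (- x)).
have fd x : 0 < x -> is_derive x 1 f (df x).
  move=> x0; have h1 := is_derive1_ln x0.
  have h0 : is_derive x 1 (-%R : R -> R) (-1) by exact: is_deriveN.
  have h2 := is_derive1_comp (is_derive_expR (- x)) h0.
  rewrite mulrN1 in h2.
  exact: (is_deriveD h1 (is_deriveZ gamma h2)).
have fd' x : x \in `]c, t[ -> is_derive x 1 f (df x).
  by rewrite in_itv /= => /andP[cx _]; apply: fd; exact: lt_trans cx.
have [|x xct E1] := MVT_segment ct fd'.
  apply: derivable_within_continuous => x; rewrite in_itv /= => /andP[cx _].
  by have [] := fd _ (lt_le_trans c0 cx).
rewrite -subr_ge0 -/(f c) -/(f t) E1 mulr_ge0 ?subr_ge0//.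
move: xct; rewrite in_itv /= => /andP[cx _]; have x0 : 0 < x by apply: lt_le_trans cx.
rewrite /df mulrN subr_ge0 -[leRHS]mul1r ler_pdivlMr//.
rewrite expRN -mulrAC ler_pdivrMr ?expR_gt0// mul1r.
have : x <= expR (x - 1) by apply: le_trans (expR_ge1Dx _); lra.
rewrite expRB ler_pdivlMr ?expR_gt0// => h; nra.
Qed.

(** With t = b x and s = b l the claim is ln s - s e^(-t) < ln t, up to small errors. As t >= c >=
    ln gamma, the left side is largest at s = gamma; [ln_expR_mono] then reduces to t = c, where
    [qc] leaves eta / 2. *)
Lemma no_large_odds gamma : 1 <= gamma < E ->
  exists c e : R, [/\ 0 < c < 1, 0 < e &
    forall b lambda A l, (0 < b)%N -> 0 < lambda <= e -> b%:R^-1 <= e ->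
      1 <= A -> A * (1 - lambda) <= 1 -> 0 < l -> b%:R * l <= gamma ->
      forall x, c / b%:R <= x -> U_ A l b (L_ A l b x) < x].
Proof.
move=> /andP[gamma1 gammaE]; have E2 := expR1_ge2 R; have E0 : 0 < E by lra.
pose g := gamma / E; have g0 : 0 < g by rewrite divr_gt0//; lra.
have g1 : g < 1 by rewrite ltr_pdivrMr// mul1r.
have gg : gamma = g * E by rewrite /g divfK// gt_eqF.
have lng : ln gamma = 1 + ln g by rewrite gg lnM ?posrE// expRK addrC.
have lng1 : ln g < 0.
  by apply: le_lt_trans (ln_le_subr1 g0) _; lra.
have lngamma0 : 0 <= ln gamma by apply: ln_ge0.
pose eta := g - 1 - ln g; have eta0 : 0 < eta by apply: gap_gt0; rewrite ?lt_eqF.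
(* Close enough to 1 to keep half of the gap, and at least ln gamma, which is below 1 as gamma <
   e. *)
pose c := Num.max (1 + eta / 2)^-1 (ln gamma).
have c0 : 0 < c by rewrite lt_max invr_gt0; apply/orP; left; lra.
have c1 : c < 1 by rewrite gt_max invf_lt1; lra.
have cinv : c^-1 <= 1 + eta / 2.
  rewrite -[leRHS]invrK lef_pV2 ?posrE ?invr_gt0//; last by lra.
  by rewrite le_max lexx.
have clng : ln gamma <= c by rewrite le_max lexx orbT.
have qc : ln gamma + eta / 2 <= ln c + gamma * expR (- c).
  have : ln c^-1 <= c^-1 - 1 by apply: ln_le_subr1; rewrite invr_gt0.
  rewrite lnV ?posrE// => h1.
  have : expR (- 1) <= expR (- c) by rewrite ler_expR; lra.
  have -> : expR (- 1) = E^-1 :> R by rewrite expRN.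
  move=> h2; have h3 : g <= gamma * expR (- c).
    by rewrite /g; apply: ler_wpM2l => //; lra.
  rewrite /eta in cinv *; lra.
have gam0 : 0 < gamma by lra.
(* The last entry pays for 2 lambda from ln A, gamma lambda from 1 / A and gamma^2 / b from the
   quadratic term, using half of the margin eta / 2; the middle one keeps z' <= 1. *)
pose e := Num.min (1 / 2) (Num.min gamma^-1 (eta / 4 / (2 + gamma + gamma ^+ 2))).
have gsq : 0 <= gamma ^+ 2 by rewrite exprn_ge0//; lra.
have e0 : 0 < e.
  rewrite !lt_min invr_gt0 gam0 /=; apply/andP; split; first lra.
  by rewrite !divr_gt0//; lra.
have e1 : e <= 1 / 2 by rewrite /e ge_min lexx.
have e2 : e <= gamma^-1 by rewrite /e !ge_min lexx ?orbT.
have e3 : (2 + gamma + gamma ^+ 2) * e <= eta / 4.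
  by rewrite mulrC -ler_pdivlMr; [rewrite /e !ge_min lexx !orbT|lra].
exists c, e; split => //; first by rewrite c0.
move=> b lambda A l b0 /andP[lam0 lame] be A1 Al l0 sg x cx.
have br : 0 < b%:R :> R by rewrite ltr0n.
have A0 : 0 < A by lra.
set s := b%:R * l in sg *; have s0 : 0 < s by rewrite mulr_gt0.
pose t := b%:R * x.
have ct : c <= t by rewrite /t mulrC -ler_pdivrMr.
have t0 : 0 < t by lra.
have x0 : 0 < x by rewrite -(pmulr_rgt0 _ br).
have z'0 : 0 < l / A * expR (- t) by rewrite mulr_gt0 ?expR_gt0// divr_gt0.
have q0 : 0 < (1 + x) ^+ b by rewrite exprn_gt0//; lra.
have zz : l / A * expR (- t) <= L_ A l b x.
  rewrite /L_; apply: ler_wpM2l; first by rewrite divr_ge0 ?(ltW l0) ?(ltW A0).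
  by rewrite expRN lef_pV2 ?posrE ?expR_gt0// expr1D_le_expR//; lra.
set z' := l / A * expR (- t) in z'0 zz.
have et1 : expR (- t) <= 1 by rewrite expR_le1; lra.
have Ai1 : A^-1 <= 1 by rewrite invf_le1.
have Ai : 1 - lambda <= A^-1 by rewrite -[A^-1]mul1r ler_pdivlMr// mulrC.
have Ai0 : 0 < A^-1 by rewrite invr_gt0.
have z'l : z' <= l.
  rewrite /z' -mulrA -[leRHS]mulr1; apply: ler_wpM2l; first exact: ltW.
  by apply: mulr_ile1 => //; exact: ltW.
have lg : l <= gamma * b%:R^-1 by rewrite ler_pdivlMr// mulrC.
have z'1 : z' <= 1.
  apply: (le_trans z'l); apply: (le_trans lg).
  have : gamma * b%:R^-1 <= gamma * gamma^-1.
    by apply: ler_wpM2l; [exact: ltW|exact: le_trans be e2].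
  by rewrite mulfV// gt_eqF.
have p0 : 0 < 1 + L_ A l b x by lra.
rewrite /U_ ltr_pdivrMr ?exprn_gt0//.
rewrite -(ltr_pM2l br) [ltLHS]mulrCA -/s [ltRHS]mulrA -/t.
apply: (@lt_le_trans _ _ (t * (1 + z') ^+ b)); last first.
  rewrite ler_pM2l//; apply: lerXn2r; rewrite ?nnegrE; lra.
apply: (@lt_le_trans _ _ (t * expR (b%:R * (z' - z' ^+ 2)))); last first.
  by rewrite ler_pM2l//; apply: expR_le_expr1D; rewrite (ltW z'0).
rewrite -[ltLHS]lnK ?posrE ?mulr_gt0// -[t in ltRHS]lnK ?posrE// -expRD ltr_expR lnM ?posrE//.
have lnA : ln A <= 2 * lambda by apply: (le_trans (ln_le_subr1 A0)); nra.
have bz : b%:R * z' = s * expR (- t) * A^-1 by rewrite /z' /s; ring.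
have bz2 : b%:R * z' ^+ 2 <= gamma ^+ 2 * e.
  have -> : b%:R * z' ^+ 2 = (b%:R * z') ^+ 2 * b%:R^-1 by field; rewrite gt_eqF.
  apply: ler_pM; [exact: sqr_ge0|by rewrite invr_ge0 ltW| |exact: be].
  apply: lerXn2r; rewrite ?nnegrE; [by rewrite mulr_ge0// ltW|lra|].
  by apply: le_trans sg; rewrite ler_pM2l.
have set0 : 0 < s * expR (- t) by rewrite mulr_gt0 ?expR_gt0.
have setg : s * expR (- t) <= gamma.
  by apply: le_trans sg; rewrite -[leRHS]mulr1 ler_pM2l.
have bzA : s * expR (- t) - gamma * lambda <= b%:R * z' by rewrite bz; nra.
have lns : ln s - s * expR (- t) <= ln gamma - gamma * expR (- t).
  have : ln (s / gamma) <= s / gamma - 1 by apply: ln_le_subr1; rewrite divr_gt0.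
  rewrite ln_div ?posrE// => h1.
  have h2 : expR (- t) <= gamma^-1.
    rewrite -[gamma^-1]lnK ?posrE ?invr_gt0// ler_expR lnV ?posrE//; lra.
  have h3 : (gamma - s) * expR (- t) <= (gamma - s) * gamma^-1.
    by apply: ler_wpM2l => //; lra.
  rewrite !mulrBl mulfV ?gt_eqF// in h3; lra.
have gE' : 0 <= gamma <= E by lra.
have qt := ln_expR_mono gE' c0 ct.
rewrite mulrBr; nra.
Qed.

End NoLargeOdds.

(** * Fixed points of monotone maps *)

Section Tarski.
Variable R : realType.
Implicit Types (f : R -> R) (x y M : R).

Lemma least_fixpoint f x0 : (forall x y, 0 <= x -> x <= y -> f x <= f y) ->
  (forall x, 0 <= x -> 0 <= f x) -> 0 <= x0 -> f x0 <= x0 ->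
  exists2 x, is_least_fixpoint f x & x <= x0.
Proof.
move=> fm f0 x00 fx0; pose S := [set x : R | 0 <= x /\ f x <= x].
have Sx0 : S x0 by [].
have hlb : has_lbound S by exists 0 => x [].
have hi : has_inf S by split => //; exists x0.
pose x := inf S.
have xlb y : S y -> x <= y by exact: inf_lbound.
have x_ge0 : 0 <= x by apply: lb_le_inf => [|y []//]; exists x0.
have fxx : f x <= x.
  apply: lb_le_inf => [|y [y0 fy]]; first by exists x0.
  by apply: (le_trans _ fy); apply: fm => //; apply: xlb; split.
have xfx : x <= f x by apply: xlb; split; [exact: f0|apply: fm => //; exact: f0].
exists x; last exact: xlb.
split; first by split => //; apply/eqP; rewrite eq_le fxx.
by move=> y [y0 fy]; apply: xlb; split => //; rewrite fy.
Qed.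

Lemma greatest_fixpoint f M y0 : (forall x y, 0 <= x -> x <= y -> f x <= f y) ->
  (forall x, 0 <= x -> f x <= M) -> 0 <= y0 -> y0 <= f y0 ->
  exists2 x, is_greatest_fixpoint f x & y0 <= x.
Proof.
move=> fm fM y00 fy0; pose S := [set x : R | 0 <= x /\ x <= f x].
have Sy0 : S y0 by [].
have hub : has_ubound S by exists M => x [x0 xf]; exact: le_trans (fM _ x0).
pose x := sup S.
have xub y : S y -> y <= x by exact: ub_le_sup.
have x_ge0 : 0 <= x by exact: le_trans (xub _ Sy0).
have xfx : x <= f x.
  apply: ge_sup => [|y [y0' fy]]; first by exists y0.
  by apply: (le_trans fy); apply: fm => //; apply: xub; split.
have fx0 : 0 <= f x by exact: le_trans xfx.
have fxx : f x <= x by apply: xub; split => //; exact: fm.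
exists x; last exact: xub.
split; first by split => //; apply/eqP; rewrite eq_le fxx.
by move=> y [y0' fy]; apply: xub; split => //; rewrite fy.
Qed.

(** The two maps are [U_] after [L_] and [L_] after [U_]. Thus [x] bounds the least fixed point of
    the former from above and, [L_] being antitone, its image under [L_] bounds the greatest fixed
    point of the latter from below. *)
Lemma separated_of_witness C b lambda x : 0 < lambda < 1 -> 0 <= x ->
  let l := lambda ^+ jc C in
  x < L_ (A_ lambda) l b x -> U_ (A_ lambda) l b (L_ (A_ lambda) l b x) <= x ->
  fixpoints_separated C b lambda.
Proof.
move=> /andP[lam0 lam1] x0 l; set A := A_ lambda => xL ULx.
have l0 : 0 < l by exact: exprn_gt0.
have A0 : 0 < A by rewrite invr_gt0 subr_gt0.
have p0 y : 0 <= y -> 0 < (1 + y) ^+ b by move=> y0; rewrite exprn_gt0//; lra.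
have mono (k : R) y z : 0 <= k -> 0 <= y -> y <= z -> k / (1 + z) ^+ b <= k / (1 + y) ^+ b.
  move=> k0 y0 yz; apply: ler_wpM2l => //.
  rewrite lef_pV2 ?posrE ?p0 ?(le_trans y0)//.
  by apply: lerXn2r; rewrite ?nnegrE; lra.
have Al : 0 <= A * l by rewrite mulr_ge0// ltW.
have lA : 0 <= l / A by rewrite divr_ge0// ltW.
have U0 y : 0 <= y -> 0 <= U_ A l b y by move=> /p0 h; rewrite divr_ge0// ltW.
have L0 y : 0 <= y -> 0 <= L_ A l b y by move=> /p0 h; rewrite divr_ge0// ltW.
have Ubound y : 0 <= y -> L_ A l b y <= l / A.
  move=> y0; rewrite /L_ ler_pdivrMr ?p0// -[leLHS]mulr1; apply: ler_wpM2l => //.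
  by rewrite exprn_ege1//; lra.
have f1E : (fun t => A ^+ 2 * J2 b (lambda_minus C lambda) t) =
    (fun t => U_ A l b (L_ A l b t)).
  apply/funext => t; rewrite /J2 /lambda_minus -/A -/l /U_ /L_ mulrA.
  by congr (_ / (1 + _ / _) ^+ b); [field; rewrite gt_eqF|rewrite mulrC].
have f2E : (fun t => A ^- 2 * J2 b (lambda_plus C lambda) t) =
    (fun t => L_ A l b (U_ A l b t)).
  apply/funext => t; rewrite /J2 /lambda_plus -/A -/l /U_ /L_ mulrA.
  by congr (_ / _); field; rewrite gt_eqF.
have [u lu ux] : exists2 u, is_least_fixpoint
    (fun t => A ^+ 2 * J2 b (lambda_minus C lambda) t) u & u <= x.
  rewrite f1E; apply: (@least_fixpoint _ x) => // [y z y0 yz|y y0].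
    have z0 : 0 <= z by exact: le_trans yz.
    by apply: (mono) => //; [exact: L0|exact: (mono)].
  exact/U0/L0.
have [v gv xv] : exists2 v, is_greatest_fixpoint
    (fun t => A ^- 2 * J2 b (lambda_plus C lambda) t) v & L_ A l b x <= v.
  rewrite f2E; apply: (@greatest_fixpoint _ (l / A)) => //.
  - move=> y z y0 yz; have z0 : 0 <= z by exact: le_trans yz.
    by apply: (mono) => //; [exact: U0|exact: (mono)].
  - by move=> y /U0/Ubound.
  - exact: L0.
  - by apply: (mono) => //; exact/U0/L0.
by exists u, v; split => //; apply: le_lt_trans ux (lt_le_trans xL xv).
Qed.

End Tarski.

(** * One step of the recursion, and coexistence *)

Section HalfCapacity.
Variable C : nat.
Hypothesis oddC : odd C.
Local Notation j := (jc C).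

Lemma jc_double : (j + j = C.+1)%N.
Proof. by rewrite addnn /jc uphalfE halfK /= oddC. Qed.

Lemma jc_gt0 : (0 < j)%N.
Proof. by have := jc_double; case: (jc C). Qed.

Lemma jc_sub : (C - j = j.-1)%N.
Proof. by move: (jc C) jc_double jc_gt0 => k; lia. Qed.

Lemma jc_le : (j <= C)%N.
Proof. by move: (jc C) jc_double jc_gt0 => k; lia. Qed.

End HalfCapacity.

Section OneStep.
Variables (R : realType) (C b : nat) (lambda : R).
Hypotheses (lambda0 : 0 < lambda) (oddC : odd C).
Local Notation j := (jc C).

Lemma geometric_sum_le n : lambda < 1 -> \sum_(r < n) lambda ^+ r * (1 - lambda) <= 1.
Proof.
move=> l1; rewrite -mulr_suml; have := subrX1 lambda n => h.
have -> : (\sum_(r < n) lambda ^+ r) * (1 - lambda) = 1 - lambda ^+ n.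
  by rewrite mulrC -opprB mulNr -h opprB.
by rewrite gerBl exprn_ge0// ltW.
Qed.

Lemma tail_geometric m n : \sum_(k < n | (m <= k)%N) lambda ^+ k =
  lambda ^+ m * \sum_(r < n - m) lambda ^+ r.
Proof.
rewrite -(big_geq_mkord m n xpredT (fun k => lambda ^+ k)) -{1}[m]add0n big_addn.
by rewrite mulr_sumr big_mkord; apply: eq_bigr => i _; rewrite exprD mulrC.
Qed.

Variable f : nat -> R.
Hypotheses (f_ge0 : forall m, 0 <= f m) (fC : f C = 1).
Hypothesis f_mono : forall m n, (m <= n <= C)%N -> f m <= f n.

Definition Ssum m := psum (C := C) lambda (fun k => f (C - k)%N ^+ b) m.

Lemma f_le1 m : (m <= C)%N -> f m <= 1.
Proof. by move=> mC; rewrite -fC; apply: f_mono; rewrite mC /=. Qed.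

Lemma fX_ge0 m : 0 <= f m ^+ b.
Proof. exact: exprn_ge0. Qed.

Lemma fX_le1 m : (m <= C)%N -> f m ^+ b <= 1.
Proof. by move=> mC; rewrite exprn_ile1// f_le1. Qed.

Lemma Ssum_ge1 m : 1 <= Ssum m.
Proof.
rewrite /Ssum /psum (bigD1 ord0)//= subn0 fC expr1n expr0 mulr1 lerDl.
by apply: sumr_ge0 => k _; rewrite mulr_ge0 ?fX_ge0// exprn_ge0// ltW.
Qed.

Lemma Ssum_split m : Ssum C = Ssum m +
  \sum_(k < C.+1 | (m < k)%N) lambda ^+ k * f (C - k)%N ^+ b.
Proof.
rewrite /Ssum /psum (bigID (fun k : 'I_C.+1 => (k <= m)%N)) /=; congr (_ + _).
  by apply: eq_bigl => k; rewrite -ltnS ltn_ord.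
by apply: eq_bigl => k; rewrite -ltnS ltn_ord -ltnNge.
Qed.

Lemma Ssum_low A : \sum_(r < j) lambda ^+ r <= A -> Ssum j.-1 <= A.
Proof.
apply: le_trans; rewrite (big_ord_widen_cond C.+1 xpredT (fun r => lambda ^+ r)) /=; last first.
  exact: leq_trans (jc_le oddC) (leqnSn _).
rewrite /Ssum /psum [leLHS](eq_bigl (fun k : 'I_C.+1 => (k < j)%N)) => [|k]; last first.
  by rewrite -[in RHS](prednK (jc_gt0 oddC)) ltnS.
apply: ler_sum => k _; rewrite -[leRHS]mulr1; apply: ler_wpM2l.
  by rewrite exprn_ge0// ltW.
by rewrite fX_le1// leq_subr.
Qed.

(** An occupied spin k >= j sees f at C - k <= j - 1. Upper bound: replace each value by f (j - 1);
    the j remaining powers sum to at most A lambda^j. Lower bound: keep only k = j, where C - k is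
    exactly j - 1; the factor 1 / A pays for the unoccupied sum. *)
Lemma step_bounds A : 0 < A -> \sum_(r < j) lambda ^+ r <= A ->
  Ssum j.-1 * (1 + lambda ^+ j / A * f j.-1 ^+ b) <= Ssum C <=
  Ssum j.-1 * (1 + A * lambda ^+ j * f j.-1 ^+ b).
Proof.
move=> A0 sumA; have S1 := Ssum_ge1 j.-1; have SA := Ssum_low sumA.
have lj0 : 0 <= lambda ^+ j by rewrite exprn_ge0// ltW.
have F0 := fX_ge0 j.-1.
have jE k : (j.-1 < k)%N = (j <= k)%N by rewrite -[in RHS](prednK (jc_gt0 oddC)).
rewrite (Ssum_split j.-1) !mulrDr !mulr1 !lerD2l.
rewrite (eq_bigl (fun k : 'I_C.+1 => (j <= k)%N)); last by move=> k; rewrite jE.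
have jC : (j < C.+1)%N by rewrite ltnS (jc_le oddC).
apply/andP; split.
  rewrite (bigD1 (Ordinal jC))//= (jc_sub oddC).
  apply: (@le_trans _ _ (lambda ^+ j * f j.-1 ^+ b)); last first.
    rewrite lerDl; apply: sumr_ge0 => k _; rewrite mulr_ge0 ?fX_ge0// exprn_ge0//.
    exact: ltW.
  rewrite mulrA; apply: ler_wpM2r => //; rewrite mulrCA -[leRHS]mulr1.
  by apply: ler_wpM2l => //; rewrite ler_pdivrMr// mul1r.
apply: (@le_trans _ _ (\sum_(k < C.+1 | (j <= k)%N) lambda ^+ k * f j.-1 ^+ b)).
  apply: ler_sum => k jk; apply: ler_wpM2l; first by rewrite exprn_ge0// ltW.
  apply: lerXn2r; rewrite ?nnegrE//; apply: f_mono.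
  by rewrite -(jc_sub oddC) leq_sub2l//= leq_subr.
rewrite -mulr_suml tail_geometric -(jc_double oddC) addnK.
rewrite mulrA; apply: ler_wpM2r => //.
apply: (@le_trans _ _ (A * lambda ^+ j)); first by rewrite mulrC; apply: ler_wpM2r.
by rewrite -[leLHS]mul1r; apply: ler_wpM2r => //; rewrite mulr_ge0// ltW.
Qed.

End OneStep.

(** * From the witness to coexistence *)

Section PhaseCoexistence.
Variables (R : realType) (C b : nat) (lambda : R).
Hypotheses (lambda0 : 0 < lambda) (oddC : odd C).
Local Notation j := (jc C).

Lemma rcdf_mono n m m' : (m <= m')%N -> rcdf C b lambda n m <= rcdf C b lambda n m'.
Proof.
move=> mm; rewrite /rcdf ler_pM2r ?invr_gt0 ?psum_hfield_gt0//.
by apply: le_psum => // k; exact: hfield_ge0.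
Qed.

Lemma coexistence_of_witness A x : 0 < A -> \sum_(r < j) lambda ^+ r <= A -> 0 <= x ->
  x < L_ A (lambda ^+ j) b x ->
  U_ A (lambda ^+ j) b (L_ A (lambda ^+ j) b x) <= x ->
  phase_coexistence C (@tree_edge b) lambda.
Proof.
move=> A0 sumA x0; set l := lambda ^+ j; set y := L_ A l b x => xy Uy.
have l0 : 0 < l by exact: exprn_gt0.
have y0 : 0 < y by exact: le_lt_trans xy.
pose u n := rcdf C b lambda n j.-1.
have u0 n : 0 < u n by exact: rcdf_gt0.
have step n : 1 + l / A * u n ^+ b <= (u n.+1)^-1 <= 1 + A * l * u n ^+ b.
  have f0 m : 0 <= rcdf C b lambda n m by rewrite ltW// rcdf_gt0.
  have fm m m' : (m <= m' <= C)%N -> rcdf C b lambda n m <= rcdf C b lambda n m'.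
    by case/andP => mm _; exact: rcdf_mono.
  have := @step_bounds R C b lambda lambda0 oddC _ f0 (rcdf_max C b lambda0 n) fm A A0 sumA.
  have S0 : 0 < Ssum C b lambda (rcdf C b lambda n) j.-1.
    by apply: (lt_le_trans ltr01); apply: Ssum_ge1 => //; exact: rcdf_max.
  rewrite /u rcdfS// -/(Ssum C b lambda (rcdf C b lambda n) j.-1).
  rewrite -/(Ssum C b lambda (rcdf C b lambda n) C) invf_div.
  move=> /andP[h1 h2]; apply/andP; split.
    by rewrite ler_pdivlMr// mulrC.
  by rewrite ler_pdivrMr// mulrC.
(* Here 1 / u - 1 are the odds. Odds at most x are followed by odds at least L x = y, and these by
   odds at most U y <= x, which closes the induction. *)
have bnd n : if odd n then u n <= (1 + y)^-1 else (1 + x)^-1 <= u n.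
  elim: n => [|n]; first by rewrite /= /u rcdf0// invf_le1; lra.
  have u0n := u0 n; have /andP[s1 s2] := step n; rewrite oddS; case: (odd n) => /= IH.
    rewrite -[leRHS]invrK lef_pV2 ?posrE ?invr_gt0//; last by lra.
    apply: (le_trans s2); rewrite lerD2l; apply: (le_trans _ Uy).
    rewrite /U_; apply: ler_wpM2l; first by rewrite mulr_ge0// ltW.
    rewrite -exprVn; apply: lerXn2r; rewrite ?nnegrE ?invr_ge0//; lra.
  rewrite -[leLHS]invrK lef_pV2 ?posrE ?invr_gt0//; last by lra.
  apply: (le_trans _ s1); rewrite lerD2l /y /L_; apply: ler_wpM2l.
    by rewrite divr_ge0// ltW.
  rewrite -exprVn; apply: lerXn2r; rewrite ?nnegrE ?invr_ge0//; lra.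
apply: (@tree_phase_coexistence _ _ _ _ lambda0 j.-1 (1 + y)^-1 (1 + x)^-1).
- by rewrite ltf_pV2 ?posrE; lra.
- by move=> n /negPf on; have := bnd n; rewrite on.
- by move=> n on; have := bnd n; rewrite on.
Qed.

End PhaseCoexistence.

Lemma powR_root_le (R : realType) (g lambda : R) j b : (0 < j)%N -> (0 < b)%N ->
  0 <= g -> 0 < lambda -> (g / b%:R) `^ j%:R^-1 <= lambda -> g <= b%:R * lambda ^+ j.
Proof.
move=> j0 b0 g0 l0 H; have br : 0 < b%:R :> R by rewrite ltr0n.
rewrite mulrC -ler_pdivrMr//.
have -> : g / b%:R = ((g / b%:R) `^ j%:R^-1) ^+ j.
  rewrite -powR_mulrn ?powR_ge0// -powRrM mulVf ?pnatr_eq0 -?lt0n// powRr1//.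
  by rewrite divr_ge0.
by apply: lerXn2r; rewrite ?nnegrE ?powR_ge0// ltW.
Qed.

Lemma le_powR_root (R : realType) (g lambda : R) j b : (0 < j)%N -> (0 < b)%N ->
  0 <= g -> 0 < lambda -> lambda <= (g / b%:R) `^ j%:R^-1 -> b%:R * lambda ^+ j <= g.
Proof.
move=> j0 b0 g0 l0 H; have br : 0 < b%:R :> R by rewrite ltr0n.
rewrite mulrC -ler_pdivlMr//.
have -> : g / b%:R = ((g / b%:R) `^ j%:R^-1) ^+ j.
  rewrite -powR_mulrn ?powR_ge0// -powRrM mulVf ?pnatr_eq0 -?lt0n// powRr1//.
  by rewrite divr_ge0.
by apply: lerXn2r; rewrite ?nnegrE ?powR_ge0// ltW.
Qed.

(** * Thresholds above the critical value *)

Section PartOne.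
Variables (R : realType) (C : nat) (gamma : R).
Hypotheses (oddC : odd C) (gammaE : expR 1 < gamma).

(** [A_ lambda] blows up as lambda tends to 1; [lambda_max] supplies the bound [K] on it. *)
Lemma fixpoints_separated_large (lambda_max : R) : lambda_max < 1 ->
  exists b0 : nat, forall b : nat, (2 <= b)%N -> (b0 <= b)%N ->
    forall lambda : R, 0 < lambda -> (gamma / b%:R) `^ (jc C)%:R^-1 <= lambda ->
    lambda <= lambda_max -> fixpoints_separated C b lambda.
Proof.
move=> lm1; have E0 := expR_gt0 (1 : R).
pose K := Num.max 1 (1 - lambda_max)^-1.
have K1 : 1 <= K by rewrite le_max lexx.
have [b0 H] := witness_exists (jc_gt0 oddC) gammaE K1.
exists b0 => b b2 bb lambda l0 gl ll.
have b_gt0 : (0 < b)%N by exact: leq_trans b2.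
have l1 : lambda < 1 by exact: le_lt_trans lm1.
have A1 : 1 <= A_ lambda <= K.
  have a1 : 1 <= (1 - lambda)^-1 by rewrite invf_ge1; lra.
  have a2 : (1 - lambda)^-1 <= (1 - lambda_max)^-1 by rewrite lef_pV2 ?posrE; lra.
  by rewrite /A_ a1 /K le_max a2 orbT.
have Al : A_ lambda * (1 - lambda) <= 1 by rewrite mulVf// gt_eqF// subr_gt0.
have gam0 : 0 <= gamma by apply/ltW/(lt_trans E0).
have l01 : 0 < lambda < 1 by rewrite l0.
have [w1 w2] := H b lambda _ bb b2 l01 (powR_root_le (jc_gt0 oddC) b_gt0 gam0 l0 gl) A1 Al.
by apply: separated_of_witness w1 w2 => //; rewrite invr_ge0.
Qed.

Lemma coexistence_large : exists b0 : nat, forall b : nat, (2 <= b)%N -> (b0 <= b)%N ->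
  forall lambda : R, 0 < lambda -> (gamma / b%:R) `^ (jc C)%:R^-1 <= lambda ->
  lambda < 1 -> phase_coexistence C (@tree_edge b) lambda.
Proof.
have E0 := expR_gt0 (1 : R); have j0 := jc_gt0 oddC.
have K1 : 1 <= (jc C)%:R :> R by rewrite ler1n.
have [b0 H] := witness_exists j0 gammaE K1.
exists b0 => b b2 bb lambda l0 gl l1.
have b_gt0 : (0 < b)%N by exact: leq_trans b2.
pose A := \sum_(r < jc C) lambda ^+ r.
have A1 : 1 <= A <= (jc C)%:R.
  apply/andP; split.
    rewrite /A; case: (jc C) j0 => // k _; rewrite big_ord_recl expr0 lerDl.
    by apply: sumr_ge0 => r _; rewrite exprn_ge0// ltW.
  rewrite -[leRHS]mulr_natl mulr1 -[X in X%:R]card_ord -sumr_const.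
  by apply: ler_sum => r _; rewrite exprn_ile1// ltW.
have Al : A * (1 - lambda) <= 1 by rewrite /A mulr_suml; exact: geometric_sum_le.
have gam0 : 0 <= gamma by apply/ltW/(lt_trans E0).
have l01 : 0 < lambda < 1 by rewrite l0.
have [w1 w2] := H b lambda _ bb b2 l01 (powR_root_le j0 b_gt0 gam0 l0 gl) A1 Al.
apply: coexistence_of_witness w1 w2 => //.
by apply: lt_le_trans (ltr01) _; case/andP: A1.
Qed.

End PartOne.

(** * Contraction on a two-cycle *)

Section TwoCycle.
Variables (R : realType) (C b : nat) (lambda : R).
Hypotheses (lambda0 : 0 < lambda) (oddC : odd C).
Local Notation j := (jc C).
Variables p q : nat -> R.
Hypotheses (q_gt0 : forall m, 0 < q m) (p_gt0 : forall m, 0 < p m).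
Hypothesis qp : forall m, (m <= C)%N -> q m <= p m.
Hypotheses (pC : p C = 1) (qC : q C = 1).
Hypothesis p_mono : forall m n, (m <= n <= C)%N -> p m <= p n.
Hypothesis q_mono : forall m n, (m <= n <= C)%N -> q m <= q n.
Hypothesis ratio_mono : forall m n, (m <= n <= C)%N -> p n * q m <= p m * q n.
Local Notation Sp := (Ssum C b lambda p).
Local Notation Sq := (Ssum C b lambda q).
Hypothesis qE : forall m, (m <= C)%N -> q m = Sp m / Sp C.
Hypothesis pE : forall m, (m <= C)%N -> p m = Sq m / Sq C.

Let p_ge0 m : 0 <= p m. Proof. exact: ltW. Qed.
Let q_ge0 m : 0 <= q m. Proof. exact: ltW. Qed.

Definition dist m : R := ln (p m / q m).

Lemma dist_ge0 m : (m <= C)%N -> 0 <= dist m.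
Proof. by move=> mC; rewrite ln_ge0// ler_pdivlMr// mul1r qp. Qed.

Lemma dist_mono m n : (m <= n <= C)%N -> dist n <= dist m.
Proof.
move=> mn; rewrite /dist ler_ln ?posrE ?divr_gt0//.
by rewrite ler_pdivrMr// mulrAC ler_pdivlMr// ratio_mono.
Qed.

Lemma expR_dist m : p m = q m * expR (dist m).
Proof. by rewrite lnK ?posrE ?divr_gt0// mulrCA divff ?mulr1// gt_eqF. Qed.

Let Sp_ge1 m : 1 <= Sp m. Proof. exact: Ssum_ge1. Qed.
Let Sq_ge1 m : 1 <= Sq m. Proof. exact: Ssum_ge1. Qed.
Let Sp_gt0 m : 0 < Sp m. Proof. exact: lt_le_trans (Sp_ge1 m). Qed.
Let Sq_gt0 m : 0 < Sq m. Proof. exact: lt_le_trans (Sq_ge1 m). Qed.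

Definition tailw m : R := \sum_(k < C.+1 | (m < k)%N) lambda ^+ k * p (C - k)%N ^+ b.

Lemma subX_le_dist m : p m ^+ b - q m ^+ b <= p m ^+ b * (b%:R * dist m).
Proof.
have pb : 0 < p m ^+ b by rewrite exprn_gt0.
have : 1 + - (b%:R * dist m) <= expR (- (b%:R * dist m)) by exact: expR_ge1Dx.
have -> : expR (- (b%:R * dist m)) = q m ^+ b / p m ^+ b.
  rewrite expRN expRM_natl -expr_div_n -exprVn; congr (_ ^+ b).
  by rewrite [p m in RHS]expR_dist invfM mulrA divff ?mul1r// gt_eqF.
by rewrite ler_pdivlMr// mulrDl mul1r mulNr lerBlDr => h; rewrite lerBlDl mulrC -lerBlDr; lra.
Qed.

Lemma le_Sq_Sp m : (m <= C)%N -> Sq m <= Sp m.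
Proof.
move=> mC; apply: ler_sum => k _; apply: ler_wpM2l; first by rewrite exprn_ge0// ltW.
by apply: lerXn2r; rewrite ?nnegrE// qp// leq_subr.
Qed.

(* The recursion, linearized. *)
Lemma dist_step m : (m <= C)%N -> dist m * Sp m <=
  b%:R * \sum_(k < C.+1 | (m < k)%N) lambda ^+ k * p (C - k)%N ^+ b * dist (C - k).
Proof.
move=> mC; pose Tp := Sp C - Sp m; pose Tq := Sq C - Sq m.
have TpE : Tp = \sum_(k < C.+1 | (m < k)%N) lambda ^+ k * p (C - k)%N ^+ b.
  by rewrite /Tp (Ssum_split C b lambda p m) addrC addKr.
have TqE : Tq = \sum_(k < C.+1 | (m < k)%N) lambda ^+ k * q (C - k)%N ^+ b.
  by rewrite /Tq (Ssum_split C b lambda q m) addrC addKr.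
have Tq0 : 0 <= Tq.
  by rewrite TqE; apply: sumr_ge0 => k _; rewrite mulr_ge0// exprn_ge0// ltW.
apply: (@le_trans _ _ (Tp - Tq)).
  apply: (@le_trans _ _ ((p m / q m - 1) * Sp m)).
    by apply: ler_wpM2r; [exact: ltW|apply: ln_le_subr1; rewrite divr_gt0].
  have -> : (p m / q m - 1) * Sp m = (p m - q m) * Sp C.
    rewrite [q m in LHS]qE// [q m in RHS]qE//; field.
    by rewrite !gt_eqF.
  rewrite (qE mC) (pE mC).
  have -> : (Sq m / Sq C - Sp m / Sp C) * Sp C = Tp - Tq / Sq C * Sp C.
    by rewrite /Tp /Tq; field; rewrite !gt_eqF.
  (* The normalizations are ordered, Sq C <= Sp C, so discarding their ratio only enlarges the
     difference to Tp - Tq. *)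
  rewrite lerD2l lerN2 mulrAC ler_pdivlMr//; apply: ler_wpM2l => //.
  exact: le_Sq_Sp.
rewrite TpE TqE -sumrB mulr_sumr; apply: ler_sum => k _.
rewrite -mulrBr mulrCA -!mulrA; apply: ler_wpM2l; first by rewrite exprn_ge0// ltW.
by apply: (le_trans (subX_le_dist _)); rewrite mulrCA.
Qed.

Lemma dist_le m : (m <= C)%N -> dist m <= b%:R * tailw m * dist 0.
Proof.
move=> mC; have b0 : 0 <= b%:R :> R by exact: ler0n.
apply: (@le_trans _ _ (dist m * Sp m)).
  by rewrite -[leLHS]mulr1; apply: ler_wpM2l => //; exact: dist_ge0.
apply: (le_trans (dist_step mC)); rewrite -mulrA; apply: ler_wpM2l => //.
rewrite /tailw mulr_suml; apply: ler_sum => k _; apply: ler_wpM2l.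
  by rewrite mulr_ge0 ?exprn_ge0// ltW.
by apply: dist_mono; rewrite leq_subr.
Qed.

(** Keeping [Sp m] in [dist_step], instead of bounding it below by 1, turns the tail into the exact
    odds Sp C / Sp m - 1, as sharpness up to the critical value requires. *)
Lemma dist_odds m : (m <= C)%N -> dist m <= b%:R * ((q m)^-1 - 1) * dist 0.
Proof.
move=> mC; rewrite -(ler_pM2r (Sp_gt0 m)); apply: (le_trans (dist_step mC)).
have -> : b%:R * ((q m)^-1 - 1) * dist 0 * Sp m = b%:R * (tailw m * dist 0).
  have -> : tailw m = Sp C - Sp m by rewrite (Ssum_split C b lambda p m) addrC addKr.
  by rewrite qE//; field; rewrite !gt_eqF.
apply: ler_wpM2l; first exact: ler0n.
rewrite /tailw mulr_suml; apply: ler_sum => k _; apply: ler_wpM2l.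
  by rewrite mulr_ge0 ?exprn_ge0// ltW.
by apply: dist_mono; rewrite leq_subr.
Qed.

Lemma Ssum0 (f : nat -> R) : f C = 1 -> Ssum C b lambda f 0 = 1.
Proof.
move=> fC; rewrite /Ssum /psum (big_pred1 ord0) => [|k /=]; last first.
  by rewrite leqn0.
by rewrite subn0 fC expr1n expr0 mulr1.
Qed.

(** The distances at 0 and at j - 1 differ by ln (Sp (j - 1) / Sq (j - 1)). These two sums involve p
    and q only at C - k >= j, where p / q is at most e^(dist j). *)
Lemma dist0_le : dist 0 <= dist j.-1 + b%:R * dist j.
Proof.
have jC := jc_le oddC; have j1C : (j.-1 <= C)%N by exact: leq_trans (leq_pred _) jC.
have r0 : p 0%N / q 0%N = Sp C / Sq C.
  by rewrite qE// pE// !Ssum0//; field; rewrite !gt_eqF.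
have r1 : p j.-1 / q j.-1 = Sp C / Sq C * (Sq j.-1 / Sp j.-1).
  by rewrite qE// pE//; field; rewrite !gt_eqF.
have -> : dist j.-1 = dist 0 + ln (Sq j.-1 / Sp j.-1).
  by rewrite /dist r0 r1 lnM ?posrE ?divr_gt0.
rewrite -addrA lerDl -lerBlDr sub0r.
rewrite -[leLHS]expRK ler_ln ?posrE ?expR_gt0 ?divr_gt0// ler_pdivlMr//.
rewrite /Ssum /psum mulr_sumr; apply: ler_sum => k kj.
rewrite mulrCA; apply: ler_wpM2l; first by rewrite exprn_ge0// ltW.
have kC : (C - k <= C)%N by rewrite leq_subr.
have jk : (j <= C - k <= C)%N.
  rewrite kC andbT; move: kj; move: (nat_of_ord k) => i ij.
  by move: (jc C) (jc_double oddC) (jc_gt0 oddC) ij => n; lia.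
rewrite expRN mulrC ler_pdivrMr ?expR_gt0// expRM_natl -exprMn.
apply: lerXn2r; rewrite ?nnegrE ?mulr_ge0 ?expR_ge0//.
rewrite [leLHS]expR_dist; apply: ler_wpM2l => //; rewrite ler_expR.
exact: dist_mono.
Qed.

Hypothesis lambda_half : lambda <= 1 / 2.

Lemma tail_sum_le m : \sum_(k < C.+1 | (m <= k)%N) lambda ^+ k <= 2 * lambda ^+ m.
Proof.
rewrite tail_geometric mulrC; apply: ler_wpM2r; first by rewrite exprn_ge0// ltW.
have lh := lambda_half; have l1 : lambda < 1 by lra.
have := geometric_sum_le lambda0 (C.+1 - m) l1; rewrite -mulr_suml.
set S := \sum_(r < _) _; have S0 : 0 <= S.
  by apply: sumr_ge0 => r _; rewrite exprn_ge0// ltW.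
nra.
Qed.

Lemma tailw_le m : tailw m <= 2 * lambda ^+ m.+1.
Proof.
apply: le_trans (tail_sum_le _); apply: ler_sum => k _.
rewrite -[leRHS]mulr1; apply: ler_wpM2l; first by rewrite exprn_ge0// ltW.
by apply: exprn_ile1 => //; rewrite -pC; apply: p_mono; rewrite leq_subr leqnn.
Qed.

(** Spins k >= j contribute at most 2 b lambda^j. For 0 < k < j a second step is taken:
    [dist (C - k)] brings a factor b lambda^(C - k + 1), so each of these terms has order b^2
    lambda^(C + 1), and C + 1 = 2 j. *)
Lemma dist0_small : 2 * (b%:R * lambda ^+ j) + 2 * j%:R * (b%:R * lambda ^+ j) ^+ 2 < 1 ->
  dist 0 = 0.
Proof.
move=> small; have D0 : 0 <= dist 0 by exact: dist_ge0.
have b0 : 0 <= b%:R :> R by exact: ler0n.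
have l0 n : 0 <= lambda ^+ n by rewrite exprn_ge0// ltW.
have p1 k : p (C - k) ^+ b <= 1.
  by apply: exprn_ile1 => //; rewrite -pC; apply: p_mono; rewrite leq_subr leqnn.
have h := dist_step (leq0n C); rewrite Ssum0// mulr1 in h.
suff : dist 0 <= (2 * (b%:R * lambda ^+ j) + 2 * j%:R * (b%:R * lambda ^+ j) ^+ 2) * dist 0.
  by move=> h2; apply/eqP; rewrite eq_le D0 andbT; nra.
apply: (le_trans h); have -> : (2 * (b%:R * lambda ^+ j) + 2 * j%:R * (b%:R * lambda ^+ j) ^+ 2) * dist 0
   = b%:R * ((2 * lambda ^+ j + j%:R * (2 * b%:R * lambda ^+ C.+1)) * dist 0).
  by rewrite -(jc_double oddC) exprD; ring.
apply: ler_wpM2l => //.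
rewrite (bigID (fun k : 'I_C.+1 => (j <= k)%N)) /= mulrDl; apply: lerD.
  apply: (@le_trans _ _ ((\sum_(k < C.+1 | (j <= k)%N) lambda ^+ k) * dist 0)); last first.
    by apply: ler_wpM2r => //; exact: tail_sum_le.
  rewrite mulr_suml [leLHS](eq_bigl (fun k : 'I_C.+1 => (j <= k)%N)) => [|k]; last first.
    by rewrite andbC; case: (leqP j k) => //= jk; exact: leq_trans (jc_gt0 oddC) jk.
  apply: ler_sum => k _; rewrite -mulrA; apply: ler_wpM2l => //.
  rewrite -[leRHS]mul1r; apply: ler_pM; rewrite ?exprn_ge0//; last first.
    by apply: dist_mono; rewrite leq_subr.
  by apply: dist_ge0; rewrite leq_subr.
apply: (@le_trans _ _ (\sum_(k < C.+1 | (k < j)%N) 2 * b%:R * lambda ^+ C.+1 * dist 0)).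
  rewrite [leLHS]big_mkcond [leRHS]big_mkcond /=; apply: ler_sum => k _.
  rewrite -ltnNge; case: (ltnP k j) => kj; last by rewrite andbF.
  rewrite andbT; case: (ltnP 0 k) => k0; last by rewrite !mulr_ge0.
  have kC : (k <= C)%N by rewrite -ltnS.
  have dk : dist (C - k) <= b%:R * (2 * lambda ^+ (C - k).+1) * dist 0.
    apply: (le_trans (dist_le (leq_subr _ _))).
    apply: ler_wpM2r => //; apply: ler_wpM2l => //; exact: tailw_le.
  have -> : 2 * b%:R * lambda ^+ C.+1 * dist 0 =
      lambda ^+ k * (b%:R * (2 * lambda ^+ (C - k).+1) * dist 0).
    by rewrite -[in LHS](subnK kC) -addSn exprD; ring.
  rewrite -mulrA; apply: ler_wpM2l => //.
  rewrite -[leRHS]mul1r; apply: ler_pM; rewrite ?exprn_ge0//.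
  by apply: dist_ge0; rewrite leq_subr.
rewrite -(big_ord_widen C.+1 (fun=> 2 * b%:R * lambda ^+ C.+1 * dist 0)).
  by rewrite sumr_const card_ord -[leLHS]mulr_natl !mulrA.
exact: leq_trans (jc_le oddC) (leqnSn _).
Qed.

Lemma dist0_large c : c < 1 -> b%:R * ((q j.-1)^-1 - 1) <= c ->
  b%:R ^+ 2 * tailw j <= (1 - c) / 2 -> dist 0 = 0.
Proof.
move=> c1 h1 h2; have D0 : 0 <= dist 0 by exact: dist_ge0.
have jC := jc_le oddC; have j1C : (j.-1 <= C)%N by exact: leq_trans (leq_pred _) jC.
have e1 := dist0_le; have e2 := dist_odds j1C; have e3 := dist_le jC.
have e4 : dist j.-1 <= c * dist 0 by apply: (le_trans e2); apply: ler_wpM2r.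
have e5 : b%:R * dist j <= (1 - c) / 2 * dist 0.
  apply: (@le_trans _ _ (b%:R ^+ 2 * tailw j * dist 0)); last by apply: ler_wpM2r.
  by rewrite expr2 -!mulrA; apply: ler_wpM2l; rewrite ?ler0n// mulrA.
have : (1 - c) / 2 * dist 0 <= 0 by lra.
by rewrite pmulr_rle0 => [h|]; [apply/eqP; rewrite eq_le D0 h|lra].
Qed.

(** A spin k > j confines each child to spins up to C - k < j - 1 and so excludes j - 1. That spin
    has probability at least lambda^(j - 1) / 4, by q(j)^b >= 1/2 and a normalization at most 2; the
    b-th power of the complement is exponentially small. *)
Lemma tailw_exp : 4 * b%:R * lambda ^+ j.+1 <= 1 ->
  tailw j <= 2 * lambda ^+ j.+1 * expR (- (b%:R * lambda ^+ j.-1 / 4)).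
Proof.
move=> small; have l0 n : 0 <= lambda ^+ n by rewrite exprn_ge0// ltW.
have jC := jc_le oddC; have lh := lambda_half; have l1 : lambda < 1 by lra.
have b0 : 0 <= b%:R :> R by exact: ler0n.
have p1 k : p (C - k) ^+ b <= 1.
  by apply: exprn_ile1 => //; rewrite -pC; apply: p_mono; rewrite leq_subr leqnn.
apply: (@le_trans _ _ (\sum_(k < C.+1 | (j < k)%N) lambda ^+ k * expR (- (b%:R * lambda ^+ j.-1 / 4)))); last first.
  by rewrite -mulr_suml; apply: ler_wpM2r; [exact: expR_ge0|exact: tail_sum_le].
apply: ler_sum => k jk; apply: ler_wpM2l => //.
have qj : 1 - 2 * lambda ^+ j.+1 <= q j.
  have -> : q j = 1 - tailw j / Sp C.
    have -> : tailw j = Sp C - Sp j by rewrite (Ssum_split C b lambda p j) addrC addKr.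
    by rewrite qE// mulrBl divff ?gt_eqF// opprB addrC subrK.
  rewrite lerD2l lerN2; apply: le_trans (tailw_le j).
  rewrite ler_pdivrMr// -[leLHS]mulr1; apply: ler_wpM2l => //.
  by apply: sumr_ge0 => i _; rewrite mulr_ge0// exprn_ge0.
have qjb : 1 / 2 <= q j ^+ b.
  have x1 : -1 <= - (2 * lambda ^+ j.+1).
    have lj1 : lambda ^+ j <= 1 by rewrite exprn_ile1// ltW.
    by have lj0 := l0 j; rewrite lerN2 exprS; nra.
  apply: (@le_trans _ _ ((1 - 2 * lambda ^+ j.+1) ^+ b)).
    by apply: le_trans (bernoulli b x1); nra.
  apply: lerXn2r; rewrite ?nnegrE//; lra.
have kC : (k <= C)%N by rewrite -ltnS.
set m := (C - k)%N; have mC : (m <= C)%N by rewrite leq_subr.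
have mj : (m < j.-1)%N.
  rewrite /m; move: (nat_of_ord k) jk kC => i.
  by move: (jc C) (jc_double oddC) (jc_gt0 oddC) => n; lia.
have pm : p m <= 1 + - (lambda ^+ j.-1 / 4).
  have -> : p m = 1 - (Sq C - Sq m) / Sq C.
    by rewrite pE// mulrBl divff ?gt_eqF// opprB addrC subrK.
  rewrite lerD2l lerN2 ler_pdivlMr//.
  have Sq2 : Sq C <= 2.
    apply: (@le_trans _ _ (\sum_(i < C.+1 | (0 <= i)%N) lambda ^+ i)); last first.
      by apply: le_trans (tail_sum_le 0) _; rewrite expr0 mulr1.
    rewrite /Ssum /psum [leLHS](eq_bigl (fun i : 'I_C.+1 => (0 <= i)%N)) => [|i]; last first.
      by rewrite -ltnS ltn_ord.
    apply: ler_sum => i _; rewrite -[leRHS]mulr1; apply: ler_wpM2l => //.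
    by apply: exprn_ile1 => //; rewrite -qC; apply: q_mono; rewrite leq_subr leqnn.
  rewrite [in leRHS](Ssum_split C b lambda q m) [leRHS]addrC addKr.
  have j1C : (j.-1 < C.+1)%N by rewrite ltnS (leq_trans (leq_pred _)).
  rewrite (bigD1 (Ordinal j1C))//=.
  have -> : (C - j.-1 = j)%N.
    by move: (jc C) (jc_double oddC) (jc_gt0 oddC) => n; lia.
  have S0 : 0 <= \sum_(i < C.+1 | (m < i)%N && (i != Ordinal j1C)) lambda ^+ i * q (C - i) ^+ b.
    by apply: sumr_ge0 => i _; rewrite mulr_ge0// exprn_ge0.
  apply: (@le_trans _ _ (lambda ^+ j.-1 * (1 / 2))).
    have : lambda ^+ j.-1 * Sq C <= lambda ^+ j.-1 * 2 by exact: ler_wpM2l.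
    by lra.
  by apply: (@le_trans _ _ (lambda ^+ j.-1 * q j ^+ b)); [apply: ler_wpM2l|rewrite lerDl].
apply: (@le_trans _ _ ((1 + - (lambda ^+ j.-1 / 4)) ^+ b)).
  by apply: lerXn2r; rewrite ?nnegrE//; exact: le_trans pm.
have lj1 : lambda ^+ j.-1 <= 1 by rewrite exprn_ile1// ltW.
apply: le_trans (expr1D_le_expR _ _) _; first by lra.
by rewrite mulrN mulrA.
Qed.

(** Two steps of the recursion lead from [q] back to [q], so its odds are caught between the
    one-step bounds. This is the inequality that [no_large_odds] contradicts. *)
Lemma odds_le_UL A : 0 < A -> \sum_(r < j) lambda ^+ r <= A ->
  (q j.-1)^-1 - 1 <= U_ A (lambda ^+ j) b (L_ A (lambda ^+ j) b ((q j.-1)^-1 - 1)).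
Proof.
move=> A0 sumA; set X := (q j.-1)^-1 - 1.
have jC := jc_le oddC; have j1C : (j.-1 <= C)%N by exact: leq_trans (leq_pred _) jC.
have l0 : 0 < lambda ^+ j by rewrite exprn_gt0.
have qX : q j.-1 = (1 + X)^-1 by rewrite /X addrC subrK invrK.
have /andP[_ h1] := step_bounds b lambda0 oddC p_ge0 pC p_mono A0 sumA.
have /andP[h2 _] := step_bounds b lambda0 oddC q_ge0 qC q_mono A0 sumA.
have k1 : X <= A * lambda ^+ j * p j.-1 ^+ b.
  by rewrite /X lerBlDl qE// invf_div ler_pdivrMr// mulrC.
have k2 : 1 + L_ A (lambda ^+ j) b X <= (p j.-1)^-1.
  rewrite /L_ -exprVn -qX pE// invf_div ler_pdivlMr//.
  by rewrite mulrC.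
apply: (le_trans k1); rewrite /U_; apply: ler_wpM2l.
  by rewrite mulr_ge0// ltW.
have L0 : 0 < 1 + L_ A (lambda ^+ j) b X.
  rewrite ltr_pwDl// /L_ -exprVn -qX mulr_ge0 ?exprn_ge0//.
  by rewrite divr_ge0// ltW.
rewrite -exprVn; apply: lerXn2r; rewrite ?nnegrE ?invr_ge0 ?(ltW L0)//.
by rewrite -[leLHS]invrK lef_pV2 ?posrE ?invr_gt0.
Qed.

Lemma eq_of_dist0 m : dist 0 = 0 -> (m <= C)%N -> p m = q m.
Proof.
move=> d0 mC; have : dist m = 0.
  by apply/eqP; rewrite eq_le dist_ge0// -d0 dist_mono.
by move=> dm; rewrite expR_dist dm expR0 mulr1.
Qed.

End TwoCycle.

(** * The limiting two-cycle, and uniqueness *)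

Section Limits.
Variables (R : realType) (C b : nat) (lambda : R).
Hypotheses (lambda0 : 0 < lambda).
Local Notation F := (rcdf C b lambda).

Let F_gt0 n m : 0 < F n m. Proof. exact: rcdf_gt0. Qed.

Lemma even_is_cvg m : cvgn (fun e => F e.*2 m).
Proof.
apply: nonincreasing_is_cvgn; last by exists 0 => _ [e _ <-]; exact: ltW.
apply/nonincreasing_seqP => e; apply: rcdf_hlr => //.
by have := hlr_hfieldSS C b lambda0 e.*2; rewrite odd_double.
Qed.

Lemma odd_is_cvg m : cvgn (fun e => F e.*2.+1 m).
Proof.
apply: nondecreasing_is_cvgn.
  apply/nondecreasing_seqP => e; apply: rcdf_hlr => //.
  by have := hlr_hfieldSS C b lambda0 e.*2.+1; rewrite /= odd_double.
exists 1 => _ [e _ <-]; have [mC|Cm] := leqP m C.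
  by rewrite -(rcdf_max C b lambda0 e.*2.+1); exact: rcdf_mono.
by rewrite rcdf_out// ltnW.
Qed.

Definition even_lim m : R := lim (F e.*2 m @[e --> \oo]).
Definition odd_lim m : R := lim (F e.*2.+1 m @[e --> \oo]).
Local Notation p := even_lim.
Local Notation q := odd_lim.

Lemma cvg_even_lim m : F e.*2 m @[e --> \oo] --> p m.
Proof. exact: even_is_cvg. Qed.

Lemma cvg_odd_lim m : F e.*2.+1 m @[e --> \oo] --> q m.
Proof. exact: odd_is_cvg. Qed.

Lemma cvg_expr (u : nat -> R) (l : R) n :
  u e @[e --> \oo] --> l -> u e ^+ n @[e --> \oo] --> l ^+ n.
Proof.
move=> ul; elim: n => [|n IH].
  by rewrite (_ : (fun e => _) = cst 1); [exact: cvg_cst|apply/funext => e; rewrite expr0].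
rewrite exprS (_ : (fun e => _) = (fun e => u e * u e ^+ n)); first exact: cvgM.
by apply/funext => e; rewrite exprS.
Qed.

Lemma cvg_Ssum (g : nat -> nat -> R) (h : nat -> R) m :
  (forall k, g e k @[e --> \oo] --> h k) ->
  Ssum C b lambda (g e) m @[e --> \oo] --> Ssum C b lambda h m.
Proof.
move=> gh; rewrite /Ssum /psum big_mkcond /=.
rewrite (_ : (fun e => _) = (fun e => \sum_(k < C.+1)
    if (k <= m)%N then lambda ^+ k * g e (C - k)%N ^+ b else 0)); last first.
  by apply/funext => e; rewrite big_mkcond.
elim: (index_enum _) => [|k r IH].
  by rewrite big_nil (_ : (fun e => _) = cst 0); [exact: cvg_cst|apply/funext => e; rewrite big_nil].
rewrite big_cons (_ : (fun e => _) = (fun e =>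
    (if (k <= m)%N then lambda ^+ k * g e (C - k)%N ^+ b else 0) +
    \sum_(i <- r) if (i <= m)%N then lambda ^+ i * g e (C - i)%N ^+ b else 0)); last first.
  by apply/funext => e; rewrite big_cons.
apply: cvgD => //; case: ifP => _; last exact: cvg_cst.
by apply: cvgMr; exact: cvg_expr.
Qed.

Lemma even_lim_ge0 m : 0 <= p m.
Proof. by apply: (cvgr_to_ge (@cvg_even_lim m)); apply: nearW => e; exact: ltW. Qed.

Lemma odd_lim_ge0 m : 0 <= q m.
Proof. by apply: (cvgr_to_ge (@cvg_odd_lim m)); apply: nearW => e; exact: ltW. Qed.

Lemma even_lim_mono m n : (m <= n)%N -> p m <= p n.
Proof.
move=> mn; apply: (ler_cvg_to (@cvg_even_lim m) (@cvg_even_lim n)).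
by apply: nearW => e; exact: rcdf_mono.
Qed.

Lemma odd_lim_mono m n : (m <= n)%N -> q m <= q n.
Proof.
move=> mn; apply: (ler_cvg_to (@cvg_odd_lim m) (@cvg_odd_lim n)).
by apply: nearW => e; exact: rcdf_mono.
Qed.

Lemma even_lim_max m : (C <= m)%N -> p m = 1.
Proof.
move=> Cm; apply: (cvg_unique _ (@cvg_even_lim m)) => //.
rewrite (_ : (fun e => _) = cst 1); first exact: cvg_cst.
by apply/funext => e; rewrite rcdf_out.
Qed.

Lemma odd_lim_max m : (C <= m)%N -> q m = 1.
Proof.
move=> Cm; apply: (cvg_unique _ (@cvg_odd_lim m)) => //.
rewrite (_ : (fun e => _) = cst 1); first exact: cvg_cst.
by apply/funext => e; rewrite rcdf_out.
Qed.

Let hlr_even e : hlr (hfield (C := C) b lambda e.*2) (hfield b lambda e.*2.+1).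
Proof. by have := hlr_hfieldS C b lambda0 e.*2; rewrite odd_double. Qed.

Lemma odd_lim_le_even m : q m <= p m.
Proof.
apply: (ler_cvg_to (@cvg_odd_lim m) (@cvg_even_lim m)).
by apply: nearW => e; apply: rcdf_hlr => //; exact: hlr_even.
Qed.

Lemma lim_ratio_mono m n : (m <= n)%N -> p n * q m <= p m * q n.
Proof.
move=> mn; apply: (ler_cvg_to (cvgM (@cvg_even_lim n) (@cvg_odd_lim m))
  (cvgM (@cvg_even_lim m) (@cvg_odd_lim n))).
by apply: nearW => e; apply: rcdf_ratio => //; exact: hlr_even.
Qed.

Lemma cvg_step (g : nat -> nat -> R) (h : nat -> R) m :
  (forall k, 0 <= h k) -> h C = 1 -> (forall k, g e k @[e --> \oo] --> h k) ->
  Ssum C b lambda (g e) m / Ssum C b lambda (g e) C @[e --> \oo] -->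
  Ssum C b lambda h m / Ssum C b lambda h C.
Proof.
move=> h0 hC gh; apply: cvgM; first exact: cvg_Ssum.
apply: cvgV; last exact: cvg_Ssum.
by rewrite gt_eqF// (lt_le_trans ltr01)// Ssum_ge1.
Qed.

Lemma odd_limE m : q m = Ssum C b lambda p m / Ssum C b lambda p C.
Proof.
apply: (cvg_unique _ (@cvg_odd_lim m)) => //.
rewrite (_ : (fun e => _) = (fun e => Ssum C b lambda (F e.*2) m / Ssum C b lambda (F e.*2) C)).
  apply: (@cvg_step (fun e => _)); [exact: even_lim_ge0|exact: even_lim_max|].
  by move=> k; exact: cvg_even_lim.
by apply/funext => e; rewrite rcdfS.
Qed.

Lemma even_limE m : p m = Ssum C b lambda q m / Ssum C b lambda q C.
Proof.
have cvS : F e.+1.*2 m @[e --> \oo] --> p m.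
  by have := @cvg_even_lim m; rewrite -(cvg_shiftS (fun e => F e.*2 m)).
apply: (cvg_unique _ cvS) => //.
rewrite (_ : (fun e => _) = (fun e => Ssum C b lambda (F e.*2.+1) m / Ssum C b lambda (F e.*2.+1) C)).
  apply: (@cvg_step (fun e => _)); [exact: odd_lim_ge0|exact: odd_lim_max|].
  by move=> k; exact: cvg_odd_lim.
by apply/funext => e; rewrite doubleS rcdfS.
Qed.

Lemma even_lim_gt0 m : 0 < p m.
Proof.
have S0 k : 0 < Ssum C b lambda q k.
  by apply: (lt_le_trans ltr01); apply: Ssum_ge1 => //; [exact: odd_lim_ge0|exact: odd_lim_max].
by rewrite even_limE divr_gt0.
Qed.

Lemma odd_lim_gt0 m : 0 < q m.
Proof.
have S0 k : 0 < Ssum C b lambda p k.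
  by apply: (lt_le_trans ltr01); apply: Ssum_ge1 => //; [exact: even_lim_ge0|exact: even_lim_max].
by rewrite odd_limE divr_gt0.
Qed.

Lemma unique_of_dist0 : dist p q 0 = 0 -> unique_gibbs C (@tree_edge b) lambda.
Proof.
move=> d0; have pq m : p m = q m.
  have [mC|Cm] := leqP m C; last by rewrite even_lim_max ?odd_lim_max// ltnW.
  apply: (@eq_of_dist0 _ C _ _ odd_lim_gt0 even_lim_gt0) => //.
  - by move=> k _; exact: odd_lim_le_even.
  - by move=> k n /andP[kn _]; exact: lim_ratio_mono.
apply: (@tree_unique_gibbs _ _ _ _ lambda0 p) => m; first exact: cvg_even_lim.
by rewrite pq; exact: cvg_odd_lim.
Qed.

End Limits.

(** * Thresholds below the critical value *)

Section PartTwo.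
Variables (R : realType) (C : nat) (gamma : R).
Hypotheses (oddC : odd C) (gamma1 : 1 <= gamma) (gammaE : gamma < expR 1).
Local Notation j := (jc C).

Lemma expRN_le_pow n (y : R) : (0 < n)%N -> 0 < y -> expR (- y) <= (n%:R / y) ^+ n.
Proof.
move=> n0 y0; have nr : 0 < n%:R :> R by rewrite ltr0n.
have -> : - y = n%:R * - (y / n%:R) by field; rewrite gt_eqF.
rewrite expRM_natl; apply: lerXn2r; rewrite ?nnegrE ?expR_ge0//.
  by rewrite divr_ge0// ltW.
rewrite expRN -[leRHS]invf_div lef_pV2 ?posrE ?expR_gt0 ?divr_gt0//.
by apply: le_trans (expR_ge1Dx _); rewrite lerDr.
Qed.

(** Since b lambda^(j - 1) = s / lambda with s = b lambda^j >= s0, the exponential is at most (4 j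
    lambda / s)^j. The factor lambda^j so gained turns b^2 lambda^(j + 1) into s^2 lambda. *)
Lemma large_regime_tail (s0 : R) : 0 < s0 -> exists2 K : R, 0 < K &
  forall (b : nat) (lambda : R), (0 < b)%N -> 0 < lambda ->
    s0 <= b%:R * lambda ^+ j <= gamma ->
    b%:R ^+ 2 * (2 * lambda ^+ j.+1 * expR (- (b%:R * lambda ^+ j.-1 / 4))) <= K * lambda.
Proof.
move=> s00; have j0 := jc_gt0 oddC.
have g1 := gamma1.
exists (2 * gamma ^+ 2 * (4 * j%:R / s0) ^+ j).
  have jr : 0 < j%:R :> R by rewrite ltr0n.
  have g0 : 0 < gamma by lra.
  by rewrite !mulr_gt0 ?exprn_gt0 ?divr_gt0 ?mulr_gt0.
move=> b lambda b0 l0 /andP[s0s sg].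
have br : 0 < b%:R :> R by rewrite ltr0n.
have lj n : 0 < lambda ^+ n by rewrite exprn_gt0.
set s := b%:R * lambda ^+ j in s0s sg; have s_gt0 : 0 < s by rewrite mulr_gt0.
have y0 : 0 < b%:R * lambda ^+ j.-1 / 4 by rewrite divr_gt0// mulr_gt0.
have h := expRN_le_pow j0 y0.
have yE : j%:R / (b%:R * lambda ^+ j.-1 / 4) = 4 * j%:R / s * lambda.
  have lE : lambda ^+ j = lambda * lambda ^+ j.-1 by rewrite -exprS prednK.
  rewrite /s lE; field.
  by rewrite !gt_eqF.
rewrite yE exprMn in h.
apply: (@le_trans _ _ (b%:R ^+ 2 * (2 * lambda ^+ j.+1 * ((4 * j%:R / s) ^+ j * lambda ^+ j)))).
  by apply: ler_wpM2l; [exact: exprn_ge0|apply: ler_wpM2l => //; rewrite mulr_ge0// ltW].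
have -> : b%:R ^+ 2 * (2 * lambda ^+ j.+1 * ((4 * j%:R / s) ^+ j * lambda ^+ j)) =
    2 * s ^+ 2 * (4 * j%:R / s) ^+ j * lambda by set w := (_ / s) ^+ j; rewrite /s [lambda ^+ j.+1]exprS; ring.
apply: ler_wpM2r; first exact: ltW.
have r0 : 0 <= 4 * j%:R / s by rewrite divr_ge0 ?mulr_ge0// ltW.
apply: ler_pM.
- by rewrite mulr_ge0// exprn_ge0// ltW.
- by rewrite exprn_ge0.
- by rewrite ler_pM2l//; apply: lerXn2r; rewrite ?nnegrE//; lra.
apply: lerXn2r; rewrite ?nnegrE//.
  by rewrite divr_ge0 ?mulr_ge0// ltW.
apply: ler_wpM2l; first by rewrite mulr_ge0.
by rewrite lef_pV2 ?posrE.
Qed.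

Lemma unique_gibbs_small : exists b0 : nat, forall b : nat, (2 <= b)%N -> (b0 <= b)%N ->
  forall lambda : R, 0 < lambda -> b%:R * lambda ^+ j <= gamma ->
  unique_gibbs C (@tree_edge b) lambda.
Proof.
have g1 := gamma1; have gE := gammaE; have j0 := jc_gt0 oddC.
have jr : 1 <= j%:R :> R by rewrite ler1n.
have g1E : 1 <= gamma < expR 1 by rewrite g1.
have [c [e [/andP[c0 c1] e0 Hodds]]] := no_large_odds g1E.
(* Below this value s <= 1/4 and j s <= 1/4, hence 2 s + 2 j s^2 < 1. *)
pose s0 : R := (4 * j%:R)^-1; have s00 : 0 < s0 by rewrite invr_gt0; lra.
have [K K0 HK] := large_regime_tail s00.
(* In turn: for [no_large_odds], for the geometric tails, for the hypothesis of [tailw_exp], and for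
   K lambda <= (1 - c) / 2 in [dist0_large]. *)
pose e' := Num.min (Num.min e (1 / 2)) (Num.min (4 * gamma)^-1 ((1 - c) / 2 / K)).
have e'0 : 0 < e'.
  rewrite !lt_min e0 invr_gt0; apply/andP; split; first by lra.
  by apply/andP; split; [lra|rewrite divr_gt0//; lra].
have [b1 Hb1] := small_root gamma j0 e'0.
have [b2 Hb2] := large_nat e^-1.
exists (maxn b1 b2) => b b2' ; rewrite geq_max => /andP[bb1 bb2] lambda l0 sg.
have b_gt0 : (0 < b)%N by exact: leq_trans b2'.
have br : 0 < b%:R :> R by rewrite ltr0n.
have le := Hb1 _ _ bb1 l0 sg.
have [le1 le2 le3 le4] : [/\ lambda <= e, lambda <= 1 / 2, lambda <= (4 * gamma)^-1 &
    lambda <= (1 - c) / 2 / K].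
  by move: le; rewrite /e' !le_min => /andP[/andP[-> ->] /andP[-> ->]].
apply: unique_of_dist0 => //; set p := even_lim _ _ _; set q := odd_lim _ _ _.
have q0 m : 0 < q m by exact: odd_lim_gt0.
have p0 m : 0 < p m by exact: even_lim_gt0.
have qp m : (m <= C)%N -> q m <= p m by move=> _; exact: odd_lim_le_even.
have pC : p C = 1 by exact: even_lim_max.
have qC : q C = 1 by exact: odd_lim_max.
have pm m n : (m <= n <= C)%N -> p m <= p n by case/andP => mn _; exact: even_lim_mono.
have qm m n : (m <= n <= C)%N -> q m <= q n by case/andP => mn _; exact: odd_lim_mono.
have rm m n : (m <= n <= C)%N -> p n * q m <= p m * q n by case/andP => mn _; exact: lim_ratio_mono.
have qE m : (m <= C)%N -> q m = Ssum C b lambda p m / Ssum C b lambda p C by move=> _; exact: odd_limE.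
have pE m : (m <= C)%N -> p m = Ssum C b lambda q m / Ssum C b lambda q C by move=> _; exact: even_limE.
have s_gt0 : 0 < b%:R * lambda ^+ j by rewrite mulr_gt0// exprn_gt0.
have [small|large] := ltP (b%:R * lambda ^+ j) s0.
  apply: (@dist0_small R C b lambda l0 oddC p q) => //.
  set s := b%:R * lambda ^+ j in small s_gt0 *.
  have js : j%:R * s <= 1 / 4.
    move: (ltW small); rewrite /s0 -[(4 * _)^-1]mul1r ler_pdivlMr; [lra|lra].
  have s4 : s <= 1 / 4 by nra.
  rewrite expr2; nra.
have b0r := ltW br.
apply: (dist0_large l0 oddC q0 p0 qp pC qC rm qE pE c1).
  rewrite leNgt; apply/negP => big.
  have l1 : lambda < 1 by lra.
  have A1 : 1 <= (1 - lambda)^-1 by rewrite invf_ge1; lra.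
  have A0 : 0 < (1 - lambda)^-1 by lra.
  have Al : (1 - lambda)^-1 * (1 - lambda) <= 1 by rewrite mulVf// gt_eqF// subr_gt0.
  have sumA : \sum_(r < j) lambda ^+ r <= (1 - lambda)^-1.
    rewrite -[leRHS]mul1r ler_pdivlMr ?subr_gt0// mulr_suml.
    exact: geometric_sum_le.
  have ll : 0 < lambda <= e by rewrite l0.
  have be : b%:R^-1 <= e by rewrite -[leRHS]invrK lef_pV2 ?posrE ?invr_gt0//; exact: Hb2.
  have lj0 : 0 < lambda ^+ j by rewrite exprn_gt0.
  have cx : c / b%:R <= (q j.-1)^-1 - 1.
    by rewrite ler_pdivrMr// mulrC ltW.
  have := Hodds b lambda _ _ b_gt0 ll be A1 Al lj0 sg _ cx.
  rewrite ltNge => /negP; apply.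
  exact: (@odds_le_UL R C b lambda l0 oddC p q).
have small : 4 * b%:R * lambda ^+ j.+1 <= 1.
  rewrite exprS; set s := b%:R * lambda ^+ j in sg s_gt0.
  have -> : 4 * b%:R * (lambda * lambda ^+ j) = 4 * s * lambda by rewrite /s; ring.
  have : 4 * gamma * lambda <= 1 by rewrite mulrC -ler_pdivlMr ?div1r//; lra.
  nra.
have sr : s0 <= b%:R * lambda ^+ j <= gamma by rewrite large.
apply: (@le_trans _ _ (K * lambda)); last by rewrite mulrC -ler_pdivlMr.
apply: le_trans (HK b lambda b_gt0 l0 sr); apply: ler_wpM2l; first exact: exprn_ge0.
exact: (@tailw_exp R C b lambda l0 oddC p q).
Qed.

End PartTwo.

(* The separation of fixed points fails for fixed b as lambda tends to 1, so its
   threshold is uniform on lambda <= lambda_max for each lambda_max < 1; the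
   threshold for phase coexistence depends on gamma and C alone. *)
Theorem theorem4p1 (R : realType) (C : nat) (hC1 : (1 <= C)%N) (hC : odd C) :
  (forall gamma : R, expR 1 < gamma ->
     (forall lambda_max : R, lambda_max < 1 ->
        exists b0 : nat, forall b : nat, (2 <= b)%N -> (b0 <= b)%N ->
        forall lambda : R, 0 < lambda ->
          (gamma / b%:R) `^ (jc C)%:R^-1 <= lambda -> lambda <= lambda_max ->
          fixpoints_separated C b lambda)
     /\
     (exists b0 : nat, forall b : nat, (2 <= b)%N -> (b0 <= b)%N ->
        forall lambda : R, 0 < lambda ->
          (gamma / b%:R) `^ (jc C)%:R^-1 <= lambda -> lambda < 1 ->
          phase_coexistence C (@tree_edge b) lambda))
  /\
  (forall gamma' : R, 0 < gamma' -> gamma' < expR 1 ->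
     exists b0 : nat, forall b : nat, (2 <= b)%N -> (b0 <= b)%N ->
     forall lambda : R, 0 < lambda ->
       lambda <= (gamma' / b%:R) `^ (jc C)%:R^-1 ->
       unique_gibbs C (@tree_edge b) lambda).
Proof.
have E1 : 1 < expR 1 :> R by rewrite -expR0 ltr_expR.
split => [gamma gE|gamma' g0 gE].
  split; last exact: coexistence_large.
  by move=> lambda_max; exact: fixpoints_separated_large.
(* Raising gamma' to at least 1 keeps it below e and makes ln gamma nonnegative, as [no_large_odds]
   assumes. *)
have [||b0 H] := @unique_gibbs_small R C (Num.max 1 gamma') hC.
- by rewrite le_max lexx.
- by rewrite gt_max E1.
exists b0 => b b2 bb lambda l0 ll; apply: H => //.
apply: (@le_trans _ _ gamma'); last by rewrite le_max lexx orbT.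
by apply: le_powR_root ll; [exact: jc_gt0|exact: leq_trans b2|exact: ltW|].
Qed.
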